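(* Let $(X,\phi)$ and $(Y,\psi)$ be irreducible Smale spaces with $X$ and $Y$ infinite. Then the following assertions are equivalent: (i) $(X,\phi)$ and $(Y,\psi)$ are asymptotically conjugate. (ii) There exists an isomorphism $\varphi:G_\phi^a\rtimes\mathbb{Z}\to G_\psi^a\rtimes\mathbb{Z}$ of étale groupoids such that $d_\psi\circ\varphi=d_\phi$. (iii) There exists an isomorphism $\Phi:\mathcal{R}_\phi^a\to\mathcal{R}_\psi^a$ of $C^*$-algebras such that $\Phi(C(X))=C(Y)$ and $\Phi\circ\rho^\phi_t=\rho^\psi_t\circ\Phi$ for all $t\in\mathbb{T}$.
   Context: Smale spaces. Let $\phi$ be a homeomorphism of a compact metric space $(X,d)$. For $\epsilon>0$ put $\Delta_\epsilon=\{(x,y)\in X\times X: d(x,y)<\epsilon\}$. $(X,\phi)$ is a Smale space if there are $\epsilon_0>0$, $0<\lambda_0<1$ and a continuous map $[\cdot,\cdot]:\Delta_{\epsilon_0}\to X$ such that: (SS1) $[x,x]=x$; $[[x,y],z]=[x,[y,z]]=[x,z]$ whenever $(x,y),(y,z),(x,z),([x,y],z),(x,[y,z])\in\Delta_{\epsilon_0}$; $[\phi(x),\phi(y)]=\phi([x,y])$ whenever $(x,y),(\phi(x),\phi(y))\in\Delta_{\epsilon_0}$; (SS2) with $X^s(x,\epsilon)=\{y: [y,x]=y,\ d(x,y)<\epsilon\}$ and $X^u(x,\epsilon)=\{y:[x,y]=y,\ d(x,y)<\epsilon\}$ for $0<\epsilon\le\epsilon_0$, one has $d(\phi(y),\phi(z))\le\lambda_0d(y,z)$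 for $y,z\in X^s(x,\epsilon)$ and $d(\phi^{-1}(y),\phi^{-1}(z))\le\lambda_0d(y,z)$ for $y,z\in X^u(x,\epsilon)$. It is irreducible if for every ordered pair of (nonempty) open sets $U,V\subset X$ there is $K\in\mathbb{N}$ with $\phi^K(U)\cap V\ne\emptyset$. Groupoids. Put $G_\phi^{s,0}=\{(x,y): y\in X^s(x,\epsilon_0)\}$, $G_\phi^{u,0}=\{(x,y): y\in X^u(x,\epsilon_0)\}$, and for $n\ge0$ put $G_\phi^{s,n}=(\phi\times\phi)^{-n}(G_\phi^{s,0})$, $G_\phi^{u,n}=(\phi\times\phi)^n(G_\phi^{u,0})$, $G_\phi^{a,n}=G_\phi^{s,n}\cap G_\phi^{u,n}$, with the relative topology from $X\times X$. These increase with $n$; $G_\phi^a=\bigcup_nG_\phi^{a,n}$ carries the inductive limit topology. As a set, $G_\phi^a=\{(x,y): \lim_{n\to\infty}d(\phi^n(x),\phi^n(y))=\lim_{n\to\infty}d(\phi^{-n}(x),\phi^{-n}(y))=0\}$, an equivalence relation viewed as a groupoid. Let $G_\phi^a\rtimes\mathbb{Z}=\{(x,n,y)\in X\times\mathbb{Z}\times X:(\phi^n(x),y)\in G_\phi^a\}$, with topology transported from the product $G_\phi^a\times\mathbb{Z}$ by the bijection $(x,n,y)\mapsto((x,\phi^{-n}(y)),n)$, operations $(x,n,y)(y,m,w)=(x,n+m,w)$, $(x,n,y)^{-1}=(y,-n,x)$, range $r(x,n,y)=(x,0,x)$, source $s(x,n,y)=(y,0,y)$. It is étale and amenable; its unit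 space is identified with $X$ via $(x,0,x)\leftrightarrow x$. An isomorphism of étale groupoids is a groupoid isomorphism which is a homeomorphism. Let $d_\phi:G_\phi^a\rtimes\mathbb{Z}\to\mathbb{Z}$, $d_\phi(x,n,z)=n$, a continuous homomorphism; $d_\psi$ is defined similarly. Asymptotic conjugacy. $(X,\phi)$ and $(Y,\psi)$ are asymptotically conjugate if they are asymptotically continuously orbit equivalent with cocycle functions $c_1\equiv1$, $c_2\equiv1$, $d_1\equiv0$, $d_2\equiv0$; that is, if there is a homeomorphism $h:X\to Y$ such that: for each $n\in\mathbb{Z}$, $x\mapsto(\psi^n(h(x)),h(\phi^n(x)))$ is a continuous map from $X$ into $G_\psi^a$; for each $n\in\mathbb{Z}$, $y\mapsto(\phi^n(h^{-1}(y)),h^{-1}(\psi^n(y)))$ is a continuous map from $Y$ into $G_\phi^a$; $(x,z)\mapsto(h(x),h(z))$ is a continuous map from $G_\phi^a$ into $G_\psi^a$; and $(y,w)\mapsto(h^{-1}(y),h^{-1}(w))$ is a continuous map from $G_\psi^a$ into $G_\phi^a$. $C^*$-algebras. $\mathcal{R}_\phi^a=C^*(G_\phi^a\rtimes\mathbb{Z})$ is the groupoid $C^*$-algebra (full and reduced coincide), realized as the closure of $C_c(G_\phi^a\rtimes\mathbb{Z})$ acting by left convolution on the Hilbert $C(X)$-module $l^2(G_\phi^a\rtimes\mathbb{Z})$, the completion of $C_c(G_\phi^a\rtimes\mathbb{Z})$ for $\langle\xi,\eta\rangle(x)=\sum_{s(\gamma)=x}\overline{\xi(\gamma)}\eta(\gamma)$.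 $C(X)$ is the subalgebra of functions supported on the (clopen) unit space. $\mathbb{T}=\mathbb{R}/\mathbb{Z}$. The dual action is $\rho^\phi_t=\operatorname{Ad}(U^\phi_t)$, where $[U^\phi_t\xi](x,n,z)=\exp(2\pi\sqrt{-1}nt)\xi(x,n,z)$; it leaves $\mathcal{R}_\phi^a$ invariant. The same notation is used for $(Y,\psi)$. *)

(* Defs.v *)
From HB Require Import structures.
From mathcomp Require Import all_boot all_order all_algebra.
From mathcomp Require Import all_classical all_reals all_analysis.
From mathcomp Require Import complex ring lra.
From mathcomp Require summability.

Set Implicit Arguments.
Unset Strict Implicit.
Unset Printing Implicit Defensive.
Import Order.TTheory GRing.Theory Num.Theory.
Import numFieldNormedType.Exports.
Local Open Scope classical_set_scope.
Local Open Scope ring_scope.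
Local Open Scope complex_scope.

Record homeo (X Y : topologicalType) := Homeo {
  hfun :> X -> Y;
  hinv : Y -> X;
  hfunK : cancel hfun hinv;
  hinvK : cancel hinv hfun;
  hfun_cont : continuous hfun;
  hinv_cont : continuous hinv }.

Definition iterz (X : topologicalType) (f : homeo X X) (n : int) : X -> X :=
  match n with
  | Posz n => iter n f
  | Negz n => iter n.+1 (hinv f)
  end.

Section Iterz.
Context (X : topologicalType) (f : homeo X X).

Lemma iterzSr n x : iterz f (n + 1) x = iterz f n (f x).
Proof.
case: n => [n|[|n]].
- by rewrite -PoszD addn1 /= -iterS iterSr.
- by rewrite /= hfunK.
- have -> : Negz n.+1 + 1 = Negz n by rewrite !NegzE -addn1 PoszD opprD addrNK.
  by rewrite /iterz (iterSr n.+1) hfunK.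
Qed.

Lemma iterzBr n x : iterz f (n - 1) x = iterz f n (hinv f x).
Proof. by rewrite -[in RHS](subrK 1 n) iterzSr hinvK. Qed.

Lemma iterzD m n x : iterz f (m + n) x = iterz f m (iterz f n x).
Proof.
elim: n x => [|n IH|n IH] x; first by rewrite addr0.
- by rewrite -addn1 PoszD addrA !iterzSr IH.
- by rewrite -addn1 PoszD opprD addrA !iterzBr IH.
Qed.

Lemma iterzK n x : iterz f (- n) (iterz f n x) = x.
Proof. by rewrite -iterzD addNr. Qed.

Lemma iterzNK n x : iterz f n (iterz f (- n) x) = x.
Proof. by rewrite -iterzD subrr. Qed.

End Iterz.

Definition Delta (R : realType) (X : metricType R) (e : R) : set (X * X) :=
  [set p | mdist p.1 p.2 < e].

(* [bracket] is total, but only its values on [Delta eps0] are constrained, and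
   only those are used below. *)
Definition stable_set (R : realType) (X : metricType R)
    (bracket : X -> X -> X) (x : X) (e : R) : set X :=
  [set y | bracket y x = y /\ mdist x y < e].

Definition unstable_set (R : realType) (X : metricType R)
    (bracket : X -> X -> X) (x : X) (e : R) : set X :=
  [set y | bracket x y = y /\ mdist x y < e].

Record smale (R : realType) (X : metricType R) := Smale {
  smap :> homeo X X;
  eps0 : R;
  lambda0 : R;
  bracket : X -> X -> X;
  smale_compact : compact [set: X];
  eps0_gt0 : 0 < eps0;
  lambda0_gt0 : 0 < lambda0;
  lambda0_lt1 : lambda0 < 1;
  bracket_cont :
    {within Delta eps0, continuous (fun p : X * X => bracket p.1 p.2)};
  bracketxx : forall x, bracket x x = x;
  bracketA : forall x y z,
    Delta eps0 (x, y) -> Delta eps0 (y, z) -> Delta eps0 (x, z) ->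
    Delta eps0 (bracket x y, z) -> Delta eps0 (x, bracket y z) ->
    bracket (bracket x y) z = bracket x z /\
    bracket x (bracket y z) = bracket x z;
  bracket_smap : forall x y,
    Delta eps0 (x, y) -> Delta eps0 (smap x, smap y) ->
    bracket (smap x) (smap y) = smap (bracket x y);
  stable_contract : forall x e y z, 0 < e -> e <= eps0 ->
    stable_set bracket x e y -> stable_set bracket x e z ->
    mdist (smap y) (smap z) <= lambda0 * mdist y z;
  unstable_contract : forall x e y z, 0 < e -> e <= eps0 ->
    unstable_set bracket x e y -> unstable_set bracket x e z ->
    mdist (hinv smap y) (hinv smap z) <= lambda0 * mdist y z }.

Definition irreducible (R : realType) (X : metricType R) (S : smale X) : Prop :=
  forall U V : set X, open U -> open V -> U !=set0 -> V !=set0 ->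
    exists K : nat, (iter K S @` U) `&` V !=set0.

Section Asymptotic.
Context (R : realType) (X : metricType R) (S : smale X).

Definition Gs0 : set (X * X) :=
  [set p | stable_set (bracket S) p.1 (eps0 S) p.2].

Definition Gu0 : set (X * X) :=
  [set p | unstable_set (bracket S) p.1 (eps0 S) p.2].

Definition Gs (n : nat) : set (X * X) :=
  (fun p => (iter n S p.1, iter n S p.2)) @^-1` Gs0.

Definition Gu (n : nat) : set (X * X) :=
  (fun p => (iter n S p.1, iter n S p.2)) @` Gu0.

Definition Ga (n : nat) : set (X * X) := Gs n `&` Gu n.

Definition asym_set : set (X * X) := \bigcup_n Ga n.

Definition asym : Type := set_type asym_set.

End Asymptotic.

HB.instance Definition _ (R : realType) (X : metricType R) (S : smale X) :=
  Choice.on (asym S).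

Section AsymTopology.
Context (R : realType) (X : metricType R) (S : smale X).

(* inductive limit topology: U is open iff each U `&` Ga n is open in Ga n *)
Definition asym_open : set_system (asym S) :=
  [set U | forall n, exists2 O : set (X * X), open O &
    forall p : asym S, Ga S n (val p) -> (U p <-> O (val p))].

Lemma asym_openT : asym_open setT.
Proof. by move=> n; exists setT => //; exact: openT. Qed.

Lemma asym_openI : setI_closed asym_open.
Proof.
move=> U V oU oV n; have [W oW UW] := oU n; have [P oP VP] := oV n.
exists (W `&` P); first exact: openI.
by move=> p pn; split=> -[/(UW p pn) ? /(VP p pn) ?].
Qed.

Lemma asym_open_bigU (I : Type) (F : I -> set (asym S)) :
  (forall i, asym_open (F i)) -> asym_open (\bigcup_i F i).
Proof.
move=> oF n.
have oP (i : I) : exists O : set (X * X), open O /\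
    forall p : asym S, Ga S n (val p) -> (F i p <-> O (val p)).
  by have [W oW WP] := oF i n; exists W.
have [W WP] := choice oP.
exists (\bigcup_i W i); first by apply: bigcup_open => i _; have [] := WP i.
move=> p pn; split=> -[i _ ip]; exists i => //.
- by apply/(WP i).2.
- by apply/((WP i).2 p).
Qed.

End AsymTopology.

HB.instance Definition _ (R : realType) (X : metricType R) (S : smale X) :=
  isOpenTopological.Build (asym S)
    (@asym_openT R X S) (@asym_openI R X S) (@asym_open_bigU R X S).

(* The pairs that some iterate of f brings into r, when f contracts r. *)
Section Eventually.
Context (R : realType) (X : metricType R) (f : X -> X) (r : X -> X -> Prop).
Variables (e d l : R).
Hypotheses (e0 : 0 < e) (d0 : 0 < d) (l0 : 0 < l) (l1 : l < 1).
Hypothesis r_refl : forall x, r x x.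
Hypothesis r_dist : forall x y, r x y -> mdist x y < e.
Hypothesis r_step :
  forall x y, r x y -> r (f x) (f y) /\ mdist (f x) (f y) <= l * mdist x y.
Hypothesis r_sym : forall x y, mdist x y < d -> r x y -> r y x.
Hypothesis r_trans : forall x y z, mdist x z < e -> r x y -> r y z -> r x z.

Definition evr x y := exists n, r (iter n f x) (iter n f y).

Lemma r_iter n x y : r x y ->
  r (iter n f x) (iter n f y) /\
  mdist (iter n f x) (iter n f y) <= l ^+ n * mdist x y.
Proof.
move=> xy; elim: n => [|n [IH1 IH2]]; first by rewrite expr0 mul1r.
have [H1 H2] := r_step IH1; split => //.
rewrite (le_trans H2)// exprS -mulrA ler_wpM2l// ltW//.
Qed.

Lemma evr_mono m n x y : (m <= n)%N ->
  r (iter m f x) (iter m f y) -> r (iter n f x) (iter n f y).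
Proof. by move=> mn /(r_iter (n - m))[]; rewrite -!iterD subnK. Qed.

Lemma evr_small c x y : 0 < c -> evr x y -> exists m, forall n, (m <= n)%N ->
  r (iter n f x) (iter n f y) /\ mdist (iter n f x) (iter n f y) < c.
Proof.
move=> c0 [m xy].
set D := mdist (iter m f x) (iter m f y).
have D0 : 0 <= D by exact: mdist_ge0.
have : geometric D l k @[k --> \oo] --> 0.
  by apply: cvg_geometric; rewrite ger0_norm// ltW.
move/cvgrPdist_lt => /(_ c c0)[k _ kP].
exists (m + k)%N => n mkn.
have mn : (m <= n)%N by rewrite (leq_trans _ mkn)// leq_addr.
have [] := r_iter (n - m) xy; rewrite -!iterD subnK// => H1 H2; split => //.
have /= := kP (n - m)%N; rewrite leq_subRL// => /(_ mkn).
rewrite sub0r normrN ger0_norm ?mulr_ge0 ?exprn_ge0 ?(ltW l0)//.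
by apply: le_lt_trans; rewrite mulrC.
Qed.

Lemma evr_refl x : evr x x. Proof. by exists 0%N. Qed.

Lemma evr_sym x y : evr x y -> evr y x.
Proof.
move=> /(evr_small d0)[m /(_ m (leqnn _))[H1 H2]]; exists m.
exact: r_sym.
Qed.

Lemma evr_trans x y z : evr x y -> evr y z -> evr x z.
Proof.
have e2 : 0 < e / 2 by rewrite divr_gt0.
move=> /(evr_small e2)[m mP] /(evr_small e2)[n nP].
have [H1 H2] := mP (maxn m n) (leq_maxl _ _).
have [H3 H4] := nP (maxn m n) (leq_maxr _ _).
exists (maxn m n); apply: r_trans H1 H3.
rewrite (le_lt_trans (metric_triangle _ (iter (maxn m n) f y) _))//.
by rewrite (splitr e) ltrD.
Qed.

Lemma evr_f x y : evr x y -> evr (f x) (f y).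
Proof. by move=> [n xy]; exists n; rewrite -!iterSr; have [] := r_step xy. Qed.

Lemma evr_finv g x y : cancel g f -> evr x y -> evr (g x) (g y).
Proof. by move=> gK [n xy]; exists n.+1; rewrite !iterSr !gK. Qed.

End Eventually.

Section AsymEquivalence.
Context (R : realType) (X : metricType R) (S : smale X).
Let e := eps0 S.
Let s x y := Gs0 S (x, y).
Let u x y := Gu0 S (x, y).

Lemma bracket_near : exists2 d : R, 0 < d & forall x y : X, mdist x y < d ->
  mdist (bracket S x y) x < e /\ mdist (bracket S x y) y < e.
Proof.
have e0 : 0 < e := eps0_gt0 S.
have e2 : 0 < e / 2 by rewrite divr_gt0.
have e4 : 0 < e / 2 / 2 by rewrite divr_gt0.
pose P (d : R) (x : X) := forall y : X, mdist x y < d ->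
  mdist (bracket S x y) x < e /\ mdist (bracket S x y) y < e.
have near_p (p : X) : \forall x \near p & d \near 0^'+, P d x.
  have /subspace_continuousP/(_ (p, p)) := bracket_cont (s := S).
  rewrite {1}/Delta/= mdistxx => /(_ e0) /= bc.
  have : nbhs (bracket S p p) (ball p (e / 2)).
    by rewrite bracketxx; exact: nbhsx_ballx.
  move=> /bc; rewrite /= nbhs_simpl/= withinE => -[V /nbhs_ballP[r /= r0 rV] VE].
  pose c := Num.min (r / 2) (e / 2 / 2).
  have c0 : 0 < c by rewrite lt_min !divr_gt0.
  near=> x d.
  have px : mdist p x < c.
    by have : ball p c x; [near: x; exact: nbhsx_ballx|rewrite ballEmdist].
  have dc : d <= c by near: d; exact: nbhs_right_le.
  move=> y /lt_le_trans/(_ dc) xy; move: px xy; rewrite !lt_min => /andP[pxr pxe] /andP[xyr xye].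
  have re : r / 2 < r by rewrite ltr_pdivrMr// ltr_pMr// ltr1n.
  have ee : e / 2 < e by rewrite ltr_pdivrMr// ltr_pMr// ltr1n.
  have eee : e / 2 / 2 < e / 2 by rewrite ltr_pdivrMr// ltr_pMr// ltr1n.
  have py : mdist p y < r.
    by rewrite (le_lt_trans (metric_triangle _ x _))// (splitr r) ltrD.
  have Vxy : V (x, y).
    by apply: rV; split => /=; rewrite ballEmdist//= (lt_trans pxr).
  have Dxy : Delta (eps0 S) (x, y) by rewrite /Delta/= (lt_trans xye)// (lt_trans eee).
  have [] : ((fun q : X * X => bracket S q.1 q.2) @^-1` ball p (e / 2)
    `&` Delta (eps0 S)) (x, y) by rewrite VE.
  rewrite /= ballEmdist/= metric_sym => bp _.
  have bx : mdist (bracket S x y) x < e / 2 + e / 2 / 2.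
    by rewrite (le_lt_trans (metric_triangle _ p _))// ltrD.
  split; first by rewrite (lt_trans bx)// [ltRHS]splitr ltrD2l.
  rewrite (le_lt_trans (metric_triangle _ x _))// [ltRHS]splitr.
  by rewrite [X in _ < _ + X]splitr addrA ltrD.
have /compact_near_coveringP cX := @smale_compact _ _ S.
have [d d0 dP] := cX R 0^'+ P _ (fun p _ => near_p p).
exists (d / 2); first by rewrite divr_gt0.
move=> x y xy; apply: (dP (d / 2)) => //=; last by rewrite divr_gt0.
by rewrite sub0r normrN gtr0_norm ?divr_gt0// ltr_pdivrMr// ltr_pMr// ltr1n.
Unshelve. all: by end_near. Qed.

Let step_s x y : s x y ->
  s (S x) (S y) /\ mdist (S x) (S y) <= lambda0 S * mdist x y.
Proof.
move=> [/= yx dxy].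
have e0 := eps0_gt0 S.
have xs : stable_set (bracket S) x (eps0 S) x.
  by split; rewrite ?bracketxx ?mdistxx.
have H : mdist (S x) (S y) <= lambda0 S * mdist x y.
  exact: (stable_contract e0 (lexx _) xs (conj yx dxy)).
have H' : mdist (S x) (S y) < eps0 S.
  apply: (le_lt_trans H); apply: le_lt_trans dxy.
  by rewrite ler_piMl ?mdist_ge0// ltW// lambda0_lt1.
split => //; split => //=; rewrite bracket_smap ?yx//; rewrite /Delta/=.
- by rewrite metric_sym.
- by rewrite metric_sym.
Qed.

Let step_u x y : u x y ->
  u (hinv S x) (hinv S y) /\
  mdist (hinv S x) (hinv S y) <= lambda0 S * mdist x y.
Proof.
move=> [/= xy dxy].
have e0 := eps0_gt0 S.
have xu : unstable_set (bracket S) x (eps0 S) x.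
  by split; rewrite ?bracketxx ?mdistxx.
have H : mdist (hinv S x) (hinv S y) <= lambda0 S * mdist x y.
  exact: (unstable_contract e0 (lexx _) xu (conj xy dxy)).
have H' : mdist (hinv S x) (hinv S y) < eps0 S.
  apply: (le_lt_trans H); apply: le_lt_trans dxy.
  by rewrite ler_piMl ?mdist_ge0// ltW// lambda0_lt1.
split => //; split => //=.
have := @bracket_smap _ _ S (hinv S x) (hinv S y) H'.
rewrite !hinvK => /(_ dxy); rewrite xy => yE.
by rewrite [in RHS]yE hfunK.
Qed.

Let refl_s x : s x x.
Proof. by split; rewrite /= ?bracketxx ?mdistxx ?eps0_gt0. Qed.

Let refl_u x : u x x.
Proof. by split; rewrite /= ?bracketxx ?mdistxx ?eps0_gt0. Qed.

Let sym_s d x y : (forall x y : X, mdist x y < d ->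
    mdist (bracket S x y) x < e /\ mdist (bracket S x y) y < e) ->
  mdist x y < d -> s x y -> s y x.
Proof.
move=> dP dxy [/= yx xy].
have yx' : mdist y x < eps0 S by rewrite metric_sym.
split=> //=; have [] := @bracketA _ _ S x y x; rewrite /Delta/= ?mdistxx ?yx//.
- exact: eps0_gt0.
- by have [] := dP _ _ dxy.
- by move=> _ ->; rewrite bracketxx.
Qed.

Let sym_u d x y : (forall x y : X, mdist x y < d ->
    mdist (bracket S x y) x < e /\ mdist (bracket S x y) y < e) ->
  mdist x y < d -> u x y -> u y x.
Proof.
move=> dP; rewrite metric_sym => dyx [/= yx xy].
have yx' : mdist y x < eps0 S by rewrite metric_sym.
split=> //=; have [] := @bracketA _ _ S x y x; rewrite /Delta/= ?mdistxx ?yx//.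
- exact: eps0_gt0.
- by rewrite metric_sym; have [] := dP _ _ dyx.
- by move=> ->; rewrite bracketxx.
Qed.

Let trans_s x y z : mdist x z < eps0 S -> s x y -> s y z -> s x z.
Proof.
move=> xz [/= yx xy] [/= zy yz]; split=> //=.
have [] := @bracketA _ _ S z y x; rewrite /Delta/= ?zy ?yx.
- by rewrite metric_sym.
- by rewrite metric_sym.
- by rewrite metric_sym.
- by rewrite metric_sym.
- by rewrite metric_sym.
- by move=> _ <-; rewrite zy.
Qed.

Let trans_u x y z : mdist x z < eps0 S -> u x y -> u y z -> u x z.
Proof.
move=> xz [/= xy dxy] [/= yz dyz]; split=> //=.
by have [] := @bracketA _ _ S x y z; rewrite /Delta/= ?xy ?yz// => <-.
Qed.

Let dist_s x y : s x y -> mdist x y < eps0 S. Proof. by case. Qed.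
Let dist_u x y : u x y -> mdist x y < eps0 S. Proof. by case. Qed.

Lemma GuE n x y :
  Gu S n (x, y) <-> u (iter n (hinv S) x) (iter n (hinv S) y).
Proof.
have iK z : iter n (hinv S) (iter n S z) = z.
  by elim: n z => //= n IH z; rewrite -iterS iterSr hfunK.
have iK' z : iter n S (iter n (hinv S) z) = z.
  by elim: n z {iK} => //= n IH z; rewrite -iterS iterSr hinvK.
split=> [[[a b] ab [<- <-]]|xy]; first by rewrite !iK.
by exists (iter n (hinv S) x, iter n (hinv S) y); rewrite //= !iK'.
Qed.

Lemma asym_setP x y : asym_set S (x, y) <->
  evr S s x y /\ evr (hinv S) u x y.
Proof.
split=> [[n _ [sn /GuE un]]|[[m sm] [n un]]]; first by split; exists n.
have l0 := lambda0_gt0 S.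
exists (maxn m n) => //; split.
  exact: (evr_mono l0 step_s (leq_maxl _ _) sm).
by apply/GuE; exact: (evr_mono l0 step_u (leq_maxr _ _) un).
Qed.

Lemma asym_refl x : asym_set S (x, x).
Proof. by apply/asym_setP; split; exists 0%N. Qed.

Lemma asym_sym x y : asym_set S (x, y) -> asym_set S (y, x).
Proof.
have [d d0 dP] := bracket_near.
have l0 := lambda0_gt0 S; have l1 := lambda0_lt1 S.
move=> /asym_setP[sxy uxy]; apply/asym_setP; split.
- apply: (evr_sym d0 l0 l1 step_s _ sxy) => a b; exact: sym_s.
- apply: (evr_sym d0 l0 l1 step_u _ uxy) => a b; exact: sym_u.
Qed.

Lemma asym_trans x y z :
  asym_set S (x, y) -> asym_set S (y, z) -> asym_set S (x, z).
Proof.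
have l0 := lambda0_gt0 S; have l1 := lambda0_lt1 S; have e0 := eps0_gt0 S.
move=> /asym_setP[sxy uxy] /asym_setP[syz uyz]; apply/asym_setP; split.
- exact: (evr_trans e0 l0 l1 step_s trans_s sxy syz).
- exact: (evr_trans e0 l0 l1 step_u trans_u uxy uyz).
Qed.

Lemma asym_iterz n x y :
  asym_set S (x, y) -> asym_set S (iterz S n x, iterz S n y).
Proof.
have fwd a b : asym_set S (a, b) -> asym_set S (S a, S b).
  move=> /asym_setP[H1 H2]; apply/asym_setP; split; first exact: (evr_f step_s H1).
  by apply: evr_finv H2; exact: hfunK.
have bwd a b : asym_set S (a, b) -> asym_set S (hinv S a, hinv S b).
  move=> /asym_setP[H1 H2]; apply/asym_setP; split; last exact: (evr_f step_u H2).
  by apply: evr_finv H1; exact: hinvK.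
elim: n x y => [//|n IH|n IH] x y xy.
- by rewrite -addn1 PoszD !iterzSr; apply: IH; exact: fwd.
- by rewrite -addn1 PoszD opprD !iterzBr; apply: IH; exact: bwd.
Qed.

End AsymEquivalence.

(* [gmul a b] is meaningful only when [src a = rng b]; units are identified
   with their identity arrows. *)
Record groupoid := Groupoid {
  arrow :> topologicalType;
  rng : arrow -> arrow;
  src : arrow -> arrow;
  ginv : arrow -> arrow;
  gmul : arrow -> arrow -> arrow;
  rng_gmul : forall a b, src a = rng b -> rng (gmul a b) = rng a;
  src_gmul : forall a b, src a = rng b -> src (gmul a b) = src b;
  rng_ginv : forall a, rng (ginv a) = src a;
  src_ginv : forall a, src (ginv a) = rng a;
  gmulA : forall a b c, src a = rng b -> src b = rng c ->
    gmul a (gmul b c) = gmul (gmul a b) c;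
  gmul_rng : forall a, gmul (rng a) a = a;
  gmul_src : forall a, gmul a (src a) = a;
  gmulV : forall a, gmul a (ginv a) = rng a;
  gmulVr : forall a, gmul (ginv a) a = src a }.

Definition units (G : groupoid) : set G := range (@rng G).

Definition groupoid_iso (G H : groupoid) (h : homeo G H) : Prop :=
  forall a b : G, (src a = rng b <-> src (h a) = rng (h b)) /\
    (src a = rng b -> h (gmul a b) = gmul (h a) (h b)).

Section Crossed.
Context (R : realType) (X : metricType R) (S : smale X).

Definition crossed_set : set (X * int * X) :=
  [set g | asym_set S (iterz S g.1.2 g.1.1, g.2)].

Definition crossed : Type := set_type crossed_set.

HB.instance Definition _ := Choice.on crossed.

Definition mk_crossed x n y (h : asym_set S (iterz S n x, y)) : crossed :=
  exist _ (x, n, y) (mem_set h : (x, n, y) \in crossed_set).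

Lemma crossedP (g : crossed) :
  asym_set S (iterz S (val g).1.2 (val g).1.1, (val g).2).
Proof. exact: (set_mem (valP g)). Qed.

Lemma untwist_subproof (g : crossed) :
  asym_set S ((val g).1.1, iterz S (- (val g).1.2) (val g).2).
Proof.
have /(asym_iterz (- (val g).1.2)) := crossedP g.
by rewrite iterzK.
Qed.

Definition untwist (g : crossed) : asym S * discrete_topology int :=
  (exist _ ((val g).1.1, iterz S (- (val g).1.2) (val g).2)
     (mem_set (untwist_subproof g)),
   (val g).1.2).

Lemma untwist_bij : bijective untwist.
Proof.
have P (q : asym S * discrete_topology int) : asym_set S
    (iterz S (q.2 : int) (val q.1).1, iterz S (q.2 : int) (val q.1).2).
  by apply: asym_iterz; rewrite -surjective_pairing; exact: (set_mem (valP q.1)).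
exists (fun q => mk_crossed (P q)).
- by move=> g; apply: val_inj; rewrite /= iterzNK; case: (val g) => -[].
- move=> [[[x y] p] n]; rewrite /untwist/=; congr (_, _).
  by apply: val_inj; rewrite /= iterzK.
Qed.

(* As [untwist] is a bijection, this is the transported topology. *)
HB.instance Definition _ :=
  Topological.copy crossed (initial_topology untwist).

Definition crossed_rng (g : crossed) : crossed :=
  @mk_crossed (val g).1.1 0 (val g).1.1 (asym_refl S _).

Definition crossed_src (g : crossed) : crossed :=
  @mk_crossed (val g).2 0 (val g).2 (asym_refl S _).

Lemma crossed_inv_subproof (g : crossed) :
  asym_set S (iterz S (- (val g).1.2) (val g).2, (val g).1.1).
Proof. exact: asym_sym (untwist_subproof g). Qed.

Definition crossed_inv (g : crossed) : crossed :=
  mk_crossed (crossed_inv_subproof g).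

Lemma crossed_mul_subproof (a b : crossed) : (val a).2 = (val b).1.1 ->
  asym_set S (iterz S ((val a).1.2 + (val b).1.2) (val a).1.1, (val b).2).
Proof.
move=> ab; have /(asym_iterz (val b).1.2) := crossedP a.
rewrite -iterzD addrC ab => /asym_trans; apply; exact: crossedP.
Qed.

Definition crossed_mul (a b : crossed) : crossed :=
  match pselect ((val a).2 = (val b).1.1) with
  | left ab => mk_crossed (crossed_mul_subproof ab)
  | right _ => a
  end.

Lemma crossed_composable (a b : crossed) :
  crossed_src a = crossed_rng b <-> (val a).2 = (val b).1.1.
Proof.
split=> [/(congr1 val)[]//|ab].
by apply: val_inj => /=; rewrite ab.
Qed.

Lemma val_crossed_mul (a b : crossed) : (val a).2 = (val b).1.1 ->
  val (crossed_mul a b) =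
    ((val a).1.1, (val a).1.2 + (val b).1.2, (val b).2).
Proof. by rewrite /crossed_mul; case: pselect. Qed.

Definition dcrossed (g : crossed) : int := (val g).1.2.

Lemma dcrossed_cont : continuous (dcrossed : crossed -> discrete_topology int).
Proof.
move=> g; apply: (@continuous_comp _ _ _ untwist snd).
  exact: initial_continuous.
exact: cvg_snd.
Qed.

End Crossed.

Section CrossedGroupoid.
Context (R : realType) (X : metricType R) (S : smale X).
Let G : topologicalType := crossed S.
Let r : G -> G := @crossed_rng _ _ S.
Let s : G -> G := @crossed_src _ _ S.
Let i : G -> G := @crossed_inv _ _ S.
Let m : G -> G -> G := @crossed_mul _ _ S.

Let rng_mul a b : s a = r b -> r (m a b) = r a.
Proof.
move=> /crossed_composable ab.
by apply: val_inj; rewrite /= val_crossed_mul.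
Qed.

Let src_mul a b : s a = r b -> s (m a b) = s b.
Proof.
move=> /crossed_composable ab.
by apply: val_inj; rewrite /= val_crossed_mul.
Qed.

Let rng_inv a : r (i a) = s a. Proof. exact: val_inj. Qed.
Let src_inv a : s (i a) = r a. Proof. exact: val_inj. Qed.

Let mulA a b c : s a = r b -> s b = r c -> m a (m b c) = m (m a b) c.
Proof.
move=> /crossed_composable ab /crossed_composable bc.
by apply: val_inj; rewrite !val_crossed_mul //= ?val_crossed_mul//= addrA.
Qed.

Let mul_rng a : m (r a) a = a.
Proof.
apply: val_inj; rewrite val_crossed_mul//= add0r.
by case: (val a) => -[].
Qed.

Let mul_src a : m a (s a) = a.
Proof.
apply: val_inj; rewrite val_crossed_mul//= addr0.
by case: (val a) => -[].
Qed.

Let mulV a : m a (i a) = r a.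
Proof. by apply: val_inj; rewrite val_crossed_mul//= subrr. Qed.

Let mulVr a : m (i a) a = s a.
Proof. by apply: val_inj; rewrite val_crossed_mul//= addNr. Qed.

Definition crossed_groupoid : groupoid :=
  Groupoid rng_mul src_mul rng_inv src_inv mulA mul_rng mul_src mulV mulVr.

End CrossedGroupoid.

Section L2.
Context (R : realType) (G : groupoid).

Definition Cc : set (G -> R[i]^o) :=
  [set f | continuous f /\ compact (closure [set g | f g != 0])].

Definition sqmod (z : R[i]) : R := complex.Re z ^+ 2 + complex.Im z ^+ 2.

(* The square of the Hilbert C(X)-module norm, sup_u <xi, xi>(u) over the
   units u; every unit is of the form [src x]. *)
Definition sqnorm (xi : G -> R[i]^o) : \bar R :=
  ereal_sup (range (fun x : G =>
    \esum_(g in [set g | src g = src x]) (sqmod (xi g))%:E)).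

(* The functions on G with finite [sqnorm] form a Banach space, so the closure
   of [Cc] among all functions is the completion of [Cc]. *)
Definition l2_set : set (G -> R[i]^o) :=
  [set xi | forall e, 0 < e ->
    exists2 f, Cc f & (sqnorm (xi - f)%R <= e%:E)%E].

Lemma sqnorm_leP xi (e : \bar R) : reflect
  (forall x : G, \esum_(g in [set g | src g = src x]) (sqmod (xi g))%:E <= e)%E
  (sqnorm xi <= e)%E.
Proof.
apply: (iffP idP) => [H x|H].
  by apply: le_trans H; apply: ereal_sup_ubound; exists x.
by apply: ge_ereal_sup => _ [x _ <-].
Qed.

Lemma sqmod_ge0 z : 0 <= sqmod z.
Proof. by rewrite addr_ge0 ?sqr_ge0. Qed.

Lemma sqmodM z w : sqmod (z * w) = sqmod z * sqmod w.
Proof. by case: z w => a b [c d]; rewrite /sqmod/=; ring. Qed.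

Lemma sqmodD z w : sqmod (z + w) <= 2 * sqmod z + 2 * sqmod w.
Proof.
case: z w => a b [c d]; rewrite /sqmod/= -subr_ge0.
rewrite (_ : _ - _ = (a - c) ^+ 2 + (b - d) ^+ 2); last by ring.
by rewrite addr_ge0 ?sqr_ge0.
Qed.

Lemma sqnormZ (u : G -> R[i]) (k : R) xi (e : R) : 0 <= k ->
  (forall g, sqmod (u g) <= k) -> (sqnorm xi <= e%:E)%E ->
  (sqnorm (fun g => u g * xi g)%R <= (k * e)%:E)%E.
Proof.
move=> k0 uk /sqnorm_leP xe; apply/sqnorm_leP => x.
apply: ge_ereal_sup => _ [A [Afin Ax] <-].
apply: (@le_trans _ _ (\sum_(g \in A) (k%:E * (sqmod (xi g))%:E))%E).
  apply: lee_fsum => // g _; rewrite -EFinM lee_fin sqmodM.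
  by rewrite ler_wpM2r ?sqmod_ge0.
rewrite -ge0_mule_fsumr; last by move=> g; rewrite lee_fin sqmod_ge0.
rewrite EFinM lee_wpmul2l ?lee_fin//.
by apply: le_trans (xe x); apply: ereal_sup_ubound; exists A.
Qed.

Lemma sqnormD xi eta (c d : R) :
  (sqnorm xi <= c%:E)%E -> (sqnorm eta <= d%:E)%E ->
  (sqnorm (xi + eta)%R <= (2 * c + 2 * d)%:E)%E.
Proof.
move=> /sqnorm_leP xc /sqnorm_leP ed; apply/sqnorm_leP => x.
have E2 (r : R) : ((2 * r)%:E = r%:E + r%:E)%E by rewrite -EFinD mulr_natl mulr2n.
have S2 (zeta : G -> R[i]^o) (r : R) :
    (\esum_(g in [set g | src g = src x]) (sqmod (zeta g))%:E <= r%:E)%E ->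
    (\esum_(g in [set g | src g = src x]) (2 * sqmod (zeta g))%:E <=
      (2 * r)%:E)%E.
  move=> zr; rewrite E2 (eq_esum (fun g _ => E2 (sqmod (zeta g)))).
  by rewrite esumD ?leeD// => g _; rewrite lee_fin sqmod_ge0.
rewrite EFinD; apply: le_trans (leeD (S2 _ _ (xc x)) (S2 _ _ (ed x))).
rewrite -esumD; first last.
- by move=> g _; rewrite lee_fin mulr_ge0 ?sqmod_ge0.
- by move=> g _; rewrite lee_fin mulr_ge0 ?sqmod_ge0.
by apply: le_esum => g _; rewrite -EFinD lee_fin sqmodD.
Qed.

Lemma CcM (u f : G -> R[i]^o) : continuous u -> Cc f ->
  Cc (fun g => u g * f g).
Proof.
move=> cu [cf Kf]; split; first by move=> g; apply: cvgM; [exact: cu|exact: cf].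
apply: subclosed_compact Kf _; first exact: closed_closure.
apply: closureS => g /=; apply: contra_neq => ->; exact: mulr0.
Qed.

Lemma CcD f g : Cc f -> Cc g -> Cc (f + g).
Proof.
move=> [cf Kf] [cg Kg]; split; first by move=> x; apply: cvgD; [exact: cf|exact: cg].
apply: subclosed_compact (compactU Kf Kg) _; first exact: closed_closure.
rewrite -closureU; apply: closureS => x /= fg0.
have [fx0|] := eqVneq (f x) 0; last by left.
by right; apply: contra_neq fg0; rewrite /= fctE fx0 add0r.
Qed.

Lemma Cc0 : Cc (0 : G -> R[i]^o).
Proof.
split; first by move=> x; exact: cvg_cst.
rewrite (_ : [set g | _] = set0) ?closure0; first exact: compact0.
by rewrite -subset0 => x /=; rewrite eqxx.
Qed.

Definition l2_pred : {pred G -> R[i]^o} := mem l2_set.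

Lemma l2_submod_closed : submod_closed l2_pred.
Proof.
split.
  apply/mem_set => e e0; exists 0; first exact: Cc0.
  rewrite subrr; apply/sqnorm_leP => x; rewrite esum1 ?lee_fin ?ltW// => g _.
  by rewrite /sqmod/= expr0n/= addr0.
move=> a x y /set_mem lx /set_mem ly; apply/mem_set => e e0.
pose k := sqmod a; have k0 : 0 <= k := sqmod_ge0 a.
have k1 : 0 < k + 1 by rewrite ltr_wpDl.
have [|f Cf fx] := lx (e / 4 / (k + 1)); first by rewrite !divr_gt0.
have [|g Cg gy] := ly (e / 4); first by rewrite divr_gt0.
exists ((fun z => a * f z) + g).
  by apply: CcD => //; apply: (@CcM (cst a)) => // z; exact: cvg_cst.
rewrite (_ : _ - _ = (fun z => a * (x - f) z) + (y - g)); last first.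
  apply/funext => z; rewrite !fctE /=.
  by rewrite -[a *: x z]/(a * x z) opprD addrACA -mulrBr.
have := sqnormD (sqnormZ k0 (fun=> lexx _) fx) gy; move/le_trans; apply.
rewrite lee_fin.
have : k * (e / 4 / (k + 1)) <= e / 4.
  by rewrite mulrA ler_pdivrMr// mulrC ler_wpM2l ?divr_ge0 ?ltW// ltrDl.
by move: (k * _) => q; lra.
Qed.

HB.instance Definition _ :=
  GRing.isSubmodClosed.Build R[i] (G -> R[i]^o) l2_pred l2_submod_closed.

Record l2 := L2 { l2fun :> G -> R[i]^o; l2funP : l2fun \in l2_pred }.

HB.instance Definition _ := [isSub for l2fun].
HB.instance Definition _ := [Choice of l2 by <:].
HB.instance Definition _ := [SubChoice_isSubLmodule of l2 by <:].

End L2.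

Section GroupoidAlgebra.
Context (R : realType) (G : groupoid).

(* On an etale groupoid, the sum has finitely many nonzero terms for f in
   [Cc]. *)
Definition convol (f xi : G -> R[i]^o) : G -> R[i]^o :=
  fun g => \sum_(a \in [set a : G | rng a = rng g])
    f a * xi (gmul (ginv a) g).

(* The value at the unit x of the C(X)-valued inner product. *)
Definition inner (xi eta : G -> R[i]^o) (x : G) : R[i]^o :=
  summability.sum (fun g : G =>
    (if src g == x then (xi g)^* * eta g else 0) : R[i]^o).

Definition adjoint (T T' : l2 R G -> l2 R G) : Prop :=
  forall (xi eta : l2 R G) (x : G), units x ->
    inner (T xi) eta x = inner xi (T' eta) x.

(* The closure, in the operator norm on [l2], of the operators of left
   convolution by elements of [Cc]. *)
Definition cstar : set (l2 R G -> l2 R G) :=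
  [set T | forall e, 0 < e -> exists2 f : G -> R[i]^o, Cc f &
    forall xi : l2 R G,
      (sqnorm (l2fun (T xi) - convol f xi)%R <= (e ^+ 2)%:E * sqnorm xi)%E].

(* The continuous functions on the unit space, extended by zero. *)
Definition cstar_diag : set (l2 R G -> l2 R G) :=
  [set T | exists f : G -> R[i]^o,
    [/\ Cc f, forall g, ~ units g -> f g = 0 &
        forall xi : l2 R G, T xi = convol f xi :> (G -> R[i]^o)]].

End GroupoidAlgebra.
Arguments cstar : clear implicits.
Arguments cstar_diag : clear implicits.

Definition cstar_iso (R : realType) (G H : groupoid)
    (Phi : (l2 R G -> l2 R G) -> (l2 R H -> l2 R H)) : Prop :=
  [/\ set_bij (cstar R G) (cstar R H) Phi,
      forall (a : R[i]) T T', cstar R G T -> cstar R G T' ->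
        Phi (a *: T + T') = a *: Phi T + Phi T',
      forall T T', cstar R G T -> cstar R G T' ->
        Phi (T \o T') = Phi T \o Phi T' &
      forall T T', cstar R G T -> cstar R G T' ->
        adjoint T T' -> adjoint (Phi T) (Phi T')].

Definition expi (R : realType) (x : R) : R[i] := cos x +i* sin x.

Section DualAction.
Context (R : realType) (X : metricType R) (S : smale X).
Let G := crossed_groupoid S.

(* [t] is a representative in R of a point of R/Z: [phase] is 1-periodic in t. *)
Definition phase (t : R) : G -> R[i]^o :=
  fun g => expi (2 * pi * (dcrossed g)%:~R * t).

Lemma phase_cont t : continuous (phase t).
Proof.
move=> g; apply: (@continuous_comp _ (discrete_topology int) _
  (@dcrossed _ _ S) (fun n : int => expi (2 * pi * n%:~R * t) : R[i]^o)).
  exact: dcrossed_cont.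
move=> A /nbhs_singleton An; apply: filterS (discrete_set1 _) => _ ->.
exact: An.
Qed.

Lemma phase_l2 t (xi : l2 R G) : 
  (fun g => phase t g * xi g) \in l2_pred (R := R) (G := G).
Proof.
have u1 g : sqmod (phase t g) <= 1 by rewrite /sqmod/= cos2Dsin2.
apply/mem_set => e e0; have /set_mem/(_ e e0)[f Cf xf] := l2funP xi.
exists (fun g => phase t g * f g); first exact: (CcM (phase_cont (t := t)) Cf).
rewrite (_ : _ - _ = (fun g => phase t g * (l2fun xi - f) g)).
  by rewrite -[e in leRHS]mul1r; exact: (sqnormZ ler01 u1 xf).
by apply/funext => g; rewrite !fctE/= mulrBr.
Qed.

Definition dual_unitary (t : R) (xi : l2 R G) : l2 R G := L2 (phase_l2 t xi).

(* Ad(U_t), since U_(-t) is the inverse of U_t. *)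
Definition dual_action (t : R) (T : l2 R G -> l2 R G) : l2 R G -> l2 R G :=
  dual_unitary t \o T \o dual_unitary (- t).

End DualAction.

(* f takes its values in [asym S] and is continuous for its inductive limit
   topology. *)
Definition continuous_into_asym (R : realType) (X : metricType R) (S : smale X)
    (T : topologicalType) (f : T -> X * X) : Prop :=
  exists2 g : T -> asym S, continuous g & forall x, val (g x) = f x.

Definition asymptotically_conjugate (R : realType) (X Y : metricType R)
    (phi : smale X) (psi : smale Y) : Prop :=
  exists h : homeo X Y,
    [/\ forall n : int, continuous_into_asym psi
          (fun x => (iterz psi n (h x), h (iterz phi n x))),
        forall n : int, continuous_into_asym phi
          (fun y => (iterz phi n (hinv h y), hinv h (iterz psi n y))),
        continuous_into_asym psi
          (fun p : asym phi => (h (val p).1, h (val p).2)) &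
        continuous_into_asym phi
          (fun q : asym psi => (hinv h (val q).1, hinv h (val q).2))].

(* Main.v *)
(* The arrows of the crossed groupoid of a Smale space are triples (x, n, y), so
   an arrow is determined by its endpoints and its degree: asymptotic conjugacies
   and degree-preserving groupoid isomorphisms are the same thing as soon as the
   groupoid is known to be topological. It is moreover etale: near a point of the
   diagonal only the diagonal is asymptotic, and the bracket provides local
   sections of the range map.

   An isomorphism of groupoids acts on l2 and conjugates the algebras. Conversely,
   let Phi be an isomorphism of algebras. On the diagonals it is dual to a
   homeomorphism h of the bases (Gelfand). For a bump f on a bisection in degree n
   and fv g = f (g^-1), the operator fv * (a f) lies in the diagonal for every a in
   C(X). Its image under Phi is the product of Phi fv and (a o h^-1) Phi f, where
   Phi f is homogeneous of degree n because Phi intertwines the dual actions. Let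
   (x, n, y) be an arrow with f (x, n, y) = 1, and let a peak at x. The value of
   the image at h y is 1, while up to a small error it is a sum over the arrows
   from h x to h y in degree n. There is at most one such arrow, so there is
   exactly one, and it stays in a compact set when (x, n, y) varies, which gives
   the continuity of (x, n, y) -> (h x, n, h y). The argument is symmetric
   in Phi and its inverse because the algebra is closed under composition. *)
Require Import Defs.
From mathcomp Require Import all_boot all_order all_algebra finmap.
From mathcomp Require Import all_classical all_reals all_analysis.
From mathcomp Require Import complex ring lra.
From mathcomp Require summability.

Set Implicit Arguments.
Unset Strict Implicit.
Unset Printing Implicit Defensive.
Import Order.TTheory GRing.Theory Num.Theory.
Import numFieldNormedType.Exports.
Local Open Scope classical_set_scope.
Local Open Scope ring_scope.
Local Open Scope complex_scope.

(** * Groupoid isomorphisms and conjugation of operators *)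

(** On the topological side the obstacle is the inductive limit topology. It is handled through one
    criterion: endpoints converge, the degree is eventually constant, and one level [Ga S n]
    eventually contains the net. What makes it work is that below [eps0] the bracket relations also
    pull back against the contraction, so the level of a limit is already a level of the nearby
    pairs.

    On the operator side the obstacle is that an element of the algebra is an operator, in general
    not convolution by a function of compact support, so a product of two of them is not a finite
    sum. Only the left factor [Phi fv] is replaced by some [q] in [Cc], whose range fibres are
    finite. The right factor is kept exact, as the vector obtained from the indicator of the units;
    multiplying it by a function of modulus at most 1 does not increase its norm, so the error is
    uniform in the peaked function [a]. Hence [a] may depend on the arrow while [q] does not, and
    the support of [q] is the compact set that yields continuity. *)

Definition homeo_sym (X Y : topologicalType) (h : homeo X Y) : homeo Y X :=
  Homeo (hinvK h) (hfunK h) (@hinv_cont _ _ h) (@hfun_cont _ _ h).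

Section GroupoidTheory.
Variable G : groupoid.
Implicit Types a b : G.

Lemma rng_rng a : rng (rng a) = rng a.
Proof. by rewrite -{1}(gmulV a) rng_gmul// rng_ginv. Qed.

Lemma src_rng a : src (rng a) = rng a.
Proof. by rewrite -{1}(gmulV a) src_gmul ?src_ginv// rng_ginv. Qed.

Lemma rng_src a : rng (src a) = src a.
Proof. by rewrite -(rng_ginv a) rng_rng. Qed.

Lemma gmul_rng_id a b : src b = rng a -> gmul b a = a -> b = rng a.
Proof.
move=> ba e; rewrite -(gmulV a) -{1}e -gmulA ?rng_ginv// gmulV.
by rewrite -ba gmul_src.
Qed.

Lemma gmul_rng_ginv a b : src b = rng a -> gmul b a = rng b -> a = ginv b.
Proof.
move=> ba e; rewrite -[LHS]gmul_rng -ba -gmulVr -gmulA ?src_ginv// e.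
by rewrite -src_ginv gmul_src.
Qed.

Lemma ginvK a : ginv (ginv a) = a.
Proof.
by apply/esym/gmul_rng_ginv; rewrite ?src_ginv// gmulVr rng_ginv.
Qed.

Lemma gmulKl a b : rng a = rng b -> gmul a (gmul (ginv a) b) = b.
Proof.
by move=> ab; rewrite gmulA ?src_ginv ?rng_ginv// gmulV ab gmul_rng.
Qed.

Lemma gmulVKl a b : src a = rng b -> gmul (ginv a) (gmul a b) = b.
Proof.
by move=> ab; rewrite gmulA ?src_ginv// gmulVr ab gmul_rng.
Qed.

Lemma rng_gmulV a b : rng a = rng b -> rng (gmul (ginv a) b) = src a.
Proof. by move=> ab; rewrite rng_gmul ?src_ginv// rng_ginv. Qed.

Lemma src_gmulV a b : rng a = rng b -> src (gmul (ginv a) b) = src b.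
Proof. by move=> ab; rewrite src_gmul ?src_ginv. Qed.

Lemma unitsE a : units a <-> rng a = a.
Proof. by split=> [[b _ <-]|<-]; [exact: rng_rng|exists a]. Qed.

Lemma units_src a : units a -> src a = a.
Proof. by move=> [b _ <-]; exact: src_rng. Qed.

Lemma ginv_rng a : ginv (rng a) = rng a.
Proof.
apply/esym/gmul_rng_ginv; first by rewrite src_rng rng_rng.
by rewrite -{2}(src_rng a) gmul_src rng_rng.
Qed.

End GroupoidTheory.

Section GroupoidIso.
Variables (G H : groupoid) (h : homeo G H).
Hypothesis hh : groupoid_iso h.
Implicit Types a b : G.

Lemma iso_mul a b : src a = rng b -> h (gmul a b) = gmul (h a) (h b).
Proof. by case: (hh a b). Qed.

Lemma iso_comp a b : src a = rng b <-> src (h a) = rng (h b).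
Proof. by case: (hh a b). Qed.

(** [groupoid_iso] speaks only of composability and products; [h (rng a)] is a left identity of
    [h a], and cancelling [h a] makes it the unit. *)
Lemma iso_rng a : h (rng a) = rng (h a).
Proof.
have ra : src (rng a) = rng a by rewrite src_rng.
apply: gmul_rng_id; first exact/iso_comp.
by rewrite -iso_mul// gmul_rng.
Qed.

Lemma iso_ginv a : h (ginv a) = ginv (h a).
Proof.
apply: gmul_rng_ginv; first by apply/iso_comp; rewrite rng_ginv.
by rewrite -iso_mul ?rng_ginv// gmulV iso_rng.
Qed.

Lemma iso_src a : h (src a) = src (h a).
Proof. by rewrite -rng_ginv iso_rng iso_ginv rng_ginv. Qed.

Lemma homeo_inj : injective h. Proof. exact: can_inj (@hfunK _ _ h). Qed.

Lemma groupoid_iso_sym : groupoid_iso (homeo_sym h).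
Proof.
move=> a b; rewrite -[a](hinvK h) -[b](hinvK h) /= !hfunK.
split; first by apply: iff_sym; exact: iso_comp.
by move=> /iso_comp ab; rewrite -iso_mul// hfunK.
Qed.

End GroupoidIso.

Section Transport.
Variables (R : realType) (G H : groupoid) (h : homeo G H).
Hypothesis hh : groupoid_iso h.

Lemma sqnorm_homeo (xi : G -> R[i]^o) : sqnorm (xi \o hinv h) = sqnorm xi.
Proof.
have E (x : G) : (\esum_(g in [set g | src g = src (h x)])
    (sqmod ((xi \o hinv h) g))%:E =
  \esum_(g in [set g | src g = src x]) (sqmod (xi g))%:E)%E.
  rewrite (@reindex_esum _ _ _ [set g : G | src g = src x] _ h)//=.
    by apply: eq_esum => g _; rewrite hfunK.
  split=> [g /= gx|a b _ _ /(@homeo_inj _ _ h)//|g /= gx].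
    by rewrite -!(iso_src hh) gx.
  exists (hinv h g); last by rewrite hinvK.
  by apply: (@homeo_inj _ _ h); rewrite !(iso_src hh) hinvK.
rewrite /sqnorm; congr ereal_sup; apply/seteqP; split=> _ [x _ <-].
  by exists (hinv h x) => //; rewrite -E hinvK.
by exists (h x) => //; rewrite E.
Qed.

Lemma Cc_homeo (f : G -> R[i]^o) : Cc f -> Cc (f \o hinv h).
Proof.
move=> [cf Kf]; split.
  by move=> x; apply: continuous_comp; [exact: hinv_cont|exact: cf].
have hK : compact (h @` closure [set g | f g != 0]).
  apply: continuous_compact => //; apply: continuous_subspaceT.
  exact: hfun_cont.
apply: subclosed_compact hK _; first exact: closed_closure.
move=> y /= yf; exists (hinv h y); last by rewrite hinvK.
move=> B /= /(@hfun_cont _ _ (homeo_sym h) y) /yf [z [fz Bz]].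
by exists (hinv h z); split.
Qed.

Lemma convol_homeo (f xi : G -> R[i]^o) :
  convol (f \o hinv h) (xi \o hinv h) = convol f xi \o hinv h.
Proof.
apply/funext => g; rewrite /convol/=.
rewrite (reindex_fsbig h [set a | rng a = rng (hinv h g)]).
  apply: eq_fsbigr => a; rewrite inE/= => ag; rewrite hfunK.
  congr (_ * xi _); apply: (@homeo_inj _ _ h); rewrite hinvK.
  by rewrite (iso_mul hh) ?src_ginv// (iso_ginv hh) hinvK.
split=> [a /= ag|a b _ _ /(@homeo_inj _ _ h)//|a /= ag].
  by rewrite -(iso_rng hh) ag (iso_rng hh) hinvK.
exists (hinv h a); last by rewrite hinvK.
by apply: (@homeo_inj _ _ h); rewrite !(iso_rng hh) !hinvK.
Qed.

Lemma l2_homeo (xi : l2 R G) : (xi \o hinv h) \in l2_pred (R := R) (G := H).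
Proof.
apply/mem_set => e e0; have /set_mem/(_ e e0)[f Cf xf] := l2funP xi.
exists (f \o hinv h); first exact: Cc_homeo.
by rewrite -[X in sqnorm X]/((l2fun xi - f) \o hinv h) sqnorm_homeo.
Qed.

Definition l2_map (xi : l2 R G) : l2 R H := L2 (l2_homeo xi).

(** The sum is a limit along finite sets directed by inclusion, and taking images under [h]
    identifies the two directed systems. *)
Lemma sum_homeo (x : H -> R[i]^o) :
  summability.sum x = summability.sum (x \o h).
Proof.
rewrite /summability.sum; congr lim.
have psE (A : {fset G}) : summability.partial_sum (x \o h) A =
    summability.partial_sum x (h @` A)%fset.
  rewrite /summability.partial_sum -(big_seq_fsetE _ A predT (x \o h)).
  rewrite -(big_seq_fsetE _ _ predT x) big_imfset//=.
  by move=> a b _ _; exact: homeo_inj.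
have imK (A : {fset H}) : (h @` (hinv h @` A))%fset = A.
  apply/fsetP => a; apply/imfsetP/idP => [[b /imfsetP[c cA ->] ->]|aA].
    by rewrite hinvK.
  by exists (hinv h a); rewrite ?hinvK//; apply/imfsetP; exists a.
apply/seteqP; split=> P [A _ AP].
  exists (hinv h @` A)%fset => // B /= AB; rewrite psE; apply: AP => /=.
  rewrite -(imK A); apply: subset_imfset; exact/fsubsetP.
exists (h @` A)%fset => // B /= AB; rewrite -(imK B) -psE; apply: AP => /=.
apply/fsubsetP => a aA; apply/imfsetP; exists (h a); last by rewrite hfunK.
by apply: (fsubsetP AB); apply/imfsetP; exists a.
Qed.

Lemma inner_homeo (xi eta : G -> R[i]^o) (x : G) :
  inner (xi \o hinv h) (eta \o hinv h) (h x) = inner xi eta x.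
Proof.
rewrite /inner sum_homeo; congr summability.sum; apply/funext => g /=.
by rewrite -(iso_src hh) (inj_eq (@homeo_inj _ _ h)) hfunK.
Qed.

End Transport.

Section Conjugation.
Variables (R : realType) (G H : groupoid) (h : homeo G H).
Hypothesis hh : groupoid_iso h.
Let hh' := groupoid_iso_sym hh.

Lemma l2_mapK : cancel (l2_map (R := R) hh) (l2_map hh').
Proof.
by move=> xi; apply: val_inj; apply/funext => g /=; rewrite hfunK.
Qed.

Definition conj_map (T : l2 R G -> l2 R G) : l2 R H -> l2 R H :=
  l2_map hh \o T \o l2_map hh'.

(** Conjugation is isometric and turns convolution by [f] into convolution by [f \o hinv h], so it
    moves an approximation of [T] to one of the same quality. *)
Lemma cstar_conj T : cstar R G T -> cstar R H (conj_map T).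
Proof.
move=> cT e /cT[f Cf Tf]; exists (f \o hinv h); first exact: Cc_homeo.
move=> xi.
have -> : l2fun (conj_map T xi) - convol (f \o hinv h) xi =
    (l2fun (T (l2_map hh' xi)) - convol f (l2_map hh' xi)) \o hinv h.
  have xiE : l2fun xi = l2fun (l2_map hh' xi) \o hinv h.
    by apply/funext => g /=; rewrite hinvK.
  by rewrite [in LHS]xiE convol_homeo.
rewrite sqnorm_homeo// (le_trans (Tf _))//.
by rewrite /= -[in leRHS](sqnorm_homeo hh').
Qed.

Lemma cstar_diag_conj T : cstar_diag R G T -> cstar_diag R H (conj_map T).
Proof.
move=> [f [Cf f0 Tf]]; exists (f \o hinv h); split; first exact: Cc_homeo.
  move=> g ng; apply: f0; apply: contra_not ng => /unitsE ug.
  apply/unitsE; rewrite -[g](hinvK h) -(iso_rng hh).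
  by rewrite ug.
move=> xi; rewrite /= Tf.
have xiE : l2fun xi = l2fun (l2_map hh' xi) \o hinv h.
  by apply/funext => g /=; rewrite hinvK.
by rewrite [in RHS]xiE convol_homeo.
Qed.

Lemma adjoint_conj T T' : adjoint T T' -> adjoint (conj_map T) (conj_map T').
Proof.
move=> TT' xi eta y /unitsE yu.
have uy : units (hinv h y).
  by apply/unitsE/(@homeo_inj _ _ h); rewrite (iso_rng hh) hinvK.
have E (zeta : l2 R H) : l2fun zeta = l2fun (l2_map hh' zeta) \o hinv h.
  by apply/funext => g /=; rewrite hinvK.
rewrite /= [X in inner _ X y]E [in RHS](E xi) -(hinvK h y) !inner_homeo//.
exact: TT'.
Qed.

End Conjugation.

Section ConjugationIso.
Variables (R : realType) (G H : groupoid) (h : homeo G H).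
Hypothesis hh : groupoid_iso h.
Let hh' := groupoid_iso_sym hh.

Lemma conj_mapK : cancel (conj_map (R := R) hh) (conj_map hh').
Proof.
move=> T; apply/funext => xi; rewrite /conj_map /=.
have := l2_mapK (R := R) hh.
by move=> K; rewrite -[RHS]K; congr (l2_map _ (l2_map _ (T _))); apply: val_inj;
  apply/funext => g /=; rewrite hfunK.
Qed.

Lemma conj_mapVK : cancel (conj_map (R := R) hh') (conj_map hh).
Proof.
move=> T; apply/funext => xi; rewrite /conj_map /=; apply: val_inj.
apply/funext => g /=; rewrite hinvK; congr (l2fun (T _) _); apply: val_inj.
by apply/funext => k /=; rewrite hinvK.
Qed.

Lemma cstar_iso_conj : cstar_iso (conj_map (R := R) hh).
Proof.
split.
- split=> [T|T T' _ _ /(can_inj conj_mapK)//|T cT]; first exact: cstar_conj.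
  exists (conj_map hh' T); last exact: conj_mapVK.
  exact: cstar_conj.
- by move=> a T T' _ _; apply/funext => xi; apply: val_inj; apply/funext.
- move=> T T' _ _; apply/funext => xi; rewrite /conj_map/=.
  congr (l2_map _ (T _)); apply: val_inj; apply/funext => g /=.
  by rewrite hfunK.
- by move=> T T' _ _; exact: adjoint_conj.
Qed.

Lemma cstar_diag_conj_eq : conj_map hh @` cstar_diag R G = cstar_diag R H.
Proof.
apply/seteqP; split=> [_ [T dT <-]|T dT]; first exact: cstar_diag_conj.
by exists (conj_map hh' T); [exact: cstar_diag_conj|exact: conj_mapVK].
Qed.

End ConjugationIso.

Section CrossedConjugation.
Variables (R : realType) (X Y : metricType R) (phi : smale X) (psi : smale Y).
Variable h : homeo (crossed_groupoid phi) (crossed_groupoid psi).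
Hypothesis hh : groupoid_iso h.
Hypothesis hd : forall g : crossed_groupoid phi, dcrossed (h g) = dcrossed g.

Lemma conj_map_dual (t : R) T :
  conj_map hh (dual_action t T) = dual_action t (conj_map hh T).
Proof.
have ph s (g : crossed_groupoid psi) : phase s (hinv h g) = phase s g.
  by rewrite /phase -hd hinvK.
apply/funext => xi; apply: val_inj; apply/funext => g /=.
rewrite ph; congr (_ * l2fun (T _) _); apply: val_inj; apply/funext => k /=.
by rewrite -ph hfunK.
Qed.

End CrossedConjugation.

(** * Asymptotic pairs at a fixed level *)

Section MetricCvg.
Context (R : realType) (X : metricType R) (T : Type) (F : set_system T).
Context {FF : Filter F}.
Implicit Types a b : T -> X.

Lemma cvg_mdist_lt a x c : a @ F --> x -> 0 < c ->
  \forall t \near F, mdist x (a t) < c.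
Proof. by move=> ax c0; exact: metricType_numDomainType.cvgr_dist_lt. Qed.

Lemma near_mdist_lt a b x y c : a @ F --> x -> b @ F --> y ->
  mdist x y < c -> \forall t \near F, mdist (a t) (b t) < c.
Proof.
move=> ax bY xyc; have c2 : 0 < (c - mdist x y) / 2.
  by rewrite divr_gt0// subr_gt0.
have H1 := cvg_mdist_lt ax c2.
have H2 := cvg_mdist_lt bY c2.
near=> t.
have ta : mdist x (a t) < (c - mdist x y) / 2 by near: t.
have tb : mdist y (b t) < (c - mdist x y) / 2 by near: t.
have := metric_triangle (a t) x (b t); have := metric_triangle x y (b t).
by rewrite (metric_sym (a t) x); move: ta tb; lra.
Unshelve. all: by end_near. Qed.

Lemma cvg_mdist a b x y : a @ F --> x -> b @ F --> y ->
  (mdist (a t) (b t) : R^o) @[t --> F] --> (mdist x y : R^o).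
Proof.
move=> ax bY; apply/cvgrPdist_lt => e e0; have c2 : 0 < e / 2 by rewrite divr_gt0.
have H1 := cvg_mdist_lt ax c2.
have H2 := cvg_mdist_lt bY c2.
near=> t.
have ta : mdist x (a t) < e / 2 by near: t.
have tb : mdist y (b t) < e / 2 by near: t.
have := metric_triangle (a t) x (b t); have := metric_triangle x y (b t).
have := metric_triangle x (a t) y; have := metric_triangle (a t) (b t) y.
rewrite (metric_sym (a t) x) (metric_sym (b t) y) ltr_norml.
by move: ta tb => ? ? ? ? ? ?; apply/andP; split; lra.
Unshelve. all: by end_near. Qed.

End MetricCvg.

Lemma iter_continuous (X : topologicalType) (f : X -> X) n :
  continuous f -> continuous (iter n f).
Proof.
move=> cf; elim: n => [x|n IH x]; first exact: cvg_id.
by rewrite /=; apply: continuous_comp; [exact: IH|exact: cf].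
Qed.

Lemma iterz_continuous (X : topologicalType) (f : homeo X X) n :
  continuous (iterz f n).
Proof.
case: n => n; first exact/iter_continuous/hfun_cont.
exact/iter_continuous/hinv_cont.
Qed.

(** * Stable and unstable relations along convergent nets *)

Section NearContraction.
Context (R : realType) (X : metricType R) (f : X -> X) (r : X -> X -> Prop).
Variables (e d l : R).
Hypotheses (e0 : 0 < e) (d0 : 0 < d) (l0 : 0 < l) (l1 : l < 1).
Hypothesis f_cont : continuous f.
Hypothesis r_dist : forall x y, r x y -> mdist x y < e.
Hypothesis r_step :
  forall x y, r x y -> r (f x) (f y) /\ mdist (f x) (f y) <= l * mdist x y.
Hypothesis r_sym : forall x y, mdist x y < d -> r x y -> r y x.
Hypothesis r_trans : forall x y z, mdist x z < e -> r x y -> r y z -> r x z.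
Hypothesis r_back : forall x y, mdist x y < e -> r (f x) (f y) -> r x y.
Context (T : Type) (F : set_system T) {FF : Filter F}.
Implicit Types a b c : T -> X.

Let rn n x y := r (iter n f x) (iter n f y).

Let iter_cvg n a x : a @ F --> x -> iter n f (a t) @[t --> F] --> iter n f x.
Proof. by move=> ax; apply: (cvg_comp _ _ ax); exact: iter_continuous. Qed.

(** [r] is symmetric only at distance less than [d]. The limit pair comes that close after some
    iterates, and by continuity so do the nearby pairs. *)
Lemma near_evr_sym a b x y n : a @ F --> x -> b @ F --> y -> evr f r x y ->
  (\forall t \near F, rn n (a t) (b t)) ->
  exists m, \forall t \near F, rn m (b t) (a t).
Proof.
move=> ax bY xy nab; have [m mP] := evr_small l0 l1 r_step d0 xy.
have [_ mnxy] := mP (maxn m n) (leq_maxl _ _).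
have H := near_mdist_lt (FF := FF) (@iter_cvg (maxn m n) _ _ ax) (@iter_cvg (maxn m n) _ _ bY) mnxy.
exists (maxn m n); near=> t; apply: r_sym; first by near: t.
by apply: (evr_mono l0 r_step (leq_maxr m n)); near: t.
Unshelve. all: by end_near. Qed.

Lemma near_evr_trans a b c x y z n n' :
  a @ F --> x -> b @ F --> y -> c @ F --> z ->
  evr f r x y -> evr f r y z ->
  (\forall t \near F, rn n (a t) (b t)) ->
  (\forall t \near F, rn n' (b t) (c t)) ->
  exists m, \forall t \near F, rn m (a t) (c t).
Proof.
move=> ax bY cz xy yz nab nbc.
have xz := evr_trans e0 l0 l1 r_step r_trans xy yz.
have [k kP] := evr_small l0 l1 r_step e0 xz.
pose m := maxn k (maxn n n').
have [_ mxz] := kP m (leq_maxl _ _).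
have H := near_mdist_lt (FF := FF) (@iter_cvg m _ _ ax) (@iter_cvg m _ _ cz) mxz.
have nm : (n <= m)%N by rewrite /m maxnC -maxnA leq_maxl.
have nm' : (n' <= m)%N by rewrite /m maxnA leq_maxr.
exists m; near=> t; apply: (r_trans (y := iter m f (b t))); first by near: t.
- by apply: (evr_mono l0 r_step nm); near: t.
- by apply: (evr_mono l0 r_step nm'); near: t.
Unshelve. all: by end_near. Qed.

(** The level [m] is lowered one step at a time: down to [n] the iterates of the limit pair are at
    distance less than [e], hence those of the nearby pairs too, and [r_back] applies. The final
    level depends only on the limit. *)
Lemma near_evr_back a b x y n m : a @ F --> x -> b @ F --> y -> rn n x y ->
  (\forall t \near F, rn m (a t) (b t)) -> \forall t \near F, rn n (a t) (b t).
Proof.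
move=> ax bY nxy mab.
have step k : (n <= k)%N -> (\forall t \near F, rn k.+1 (a t) (b t)) ->
    \forall t \near F, rn k (a t) (b t).
  move=> nk kab; have kxy := r_dist (evr_mono l0 r_step nk nxy).
  have H := near_mdist_lt (FF := FF) (@iter_cvg k _ _ ax) (@iter_cvg k _ _ bY) kxy.
  near=> t; apply: r_back; first by near: t.
  by rewrite -!iterS; near: t.
have [mn|/ltnW nm] := leqP m n.
  by near=> t; apply: (evr_mono l0 r_step mn); near: t.
rewrite -(subnK nm) in mab; elim: (m - n)%N mab => [//|k IH].
by rewrite addSn => /step H; apply: IH; apply: H; rewrite leq_addl.
Unshelve. all: by end_near. Qed.

End NearContraction.

Section SmaleLevels.
Context (R : realType) (X : metricType R) (S : smale X).
Local Notation e := (eps0 S).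

Definition stab x y := Gs0 S (x, y).
Definition unst x y := Gu0 S (x, y).

Lemma stab_refl x : stab x x.
Proof. by split; rewrite /= ?bracketxx ?mdistxx ?eps0_gt0. Qed.

Lemma unst_refl x : unst x x.
Proof. by split; rewrite /= ?bracketxx ?mdistxx ?eps0_gt0. Qed.

Lemma stab_step x y : stab x y ->
  stab (S x) (S y) /\ mdist (S x) (S y) <= lambda0 S * mdist x y.
Proof.
move=> xy; have [yx dxy] := xy.
have c : mdist (S x) (S y) <= lambda0 S * mdist x y.
  exact: (stable_contract (eps0_gt0 S) (lexx _) (stab_refl x) xy).
have c' : mdist (S x) (S y) < e.
  apply: (le_lt_trans c); apply: le_lt_trans dxy.
  by rewrite ler_piMl ?mdist_ge0// ltW// lambda0_lt1.
by do 2 split => //=; rewrite bracket_smap ?yx// /Delta/= metric_sym.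
Qed.

(** By equivariance of the bracket, a local relation pulls back against the contraction as long as
    the points stay closer than [eps0]. *)
Lemma unst_back x y : mdist x y < e -> unst (hinv S x) (hinv S y) -> unst x y.
Proof.
move=> dxy [/= xy d']; split => //=.
by rewrite -{1}(hinvK S x) -{1}(hinvK S y) bracket_smap ?xy ?hinvK// /Delta/= !hinvK.
Qed.

Lemma stab_back x y : mdist x y < e -> stab (S x) (S y) -> stab x y.
Proof.
move=> dxy [/= yx d']; split => //=.
move: yx; rewrite bracket_smap; [exact: (can_inj (hfunK S))| |];
  by rewrite /Delta/= metric_sym.
Qed.

Lemma unst_step x y : unst x y -> unst (hinv S x) (hinv S y) /\
  mdist (hinv S x) (hinv S y) <= lambda0 S * mdist x y.
Proof.
move=> xy; have [/= yE dxy] := xy.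
have c : mdist (hinv S x) (hinv S y) <= lambda0 S * mdist x y.
  exact: (unstable_contract (eps0_gt0 S) (lexx _) (unst_refl x) xy).
have c' : mdist (hinv S x) (hinv S y) < e.
  apply: (le_lt_trans c); apply: le_lt_trans dxy.
  by rewrite ler_piMl ?mdist_ge0// ltW// lambda0_lt1.
do 2 split => //=; apply: (can_inj (hfunK S)).
by rewrite -bracket_smap// /Delta/= !hinvK.
Qed.

Lemma stab_trans x y z : mdist x z < e -> stab x y -> stab y z -> stab x z.
Proof.
move=> xz [/= yx xy] [/= zy yz]; split=> //=.
have [] := @bracketA _ _ S z y x;
  rewrite /Delta/= ?zy ?yx ?(metric_sym y) ?(metric_sym z)//.
by move=> _ <-.
Qed.

Lemma unst_trans x y z : mdist x z < e -> unst x y -> unst y z -> unst x z.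
Proof.
move=> xz [/= xy dxy] [/= yz dyz]; split=> //=.
by have [] := @bracketA _ _ S x y z; rewrite /Delta/= ?xy ?yz// => <-.
Qed.

(** Below the radius of [bracket_near] the brackets of [x] and [y] stay within [eps0] of the points,
    so associativity applies to the triple [x], [y], [x]. *)
Lemma near_sym : exists2 d : R, 0 < d & forall x y, mdist x y < d ->
  (stab x y -> stab y x) /\ (unst x y -> unst y x).
Proof.
have [d d0 dP] := bracket_near S; exists d => // x y xy.
have e0 := eps0_gt0 S; have := xy; rewrite metric_sym => yx.
split=> -[/= E dxy]; have dyx := dxy; rewrite metric_sym in dyx;
  (split; last by []); rewrite /=.
- have [] := @bracketA _ _ S x y x; rewrite /Delta/= ?mdistxx ?E//.
    by have [] := dP _ _ xy.
  by move=> _ ->; rewrite bracketxx.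
- have [] := @bracketA _ _ S x y x; rewrite /Delta/= ?mdistxx ?E//.
    by rewrite metric_sym; have [] := dP _ _ yx.
  by move=> ->; rewrite bracketxx.
Qed.

Lemma smap_continuous : continuous (S : X -> X).
Proof. exact: hfun_cont. Qed.

Lemma hinv_continuous : continuous (hinv S).
Proof. exact: hinv_cont. Qed.

Lemma GaE n x y : Ga S n (x, y) <->
  stab (iter n S x) (iter n S y) /\ unst (iter n (hinv S) x) (iter n (hinv S) y).
Proof. by split=> -[H1 /GuE H2]. Qed.

Lemma Ga_mono m n x y : (m <= n)%N -> Ga S m (x, y) -> Ga S n (x, y).
Proof.
move=> mn /GaE[H1 H2]; apply/GaE; split.
- exact: (evr_mono (lambda0_gt0 S) stab_step mn H1).
- exact: (evr_mono (lambda0_gt0 S) unst_step mn H2).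
Qed.

Lemma Ga_refl n x : Ga S n (x, x).
Proof. by apply/GaE; split; [exact: stab_refl|exact: unst_refl]. Qed.

Lemma Ga_asym n x y : Ga S n (x, y) -> asym_set S (x, y).
Proof. by exists n. Qed.

End SmaleLevels.

(* A net of pairs converging in [X * X] to a point of [asym] converges there iff
   it is eventually in a fixed [Ga m]. *)
Section NearLevel.
Context (R : realType) (X : metricType R) (S : smale X).

Definition near_level (T : Type) (F : set_system T) (a b : T -> X) :=
  exists n, \forall t \near F, Ga S n (a t, b t).

Context (T : Type) (F : set_system T) {FF : Filter F}.
Implicit Types a b c : T -> X.

Let l0 := lambda0_gt0 S.
Let l1 := lambda0_lt1 S.
Let e0 := eps0_gt0 S.
Let stab_dist x y : stab S x y -> mdist x y < eps0 S. Proof. by case. Qed.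
Let unst_dist x y : unst S x y -> mdist x y < eps0 S. Proof. by case. Qed.

Lemma near_levelI a b m n :
  (\forall t \near F, stab S (iter m S (a t)) (iter m S (b t))) ->
  (\forall t \near F, unst S (iter n (hinv S) (a t)) (iter n (hinv S) (b t))) ->
  near_level F a b.
Proof.
move=> sab uab; exists (maxn m n); near=> t; apply/GaE; split.
- by apply: (evr_mono l0 (@stab_step _ _ S) (leq_maxl m n)); near: t.
- by apply: (evr_mono l0 (@unst_step _ _ S) (leq_maxr m n)); near: t.
Unshelve. all: by end_near. Qed.

Lemma near_level_stab a b : near_level F a b -> exists m,
  \forall t \near F, stab S (iter m S (a t)) (iter m S (b t)).
Proof. by move=> [n nab]; exists n; apply: filterS nab => t /GaE[]. Qed.

Lemma near_level_unst a b : near_level F a b -> exists m,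
  \forall t \near F, unst S (iter m (hinv S) (a t)) (iter m (hinv S) (b t)).
Proof. by move=> [n nab]; exists n; apply: filterS nab => t /GaE[]. Qed.

Lemma near_level_sym a b x y : a @ F --> x -> b @ F --> y ->
  asym_set S (x, y) -> near_level F a b -> near_level F b a.
Proof.
move=> ax bY /asym_setP[sxy uxy] ab; have [d d0 dP] := near_sym S.
have [m sab] := near_level_stab ab; have [n uab] := near_level_unst ab.
have [|m' sba] := near_evr_sym d0 l0 l1 (@smap_continuous _ _ S)
  (@stab_step _ _ S) _ ax bY sxy sab; first by move=> u v /dP[].
have [|n' uba] := near_evr_sym d0 l0 l1 (@hinv_continuous _ _ S)
  (@unst_step _ _ S) _ ax bY uxy uab; first by move=> u v /dP[].
exact: near_levelI sba uba.
Qed.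

Lemma near_level_trans a b c x y z :
  a @ F --> x -> b @ F --> y -> c @ F --> z ->
  asym_set S (x, y) -> asym_set S (y, z) ->
  near_level F a b -> near_level F b c -> near_level F a c.
Proof.
move=> ax bY cz /asym_setP[sxy uxy] /asym_setP[syz uyz] ab bc.
have [m sab] := near_level_stab ab; have [n uab] := near_level_unst ab.
have [m' sbc] := near_level_stab bc; have [n' ubc] := near_level_unst bc.
have [k sac] := near_evr_trans e0 l0 l1 (@smap_continuous _ _ S)
  (@stab_step _ _ S) (@stab_trans _ _ S) ax bY cz sxy syz sab sbc.
have [k' uac] := near_evr_trans e0 l0 l1 (@hinv_continuous _ _ S)
  (@unst_step _ _ S) (@unst_trans _ _ S) ax bY cz uxy uyz uab ubc.
exact: near_levelI sac uac.
Qed.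

Lemma near_level_back a b x y n : a @ F --> x -> b @ F --> y ->
  Ga S n (x, y) -> near_level F a b -> \forall t \near F, Ga S n (a t, b t).
Proof.
move=> ax bY /GaE[sxy uxy] ab.
have [m sab] := near_level_stab ab; have [m' uab] := near_level_unst ab.
have H1 := near_evr_back (FF := FF) l0 (@smap_continuous _ _ S) stab_dist
  (@stab_step _ _ S) (@stab_back _ _ S) ax bY sxy sab.
have H2 := near_evr_back (FF := FF) l0 (@hinv_continuous _ _ S) unst_dist
  (@unst_step _ _ S) (@unst_back _ _ S) ax bY uxy uab.
by near=> t; apply/GaE; split; near: t.
Unshelve. all: by end_near. Qed.

(** Applying [S] gains a forward step and costs a backward one, and conversely for [hinv S], so each
    application raises the level by at most one. *)
Lemma near_level_iterz a b k : near_level F a b ->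
  near_level F (fun t => iterz S k (a t)) (fun t => iterz S k (b t)).
Proof.
have fwd u v n : Ga S n (u, v) -> Ga S n.+1 (S u, S v).
  move=> /GaE[H1 H2]; apply/GaE; rewrite !iterSr !hfunK; split => //.
  by rewrite -!iterSr; exact: (stab_step (stab_step H1).1).1.
have bwd u v n : Ga S n (u, v) -> Ga S n.+1 (hinv S u, hinv S v).
  move=> /GaE[H1 H2]; apply/GaE; rewrite !iterSr !hinvK; split => //.
  by rewrite -!iterSr; exact: (unst_step (unst_step H2).1).1.
move=> [n nab]; exists (n + `|k|)%N; apply: filterS nab => t nab.
case: k => k /=.
  by elim: k => [|k IH]; rewrite ?addn0// addnS; exact: fwd.
elim: k => [|k IH]; first by rewrite addn1; exact: bwd.
by rewrite addnS; exact: bwd.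
Qed.

Lemma near_level_refl a : near_level F a a.
Proof. by exists 0%N; apply: nearW => t; exact: Ga_refl. Qed.

End NearLevel.

(** * Convergence of asymptotic pairs and of arrows *)

Section AsymCvg.
Context (R : realType) (X : metricType R) (S : smale X).

Lemma open_asymE (U : set (asym S)) : open U = asym_open U.
Proof. by []. Qed.

Lemma val_asym_continuous : continuous (val : asym S -> X * X).
Proof. by apply/continuousP => U oU; rewrite open_asymE => n; exists U. Qed.

Lemma asym_setE (p : asym S) : asym_set S ((val p).1, (val p).2).
Proof. by rewrite -surjective_pairing; exact: (set_mem (valP p)). Qed.

(** Openness is tested inside one [Ga S m] at a time, and there [near_level_back] lowers the level
    [m] of the pairs near a pair of level [n] to [n]. *)
Lemma open_Ga n : open [set p : asym S | Ga S n (val p)].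
Proof.
rewrite open_asymE => m.
exists (interior [set q : X * X | Ga S m q -> Ga S n q]).
  exact: open_interior.
move=> p mp; split=> [|/interior_subset/(_ mp)//]; rewrite /mkset.
case: (val p) {mp} => x y nxy.
have FF : Filter (within [set q : X * X | Ga S m q] (nbhs (x, y))).
  exact: within_filter.
have ax : fst @ within [set q : X * X | Ga S m q] (nbhs (x, y)) --> x.
  by apply: cvg_trans (cvg_fst (F := nbhs x) (G := nbhs y)); apply: cvg_app; exact: cvg_within.
have bY : snd @ within [set q : X * X | Ga S m q] (nbhs (x, y)) --> y.
  by apply: cvg_trans (cvg_snd (F := nbhs x) (G := nbhs y)); apply: cvg_app; exact: cvg_within.
have := near_level_back (FF := FF) ax bY nxy.
rewrite /interior /= => H; apply: filterS (H _) => [[]//|].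
exists m; suff : within [set q : X * X | Ga S m q] (nbhs (x, y))
    [set q | Ga S m q] by apply: filterS => -[].
exact: withinT.
Qed.

Lemma nbhs_asym (p : asym S) (U : set (asym S)) n : nbhs p U ->
  exists2 O : set (X * X), nbhs (val p) O &
    forall q : asym S, Ga S n (val q) -> O (val q) -> U q.
Proof.
rewrite nbhsE => -[V [oV Vp] VU].
case: (set_mem (valP p) : asym_set S (val p)) => m _ mp.
(* [m] is a level of [p]; at level [maxn m n] the open set sees [p] as well as the pairs of level
   [n]. *)
have [W oW WV] := oV (maxn m n); exists W.
  apply: open_nbhs_nbhs; split => //; apply/WV => //.
  by rewrite (surjective_pairing (val p)) in mp *; apply: Ga_mono mp; exact: leq_maxl.
move=> q nq Wq; apply: VU; apply/WV => //.
by rewrite (surjective_pairing (val q)) in nq *; apply: Ga_mono nq; exact: leq_maxr.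
Qed.

Lemma near_level_asym (p : asym S) :
  near_level S (nbhs p) (fun q => (val q).1) (fun q => (val q).2).
Proof.
have [n _ np] := asym_setE p; exists n.
have : nbhs p [set q : asym S | Ga S n (val q)].
  apply: open_nbhs_nbhs; split; first exact: open_Ga.
  by rewrite /= (surjective_pairing (val p)).
by apply: filterS => q; rewrite /= {1}(surjective_pairing (val q)).
Qed.

Section Cvg.
Context (T : Type) (F : set_system T) {FF : Filter F}.

Lemma cvg_asymP (g : T -> asym S) (p : asym S) : g @ F --> p <->
  [/\ (val (g t)).1 @[t --> F] --> (val p).1,
      (val (g t)).2 @[t --> F] --> (val p).2 &
      near_level S F (fun t => (val (g t)).1) (fun t => (val (g t)).2)].
Proof.
split=> [gp|[ax bY [n nab]]].
  have vgp : (val \o g) @ F --> val p.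
    exact: (cvg_comp _ _ gp (@val_asym_continuous p)).
  split.
  - by apply: (cvg_comp _ _ vgp); case: (val p) => x y; exact: cvg_fst.
  - by apply: (cvg_comp _ _ vgp); case: (val p) => x y; exact: cvg_snd.
  - by have [n np] := near_level_asym p; exists n; exact: gp np.
move=> U /(nbhs_asym n)[W Wp WU].
have vgp : (val \o g) @ F --> val p.
  rewrite (surjective_pairing (val p)).
  have -> : val \o g = fun t => ((val (g t)).1, (val (g t)).2).
    by apply/funext => t /=; rewrite -surjective_pairing.
  exact: cvg_pair.
rewrite /nbhs/=; near=> t; apply: WU; last by near: t; exact: vgp Wp.
by rewrite (surjective_pairing (val _)); near: t.
Unshelve. all: by end_near. Qed.

End Cvg.

End AsymCvg.

Section CrossedCvg.
Context (R : realType) (X : metricType R) (S : smale X).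
Context (T : Type) (F : set_system T) {FF : Filter F}.
Implicit Types g : crossed S.

Lemma crossed_inj g g' : (val g).1.1 = (val g').1.1 -> (val g).2 = (val g').2 ->
  dcrossed g = dcrossed g' -> g = g'.
Proof.
move=> H1 H2 H3; apply: val_inj; move: H1 H2 H3; rewrite /dcrossed.
by case: (val g) => -[x n] y; case: (val g') => -[x' n'] y' /= -> -> ->.
Qed.

Lemma cvg_crossed_untwist (g : T -> crossed S) g0 : g @ F --> g0 <->
  (fun t => untwist (g t)) @ F --> untwist g0.
Proof.
split=> [gg|ugg].
  exact: (cvg_comp _ _ gg (@initial_continuous _ _ (@untwist _ _ S) g0)).
move=> A; rewrite nbhsE => -[B [[C oC <-] Cg] BA].
have : nbhs (untwist g0) C by apply: open_nbhs_nbhs.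
by move=> /ugg H; apply: (@filterS _ F _ _ _ _ H) => t; exact: BA.
Qed.

(** The degree is locally constant, so the twist that defines the topology can be undone with the
    fixed power [dcrossed g0], at a bounded cost in level by [near_level_iterz]. *)
Lemma cvg_crossedP (g : T -> crossed S) g0 : g @ F --> g0 <->
  [/\ (val (g t)).1.1 @[t --> F] --> (val g0).1.1,
      (val (g t)).2 @[t --> F] --> (val g0).2,
      \forall t \near F, dcrossed (g t) = dcrossed g0 &
      near_level S F (fun t => iterz S (dcrossed g0) (val (g t)).1.1)
        (fun t => (val (g t)).2)].
Proof.
rewrite cvg_crossed_untwist; set k := dcrossed g0.
have E (t : T) : dcrossed (g t) = k ->
    (val (g t)).2 = iterz S k (val (untwist (g t)).1).2.
  by move=> <-; rewrite /= iterzNK.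
split=> [ug|[ax bY dk ab]].
  have u1 : (fun t => (untwist (g t)).1) @ F --> (untwist g0).1.
    by apply: (cvg_comp (fun t => untwist (g t)) fst ug); exact: cvg_fst.
  have u2 : (fun t => dcrossed (g t) : discrete_topology int) @ F --> (k : discrete_topology int).
    by apply: (cvg_comp (fun t => untwist (g t)) snd ug); exact: cvg_snd.
  have dk : \forall t \near F, dcrossed (g t) = k by exact: u2 (discrete_set1 _).
  have [ax bY ab] := (cvg_asymP _ _).1 u1; split => //.
  - have : iterz S k (val (untwist (g t)).1).2 @[t --> F] --> (val g0).2.
      rewrite -(iterzNK S k (val g0).2).
      by apply: (cvg_comp _ _ bY); exact: iterz_continuous.
    apply: cvg_trans; apply: near_eq_cvg; near=> t; apply/esym/E.
    by near: t.
  - have [n nab] := near_level_iterz k ab; exists n; near=> t.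
    rewrite E; last by near: t.
    by near: t.
have u2 : (fun t => (untwist (g t)).2) @ F --> (untwist g0).2.
  move=> A /nbhs_singleton Ak.
  by apply: (@filterS _ F _ _ _ _ dk) => t dgt; rewrite /= -/(dcrossed _) dgt.
suff u1 : (fun t => (untwist (g t)).1) @ F --> (untwist g0).1.
  rewrite [untwist g0]surjective_pairing.
  have -> : (fun t => untwist (g t)) =
      (fun t => ((untwist (g t)).1, (untwist (g t)).2)).
    by apply/funext => t; rewrite -surjective_pairing.
  exact: (cvg_pair u1 u2).
have bYk : iterz S (- k) (val (g t)).2 @[t --> F] --> iterz S (- k) (val g0).2.
  by apply: (cvg_comp _ _ bY); exact: iterz_continuous.
have bY' : (val (untwist (g t)).1).2 @[t --> F] --> iterz S (- k) (val g0).2.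
  apply: cvg_trans bYk; apply: near_eq_cvg; near=> t => /=.
  by have -> : (val (g t)).1.2 = k by near: t.
apply/cvg_asymP; split => //.
have [n nab] := near_level_iterz (- k) ab; exists n; near=> t => /=.
have -> : (val (g t)).1.2 = k by near: t.
rewrite -[(val (g t)).1.1](iterzK S k).
by near: t.
Unshelve. all: by end_near. Qed.

End CrossedCvg.

(** * The crossed groupoid is etale *)

(** [gmul] is total but meaningful only on composable pairs, so [et_gmul] follows nets that are
    eventually composable. [et_bump] stands for local compactness together with Urysohn's lemma. *)
Record etale (R : realType) (G : groupoid) : Prop := Etale {
  et_hausdorff : hausdorff_space G;
  et_rng : continuous (@rng G);
  et_ginv : continuous (@ginv G);
  et_gmul : forall (T : Type) (F : set_system T), Filter F ->
    forall (a b : T -> G) a0 b0, a @ F --> a0 -> b @ F --> b0 ->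
    src a0 = rng b0 -> (\forall t \near F, src (a t) = rng (b t)) ->
    gmul (a t) (b t) @[t --> F] --> gmul a0 b0;
  et_units : open (@units G);
  et_section : forall a : G, exists2 sg : G -> G, sg @ rng a --> a &
    \forall u \near rng a, rng (sg u) = u;
  et_bump : forall (a : G) (U : set G), nbhs a U ->
    exists p : G -> R^o, [/\ continuous p, p a = 1, forall g, 0 <= p g,
      compact (closure [set g | p g != 0]) & closure [set g | p g != 0] `<=` U]
  }.

Section AsymLocal.
Context (R : realType) (X : metricType R) (S : smale X).

Lemma bracket_cvg (T : Type) (F : set_system T) {FF : Filter F}
    (a b : T -> X) (x y : X) :
  a @ F --> x -> b @ F --> y -> mdist x y < eps0 S ->
  bracket S (a t) (b t) @[t --> F] --> bracket S x y.
Proof.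
move=> ax bY xy; have ab := near_mdist_lt (FF := FF) ax bY xy.
have /subspace_continuousP/(_ (x, y) xy) bc := bracket_cont (s := S).
move=> U /bc UV.
have {UV}[[V W] /= [xV yW] VWU] : nbhs (x, y) [set p : X * X |
  Delta (eps0 S) p -> U (bracket S p.1 p.2)] by exact: UV.
have aV := ax _ xV; have bW := bY _ yW.
suff : \forall t \near F, U (bracket S (a t) (b t)) by [].
near=> t.
have VWt : (V `*` W) (a t, b t) by split => /=; near: t.
have abt : Delta (eps0 S) (a t, b t) by rewrite /Delta/=; near: t.
exact: (VWU _ VWt abt).
Unshelve. all: by end_near. Qed.

(** A diagonal pair has level 0, so the nearby pairs have level 0; then the bracket of [a t] and
    [b t] equals [b t] by the unstable relation and [a t] by the reversed stable one. *)
Lemma near_level_diag (T : Type) (F : set_system T) {FF : Filter F} (a b : T -> X) (x : X) :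
  a @ F --> x -> b @ F --> x -> near_level S F a b -> \forall t \near F, a t = b t.
Proof.
move=> ax bx ab; have [d d0 dP] := near_sym S.
have ab0 := near_level_back (FF := FF) ax bx (Ga_refl S 0 x) ab.
have xd : mdist x x < d by rewrite mdistxx.
have abd := near_mdist_lt (FF := FF) ax bx xd.
near=> t.
have /GaE[/= sab [/= uab _]] : Ga S 0 (a t, b t) by near: t.
have [/(_ sab)[/= ba _] _] : (stab S (a t) (b t) -> stab S (b t) (a t)) /\
  (unst S (a t) (b t) -> unst S (b t) (a t)) by apply: dP; near: t.
by rewrite -ba uab.
Unshelve. all: by end_near. Qed.

(* [beta z] is the bracket of a point unstably equivalent to [z] near [y] and of
   one stably equivalent to [z] near [y], hence asymptotic to [z]. *)
Lemma asym_section x y : asym_set S (x, y) ->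
  exists2 beta : X -> X, beta @ x --> y & near_level S (nbhs x) id beta.
Proof.
move=> xyS; have [n _ /GaE[sxy uxy]] := xyS.
pose A := iter n S; pose B := iter n (hinv S).
have AB : cancel A B.
  by rewrite /A /B; elim: n {sxy uxy A B} => //= n IH z; rewrite /= -iterS iterSr hfunK IH.
have BA : cancel B A.
  by rewrite /A /B; elim: n {sxy uxy A B AB} => //= n IH z; rewrite /= -iterS iterSr hinvK IH.
have cA : continuous A by exact/iter_continuous/hfun_cont.
have cB : continuous B by exact/iter_continuous/hinv_cont.
have e0 := eps0_gt0 S.
pose v1 z := bracket S (A y) (A z); pose v2 z := bracket S (B z) (B y).
have [/= yxA dA] := sxy; have [/= xyB dB] := uxy; rewrite -/A -/B in yxA dA xyB dB.
have dA' := dA; rewrite metric_sym in dA'.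
have v1x : v1 @ x --> bracket S (A y) (A x).
  by apply: bracket_cvg => //; [exact: cvg_cst|exact: cA].
have v2x : v2 @ x --> bracket S (B x) (B y).
  by apply: bracket_cvg => //; [exact: cB|exact: cvg_cst].
(* The relations of level [n] between [x] and [y] turn the two limits into [A y] and [B y]. *)
rewrite yxA in v1x; rewrite xyB in v2x.
pose w1 := B \o v1; pose w2 := A \o v2.
have w1x : w1 @ x --> y.
  by rewrite -(AB y); apply: (cvg_comp _ _ v1x); exact: cB.
have w2x : w2 @ x --> y.
  by rewrite -(BA y); apply: (cvg_comp _ _ v2x); exact: cA.
pose beta z := bracket S (w2 z) (w1 z).
have yy : mdist y y < eps0 S by rewrite mdistxx.
have betax : beta @ x --> y.
  by rewrite -(bracketxx S y); exact: bracket_cvg.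
exists beta => //.
have sw1 : \forall z \near x, stab S (A z) (A (w1 z)).
  have H1 : \forall z \near x, mdist (A y) (A z) < eps0 S.
    exact: near_mdist_lt (cvg_cst (A y)) (cA x) dA'.
  have H2 : \forall z \near x, mdist (A z) (v1 z) < eps0 S.
    exact: near_mdist_lt (cA x) v1x dA.
  near=> z.
  have d1 : mdist (A y) (A z) < eps0 S by near: z.
  have d2 : mdist (A z) (v1 z) < eps0 S by near: z.
  have d2' := d2; rewrite metric_sym in d2'.
  rewrite /w1/= BA; split => //=; rewrite /v1.
  by have [] := @bracketA _ _ S (A y) (A z) (A z); rewrite /Delta/= ?mdistxx ?bracketxx.
have uw2 : \forall z \near x, unst S (B z) (B (w2 z)).
  have H1 : \forall z \near x, mdist (B z) (B y) < eps0 S.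
    exact: near_mdist_lt (cB x) (cvg_cst (B y)) dB.
  have H2 : \forall z \near x, mdist (B z) (v2 z) < eps0 S.
    exact: near_mdist_lt (cB x) v2x dB.
  near=> z.
  have d1 : mdist (B z) (B y) < eps0 S by near: z.
  have d2 : mdist (B z) (v2 z) < eps0 S by near: z.
  rewrite /w2/= AB; split => //=; rewrite /v2.
  by have [] := @bracketA _ _ S (B z) (B z) (B y); rewrite /Delta/= ?mdistxx ?bracketxx.
have N12 := near_mdist_lt (FF := nbhs_filter x) w2x w1x yy.
have N1b := near_mdist_lt (FF := nbhs_filter x) w1x betax yy.
have N2b := near_mdist_lt (FF := nbhs_filter x) w2x betax yy.
have s1 : \forall z \near x, stab S (w1 z) (beta z).
  near=> z.
  have d1 : mdist (w2 z) (w1 z) < eps0 S by near: z.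
  have d2 : mdist (w1 z) (beta z) < eps0 S by near: z.
  have d2' := d2; rewrite metric_sym in d2'.
  split => //=; rewrite /beta.
  by have [] := @bracketA _ _ S (w2 z) (w1 z) (w1 z); rewrite /Delta/= ?mdistxx ?bracketxx.
have u2 : \forall z \near x, unst S (w2 z) (beta z).
  near=> z.
  have d1 : mdist (w2 z) (w1 z) < eps0 S by near: z.
  have d2 : mdist (w2 z) (beta z) < eps0 S by near: z.
  split => //=; rewrite /beta.
  by have [] := @bracketA _ _ S (w2 z) (w2 z) (w1 z); rewrite /Delta/= ?mdistxx ?bracketxx.
have [xyS1 xyS2] := (asym_setP S x y).1 xyS.
have [m sm] := near_evr_trans e0 (lambda0_gt0 S) (lambda0_lt1 S)
  (@smap_continuous _ _ S) (@stab_step _ _ S) (@stab_trans _ _ S)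
  (@cvg_id _ (nbhs x)) w1x betax xyS1 (ex_intro _ 0%N (stab_refl S y))
  (n := n) (n' := 0) sw1 s1.
have [m' um] := near_evr_trans e0 (lambda0_gt0 S) (lambda0_lt1 S)
  (@hinv_continuous _ _ S) (@unst_step _ _ S) (@unst_trans _ _ S)
  (@cvg_id _ (nbhs x)) w2x betax xyS2 (ex_intro _ 0%N (unst_refl S y))
  (n := n) (n' := 0) uw2 u2.
exact: near_levelI sm um.
Unshelve. all: by end_near. Qed.

End AsymLocal.

Section CrossedTopology.
Context (R : realType) (X : metricType R) (S : smale X).
Let G := crossed_groupoid S.
Implicit Types g : G.

Let coord1 g : X := (val (g : crossed S)).1.1.
Let coord2 g : X := (val (g : crossed S)).2.

Lemma cvg_id_crossed g : [/\ coord1 @ g --> coord1 g, coord2 @ g --> coord2 g,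
  \forall g' \near g, dcrossed g' = dcrossed g &
  near_level S (nbhs g) (fun g' => iterz S (dcrossed g) (coord1 g')) coord2].
Proof. exact: (cvg_crossedP (fun g' => g') g).1 (@cvg_id _ (nbhs g)). Qed.

Lemma coord1_continuous : continuous coord1.
Proof. by move=> g; have [] := cvg_id_crossed g. Qed.

Lemma coord2_continuous : continuous coord2.
Proof. by move=> g; have [] := cvg_id_crossed g. Qed.

Lemma crossed_rng_continuous : continuous (@rng G).
Proof.
move=> g; have [H1 H2 H3 H4] := cvg_id_crossed g.
apply/(cvg_crossedP (FF := nbhs_filter g)); split => //; first by apply: nearW.
exact: near_level_refl.
Qed.

Lemma crossed_hausdorff : hausdorff_space G.
Proof.
have E (Z : topologicalType) (f : G -> Z) (a b : G) : hausdorff_space Z ->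
    continuous f -> cluster (nbhs a) b -> f a = f b.
  move=> hZ cf ab; apply: hZ => A B /cf Aa /cf Bb.
  by have [g [Ag Bg]] := ab _ _ Aa Bb; exists (f g).
move=> a b ab; apply: crossed_inj.
- exact: (E _ coord1 a b (@metric_hausdorff _ X) coord1_continuous).
- exact: (E _ coord2 a b (@metric_hausdorff _ X) coord2_continuous).
- exact: (E _ _ a b discrete_hausdorff (@dcrossed_cont _ _ S)).
Qed.

Lemma crossed_ginv_continuous : continuous (@ginv G).
Proof.
move=> g; have [H1 H2 H3 H4] := cvg_id_crossed g.
apply/(cvg_crossedP (FF := nbhs_filter g)); split => //.
- by apply: filterS H3 => g' /= g'g; rewrite /dcrossed/=; congr (- _).
- set k := dcrossed g in H3 H4 *.
  have H : (fun g' => iterz S k (coord1 g')) @ g --> iterz S k (coord1 g).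
    by apply: (cvg_comp _ _ H1); exact: iterz_continuous.
  have L := near_level_sym (FF := nbhs_filter g) H H2 (crossedP g) H4.
  have [m mg] := near_level_iterz (FF := nbhs_filter g) (- k) L.
  by exists m; apply: filterS mg => g'; rewrite iterzK.
Qed.

Lemma crossed_gmul_cvg (T : Type) (F : set_system T) : Filter F ->
  forall (a b : T -> G) a0 b0, a @ F --> a0 -> b @ F --> b0 ->
    src a0 = rng b0 -> (\forall t \near F, src (a t) = rng (b t)) ->
    gmul (a t) (b t) @[t --> F] --> gmul a0 b0.
Proof.
move=> FF a b a0 b0 /cvg_crossedP[A1 A2 A3 A4] /cvg_crossedP[B1 B2 B3 B4].
move=> /crossed_composable ab0 ab.
have abE : \forall t \near F, val (gmul (a t) (b t) : crossed S) =
    (coord1 (a t), dcrossed (a t) + dcrossed (b t), coord2 (b t)).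
  apply: filterS ab => t /crossed_composable abt.
  by rewrite /= val_crossed_mul.
have ab0E : val (gmul a0 b0 : crossed S) =
    (coord1 a0, dcrossed a0 + dcrossed b0, coord2 b0).
  by rewrite /= val_crossed_mul.
apply/cvg_crossedP; rewrite /dcrossed ab0E /=; split.
- apply: cvg_trans A1; apply: near_eq_cvg; near=> t.
  by have -> : val (gmul (a t) (b t) : crossed S) =
    (coord1 (a t), dcrossed (a t) + dcrossed (b t), coord2 (b t)) by near: t.
- apply: cvg_trans B2; apply: near_eq_cvg; near=> t.
  by have -> : val (gmul (a t) (b t) : crossed S) =
    (coord1 (a t), dcrossed (a t) + dcrossed (b t), coord2 (b t)) by near: t.
- near=> t.
  have -> : val (gmul (a t) (b t) : crossed S) =
    (coord1 (a t), dcrossed (a t) + dcrossed (b t), coord2 (b t)) by near: t.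
  have /= -> : dcrossed (a t) = dcrossed a0 by near: t.
  by have /= -> : dcrossed (b t) = dcrossed b0 by near: t.
pose k := dcrossed a0; pose l := dcrossed b0.
have L1 := near_level_iterz (FF := FF) l A4.
have a0A := asym_iterz l (crossedP a0); rewrite -/k in a0A.
have b0A := crossedP b0; rewrite -ab0 in b0A.
have C1 : (fun t => iterz S l (iterz S k (coord1 (a t)))) @ F -->
    iterz S l (iterz S k (coord1 a0)).
  apply: (cvg_comp (fun t => iterz S k (coord1 (a t))) (iterz S l)).
    by apply: (cvg_comp _ _ A1); exact: iterz_continuous.
  exact: iterz_continuous.
have C2 : (fun t => iterz S l (coord2 (a t))) @ F --> iterz S l (coord2 a0).
  by apply: (cvg_comp _ _ A2); exact: iterz_continuous.
have L2 : near_level S F (fun t => iterz S l (coord2 (a t)))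
    (fun t => coord2 (b t)).
  have [n nb] := B4; exists n; near=> t.
  have -> : coord2 (a t) = coord1 (b t).
    by apply/crossed_composable; near: t.
  by near: t.
have [n nab] := near_level_trans C1 C2 B2 a0A b0A L1 L2.
exists n; near=> t.
have -> : val (gmul (a t) (b t) : crossed S) =
  (coord1 (a t), dcrossed (a t) + dcrossed (b t), coord2 (b t)) by near: t.
by rewrite /= addrC iterzD; near: t.
Unshelve. all: by end_near. Qed.

Lemma crossed_unitE g : units g <-> dcrossed g = 0 /\ coord1 g = coord2 g.
Proof.
split=> [[g' _ <-]//|[d0 xy]]; exists g => //.
by apply: crossed_inj.
Qed.

(** The degree is locally constant, and by [near_level_diag] the endpoints of arrows near a unit
    coincide. *)
Lemma crossed_units_open : open (@units G).
Proof.
rewrite openE => g ug; have [d0 xy] := (crossed_unitE g).1 ug.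
have [H1 H2 H3 H4] := cvg_id_crossed g; rewrite d0 in H3 H4.
rewrite xy in H1.
have H := near_level_diag (FF := nbhs_filter g) H1 H2 H4.
rewrite /interior; near=> g'; apply/crossed_unitE; split; near: g' => //.
Unshelve. all: by end_near. Qed.

Lemma crossed_section (a : G) : exists2 sg : G -> G, sg @ rng a --> a &
    \forall u \near rng a, rng (sg u) = u.
Proof.
pose k := dcrossed a.
have [beta betax [n nL]] := asym_section (crossedP a).
pose z (u : G) := iterz S k (coord1 u).
(* The value [a] is a default; near [rng a] the pair is asymptotic by the choice of [beta]. *)
pose sg (u : G) : G :=
  match pselect (asym_set S (z u, beta (z u))) with
  | left h => mk_crossed h | right _ => a end.
have zx : z @ rng a --> iterz S k (coord1 a).
  by apply: (cvg_comp _ _ (@coord1_continuous (rng a))); exact: iterz_continuous.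
have zL : \forall u \near rng a, Ga S n (z u, beta (z u)) := zx _ nL.
have sgE : \forall u \near rng a, val (sg u : crossed S) = (coord1 u, k, beta (z u)).
  apply: filterS zL => u /Ga_asym h; rewrite /sg.
  by case: pselect => // h'; exfalso; exact: h' h.
have bz : (beta \o z) @ rng a --> coord2 a by exact: (cvg_comp _ _ zx betax).
have c1 : coord1 @ rng a --> coord1 a by exact: (@coord1_continuous (rng a)).
exists sg.
  apply/(cvg_crossedP (FF := nbhs_filter (rng a))); split.
  - apply: cvg_trans c1; apply: near_eq_cvg.
    by apply: filterS sgE => u ->.
  - apply: cvg_trans bz; apply: near_eq_cvg.
    by apply: filterS sgE => u ->.
  - by apply: filterS sgE => u; rewrite /dcrossed => ->.
  - exists n; near=> u.
    have -> : val (sg u : crossed S) = (coord1 u, k, beta (z u)) by near: u.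
    by near: u.
(* The range of [sg u] is the unit at [coord1 u], which is [u] itself once [u] is a unit. *)
have uU : \forall u \near rng a, units u.
  by apply: open_nbhs_nbhs; split; [exact: crossed_units_open|exists a].
near=> u; have sgu : val (sg u : crossed S) = (coord1 u, k, beta (z u)) by near: u.
have [d0 xy] : dcrossed u = 0 /\ coord1 u = coord2 u.
  by apply/crossed_unitE; near: u.
by apply: crossed_inj; rewrite //= sgu.
Unshelve. all: by end_near. Qed.

(** The sets [B r], cut out at the fixed level [n], are the base of a filter that converges to [a]
    by [cvg_crossedP]. *)
Lemma nbhs_crossed (a : G) (U : set G) n : nbhs a U -> exists2 r : R, 0 < r &
  forall g : G, dcrossed g = dcrossed a ->
    Ga S n (iterz S (dcrossed a) (coord1 g), coord2 g) ->
    mdist (coord1 a) (coord1 g) < r -> mdist (coord2 a) (coord2 g) < r -> U g.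
Proof.
pose B (r : R) := [set g : G | [/\ dcrossed g = dcrossed a,
    Ga S n (iterz S (dcrossed a) (coord1 g), coord2 g),
    mdist (coord1 a) (coord1 g) < r & mdist (coord2 a) (coord2 g) < r]].
pose F := filter_from [set r : R | 0 < r] B.
have FF : Filter F.
  apply: filter_from_filter; first by exists 1 => /=.
  move=> r s /= r0 s0; exists (Num.min r s) => /=; first by rewrite lt_min r0.
  by move=> g [H1 H2]; rewrite !lt_min => /andP[? ?] /andP[? ?]; split; split.
have : id @ F --> a.
  apply/cvg_crossedP; split.
  - apply/metricType_numDomainType.cvgrPdist_lt => e e0.
    by exists e => // g [].
  - apply/metricType_numDomainType.cvgrPdist_lt => e e0.
    by exists e => // g [].
  - by exists 1 => [|g []] /=.
  - by exists n; exists 1 => [|g []] /=.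
move=> /(_ U) H /H [r r0 rU]; exists r => // g H1 H2 H3 H4; exact: rU.
Qed.

(** Level [n] asks for bracket equations, which are closed conditions, and for strict bounds by
    [eps0], which are not. The radius [r] keeps the distances at level [n] below some [c < eps0], so
    the bounds survive in the limit and [C] is compact. On the other hand the set [Lv] of arrows of
    level [n] is open, so a cut-off outside [Lv] keeps [p] continuous. *)
Lemma crossed_bump (a : G) (U : set G) : nbhs a U ->
  exists p : G -> R^o, [/\ continuous p, p a = 1, forall g, 0 <= p g,
    compact (closure [set g | p g != 0]) & closure [set g | p g != 0] `<=` U].
Proof.
move=> aU.
pose k := dcrossed a; pose x := coord1 a; pose y := coord2 a.
have [n _ nxy] : asym_set S (iterz S k x, y) := crossedP a.
have [/= sxy uxy] := (GaE S n _ _).1 nxy.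
pose A := iter n S; pose B := iter n (hinv S).
have cA : continuous A by exact/iter_continuous/hfun_cont.
have cB : continuous B by exact/iter_continuous/hinv_cont.
have ck : continuous (iterz S k) by exact: iterz_continuous.
have cAk : continuous (A \o iterz S k) by move=> z; apply: continuous_comp; [exact: ck|exact: cA].
have cBk : continuous (B \o iterz S k) by move=> z; apply: continuous_comp; [exact: ck|exact: cB].
pose dA := mdist (A (iterz S k x)) (A y); pose dB := mdist (B (iterz S k x)) (B y).
have dAe : dA < eps0 S by case: sxy.
have dBe : dB < eps0 S by case: uxy.
(* The midpoint between the larger distance at level [n] and [eps0]. *)
pose c := (Num.max dA dB + eps0 S) / 2.
have [dAc dBc ce] : [/\ dA < c, dB < c & c < eps0 S].
  have : dA <= Num.max dA dB by rewrite le_max lexx.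
  have : dB <= Num.max dA dB by rewrite le_max lexx orbT.
  have : Num.max dA dB < eps0 S by rewrite gt_max dAe.
  by rewrite /c; move: (Num.max dA dB) => m ? ? ?; split; lra.
have [r1 r10 r1U] := nbhs_crossed n aU.
have f1 : fst @ nbhs (x, y) --> x by exact: cvg_fst.
have f2 : snd @ nbhs (x, y) --> y by exact: cvg_snd.
have nA : \forall q \near (x, y), mdist (A (iterz S k q.1)) (A q.2) < c.
  exact: (near_mdist_lt (FF := nbhs_filter (x, y))
    (cvg_comp _ _ f1 (cAk x)) (cvg_comp _ _ f2 (cA y)) dAc).
have nB : \forall q \near (x, y), mdist (B (iterz S k q.1)) (B q.2) < c.
  exact: (near_mdist_lt (FF := nbhs_filter (x, y))
    (cvg_comp _ _ f1 (cBk x)) (cvg_comp _ _ f2 (cB y)) dBc).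
have [[V W] /= [xV yW] VW] := filterI nA nB.
have [v /= v0 vV] := (metricType_numDomainType.nbhs_mdistP _ _).1 xV.
have [w /= w0 wW] := (metricType_numDomainType.nbhs_mdistP _ _).1 yW.
(* Half of the minimum, so that the closed balls of radius [r] lie inside the three open ones. *)
pose r := Num.min r1 (Num.min v w) / 2.
have m0 : 0 < Num.min r1 (Num.min v w) by rewrite !lt_min r10 v0.
have r0 : 0 < r by rewrite divr_gt0.
have rm : r < Num.min r1 (Num.min v w) by rewrite /r; move: m0; lra.
move: (rm); rewrite !lt_min => /and3P[rr1 rv rw].
pose Lv := [set g : G | dcrossed g = k /\ Ga S n (iterz S k (coord1 g), coord2 g)].
pose C := [set g : G | [/\ Lv g, mdist x (coord1 g) <= r & mdist y (coord2 g) <= r]].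
have CAB (x' y' : X) : mdist x x' <= r -> mdist y y' <= r ->
    mdist (A (iterz S k x')) (A y') < c /\ mdist (B (iterz S k x')) (B y') < c.
  move=> xr yr; apply: (VW (x', y')); split => /=.
  - by apply: vV; exact: le_lt_trans rv.
  - by apply: wW; exact: le_lt_trans rw.
have CU : C `<=` U.
  move=> g [[H1 H2] H3 H4]; apply: r1U => //; [exact: le_lt_trans rr1|exact: le_lt_trans rr1].
have CC : compact C.
  have [n1 n2] : compact [set: X] /\ hausdorff_space X.
    by split; [exact: (smale_compact S)|exact: metric_hausdorff].
  (* The endpoints cluster at a pair of points by compactness of the product; this pair is shown to
     have level [n], which makes it an arrow of [C]. *)
  move=> F FF FC; pose f (g : G) := (coord1 g, coord2 g).
  have [[x' y'] [_ cl]] : [set: X * X] `&` cluster (f @ F) !=set0.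
    have -> : [set: X * X] = [set: X] `*` [set: X] by apply/seteqP; split.
    apply: (compact_setX n1 n1 (fmap_proper_filter f FF)).
    by rewrite /nbhs /fmap /=; apply: filterS FC => g _; split.
  pose P := f @` C.
  have clP : closure P (x', y').
    move=> Q Qxy; apply: (cl P Q _ Qxy); rewrite /fmap /=.
    by apply: filterS FC => g Cg; exists g.
  have WF := within_nbhs_proper clP.
  have wT : within P (nbhs (x', y')) P by exact: withinT.
  have w1 : fst @ within P (nbhs (x', y')) --> x'.
    by apply: cvg_trans (cvg_fst (F := nbhs x') (G := nbhs y')); apply: cvg_app; exact: cvg_within.
  have w2 : snd @ within P (nbhs (x', y')) --> y'.
    by apply: cvg_trans (cvg_snd (F := nbhs x') (G := nbhs y')); apply: cvg_app; exact: cvg_within.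
  have xr : mdist x x' <= r.
    apply: (closed_cvg (fun z => z <= r) (@closed_le R r) _ _
      (cvg_mdist (cvg_cst x) w1)).
    by apply: filterS wT => _ [g [_ + _] <-].
  have yr : mdist y y' <= r.
    apply: (closed_cvg (fun z => z <= r) (@closed_le R r) _ _
      (cvg_mdist (cvg_cst y) w2)).
    by apply: filterS wT => _ [g [_ _ +] <-].
  have [dA' dB'] := CAB _ _ xr yr.
  have {}dA' := lt_trans dA' ce; have {}dB' := lt_trans dB' ce.
  have L : Ga S n (iterz S k x', y').
    apply/GaE; split; split => //=.
      rewrite metric_sym in dA'.
      apply: (cvg_unique n2 (F := (A q.2) @[q --> within P (nbhs (x', y'))])).
        have := bracket_cvg (FF := @filter_filter _ _ WF)
          (cvg_comp _ _ w2 (cA y')) (cvg_comp _ _ w1 (cAk x')) dA'.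
        apply: cvg_trans; apply: near_eq_cvg.
        by apply: filterS wT => _ [g [[_ /GaE[[/= + _] _]] _ _] <-] /=.
      exact: (cvg_comp _ _ w2 (cA y')).
    apply: (cvg_unique n2 (F := (B q.2) @[q --> within P (nbhs (x', y'))])).
      have := bracket_cvg (FF := @filter_filter _ _ WF)
        (cvg_comp _ _ w1 (cBk x')) (cvg_comp _ _ w2 (cB y')) dB'.
      apply: cvg_trans; apply: near_eq_cvg.
      by apply: filterS wT => _ [g [[_ /GaE[_ [/= + _]]] _ _] <-] /=.
    exact: (cvg_comp _ _ w2 (cB y')).
  pose g' : G := mk_crossed (Ga_asym L).
  exists g'; split; first by split.
  (* All arrows of [C] share degree and level, so closeness of endpoints is closeness in [G]. *)
  move=> D E FD Eg'; have [r' r'0 r'E] := nbhs_crossed n Eg'.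
  have [||_ [[g [Dg Cg] <-] [d1 d2]]] := cl (f @` (D `&` C))
      [set q | mdist x' q.1 < r' /\ mdist y' q.2 < r'].
  - by rewrite /fmap /=; apply: filterS (filterI FD FC) => g DCg; exists g.
  - exists ([set z | mdist x' z < r'], [set z | mdist y' z < r']) => /=.
      by split; apply/metricType_numDomainType.nbhs_mdistP; exists r'.
    by move=> q [].
  have [[H1 H2] _ _] := Cg.
  by exists g; split => //; exact: r'E.
have Cclosed : closed C by apply: compact_closed => //; exact: crossed_hausdorff.
have oLv : open Lv.
  rewrite openE => g [gk gL]; have [H1 H2 H3 H4] := cvg_id_crossed g.
  rewrite gk in H3 H4.
  have Hk : (fun g' => iterz S k (coord1 g')) @ g --> iterz S k (coord1 g).
    by apply: (cvg_comp _ _ H1); exact: ck.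
  have H5 := near_level_back (FF := nbhs_filter g) Hk H2 gL H4.
  by rewrite /interior; near=> g'; split; near: g'.
pose bmp (s : R) : R^o := Num.max 0 (1 - s / r).
have bmp0 s : 0 <= bmp s by rewrite /bmp le_max lexx.
have bmpr s : bmp s != 0 -> s <= r.
  apply: contraNT; rewrite -ltNge => rs; rewrite /bmp; apply/eqP/max_idPl.
  by rewrite subr_le0 ler_pdivlMr// mul1r ltW.
have cbmp (Z : topologicalType) (f : Z -> R^o) : continuous f ->
    continuous (fun z => bmp (f z)).
  move=> cf z; apply: (@continuous_max _ _ (cst 0) (fun z => 1 - f z / r)).
    exact: cvg_cst.
  by apply: cvgB; [exact: cvg_cst|apply: cvgM; [exact: cf|exact: cvg_cst]].
pose q (g : G) : R^o := bmp (mdist x (coord1 g)) * bmp (mdist y (coord2 g)).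
pose p (g : G) : R^o := if g \in Lv then q g else 0.
have cq : continuous q.
  have c1 : continuous (fun g => mdist x (coord1 g) : R^o).
    by move=> g; exact: (cvg_mdist (cvg_cst x) (@coord1_continuous g)).
  have c2 : continuous (fun g => mdist y (coord2 g) : R^o).
    by move=> g; exact: (cvg_mdist (cvg_cst y) (@coord2_continuous g)).
  by move=> g; exact: (cvgM (cbmp _ _ c1 g) (cbmp _ _ c2 g)).
have pC : [set g | p g != 0] `<=` C.
  move=> g /=; rewrite /p; case: ifPn => [/set_mem gL|]; last by rewrite eqxx.
  by rewrite /q mulf_eq0 negb_or => /andP[/bmpr H1 /bmpr H2]; split.
have clC : closure [set g | p g != 0] `<=` C.
  by move: (closureS pC); rewrite -((closure_id C).1 Cclosed).
exists p; split.
- move=> g; have [gL|gL] := pselect (Lv g).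
    have pq g' : Lv g' -> p g' = q g' by move=> g'L; rewrite /p mem_set.
    have gLv : nbhs g Lv by exact: open_nbhs_nbhs.
    have E : {near nbhs g, q =1 p} by apply: filterS gLv => g' /pq.
    rewrite /continuous_at pq//; exact: cvg_trans (near_eq_cvg E) (cq g).
  have gC : ~ C g by case.
  have pg : p g = 0 by rewrite /p memNset.
  have gC' : nbhs g (~` C).
    by apply: open_nbhs_nbhs; split => //; exact: closed_openC.
  have N : \forall g' \near nbhs g, p g' = 0.
    by apply: filterS gC' => g'; apply: contra_notP => /eqP pg'; exact: pC.
  rewrite /continuous_at pg; exact: cvg_near_cst N.
- rewrite /p mem_set; last by split.
  by rewrite /q !mdistxx /bmp mul0r subr0 max_r ?mulr1.
- by move=> g; rewrite /p; case: ifP => // _; exact: mulr_ge0.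
- by apply: subclosed_compact CC clC; exact: closed_closure.
- exact: subset_trans clC CU.
Unshelve. all: by end_near. Qed.

Lemma crossed_etale : etale R G.
Proof.
split.
- exact: crossed_hausdorff.
- exact: crossed_rng_continuous.
- exact: crossed_ginv_continuous.
- exact: crossed_gmul_cvg.
- exact: crossed_units_open.
- exact: crossed_section.
- exact: crossed_bump.
Qed.

End CrossedTopology.

(** * Asymptotic conjugacy and groupoid isomorphisms *)

Section IntoAsym.
Context (R : realType) (X : metricType R) (S : smale X).

Definition mk_asym (p : X * X) (h : asym_set S p) : asym S :=
  exist _ p (mem_set h : p \in asym_set S).

Lemma twist_into_asym (T : topologicalType) (c : T -> crossed S) n :
  continuous c -> (forall t, dcrossed (c t) = n) ->
  continuous_into_asym S (fun t => (iterz S n (val (c t)).1.1, (val (c t)).2)).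
Proof.
move=> cc cn.
have cS t : asym_set S (iterz S n (val (c t)).1.1, (val (c t)).2).
  by rewrite -(cn t); exact: crossedP.
exists (fun t => mk_asym (cS t)) => // t.
have [H1 H2 H3 H4] := (cvg_crossedP (FF := nbhs_filter t) c (c t)).1 (cc t).
apply/(cvg_asymP (FF := nbhs_filter t)); split => //=.
- by apply: (cvg_comp _ _ H1); exact: iterz_continuous.
- by rewrite cn in H4.
Qed.

Lemma into_asym_mem (T : topologicalType) (f : T -> X * X) (t : T) :
  continuous_into_asym S f -> asym_set S (f t).
Proof. by move=> [g _ <-]; exact: (set_mem (valP (g t))). Qed.

Lemma into_asym_near_level (T : topologicalType) (f : T -> X * X) (t : T) :
  continuous_into_asym S f ->
  near_level S (nbhs t) (fun t => (f t).1) (fun t => (f t).2).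
Proof.
move=> [g cg gf]; have [n ng] := near_level_asym (g t).
have H : \forall t' \near t, Ga S n ((val (g t')).1, (val (g t')).2) := cg t _ ng.
by exists n; apply: filterS H => t'; rewrite gf.
Qed.

Definition orbit_arrow n x : crossed S :=
  mk_crossed (asym_refl S (iterz S n x)).

Lemma orbit_arrow_continuous n : continuous (orbit_arrow n).
Proof.
move=> x; apply/(cvg_crossedP (FF := nbhs_filter x)); split => //.
- exact: iterz_continuous.
- exact: nearW.
- exact: near_level_refl.
Qed.

Definition asym_arrow (p : asym S) : crossed S :=
  @mk_crossed _ _ S (val p).1 0 (val p).2 (asym_setE p).

Lemma asym_arrow_continuous : continuous asym_arrow.
Proof.
move=> p; have [H1 H2 H3] := (cvg_asymP (FF := nbhs_filter p) id p).1 (@cvg_id _ (nbhs p)).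
apply/(cvg_crossedP (FF := nbhs_filter p)); split => //.
exact: nearW.
Qed.

Lemma crossed_rngE (g : crossed S) : crossed_rng g = orbit_arrow 0 (val g).1.1.
Proof. exact: val_inj. Qed.

Lemma crossed_srcE (g : crossed S) : crossed_src g = orbit_arrow 0 (val g).2.
Proof. exact: val_inj. Qed.

End IntoAsym.

Section ConjugacyIso.
Context (R : realType) (X Y : metricType R) (phi : smale X) (psi : smale Y).

Definition covers (k : X -> Y) (th : crossed phi -> crossed psi) :=
  forall g, val (th g) = (k (val g).1.1, dcrossed g, k (val g).2).

Definition degree_preserving_iso := exists2 h :
  homeo (crossed_groupoid phi) (crossed_groupoid psi), groupoid_iso h &
  forall g : crossed_groupoid phi, dcrossed (h g) = dcrossed g.

(** For an arrow [(x, n, y)], the first hypothesis makes [psi^n (k x)] asymptotic to [k (phi^n x)]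
    and the second makes the latter asymptotic to [k y]. The same chain, read through
    [near_level_trans], gives continuity. *)
Lemma covers_exists (k : X -> Y) :
  (forall n, continuous_into_asym psi (fun x => (iterz psi n (k x), k (iterz phi n x)))) ->
  continuous_into_asym psi (fun p : asym phi => (k (val p).1, k (val p).2)) ->
  continuous k -> exists2 th, continuous th & covers k th.
Proof.
move=> k1 k2 ck.
have kS (g : crossed phi) :
    asym_set psi (iterz psi (val g).1.2 (k (val g).1.1), k (val g).2).
  apply: asym_trans (into_asym_mem (val g).1.1 (k1 _)) _.
  exact: (into_asym_mem (mk_asym (crossedP g)) k2).
exists (fun g => mk_crossed (kS g)); last by [].
move=> g; pose n := dcrossed g.
have [H1 H2 H3 H4] := cvg_id_crossed g.
have [c1 c2] : (k (val g').1.1 @[g' --> g] --> k (val g).1.1) /\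
    (k (val g').2 @[g' --> g] --> k (val g).2).
  by split; [exact: (cvg_comp _ _ H1 (ck _))|exact: (cvg_comp _ _ H2 (ck _))].
apply/(cvg_crossedP (FF := nbhs_filter g)); split => //.
apply: (near_level_trans (FF := nbhs_filter g)
  (b := fun g' : crossed phi => k (iterz phi n (val g').1.1))
  (x := iterz psi n (k (val g).1.1)) (y := k (iterz phi n (val g).1.1))
  (z := k (val g).2)) => //.
- exact: (cvg_comp _ _ c1 (@iterz_continuous _ _ _ _)).
- apply: (cvg_comp _ _ (cvg_comp _ _ H1 (@iterz_continuous _ phi n _)) (ck _)).
- exact: (into_asym_mem (val g).1.1 (k1 n)).
- exact: (into_asym_mem (mk_asym (crossedP g)) k2).
- have [m mP] := into_asym_near_level (val g).1.1 (k1 n).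
  by exists m; exact: (H1 _ mP).
- pose p0 : asym phi := mk_asym (crossedP g).
  have [m mP] := into_asym_near_level p0 k2.
  (* The level given by [k2] holds near a point of [asym phi]; the pairs lie in a fixed level [j],
     where that neighbourhood comes from one in the product. *)
  exists m; have [j jP] := H4.
  have [r nr rP] := nbhs_asym j mP.
  have c3 : (iterz phi n (val g').1.1, (val g').2) @[g' --> g] --> val p0.
    exact: (cvg_pair (cvg_comp _ _ H1 (@iterz_continuous _ phi n _)) H2).
  have c4 : \forall g' \near g, r (iterz phi n (val g').1.1, (val g').2) := c3 _ nr.
  near=> g'.
  have jg' : Ga phi j (iterz phi n (val g').1.1, (val g').2) by near: g'.
  apply: (rP (mk_asym (Ga_asym jg'))) => //=.
  by near: g'.
Unshelve. all: by end_near. Qed.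

Lemma covers_iso (k : homeo X Y) (th : crossed phi -> crossed psi)
    (th' : crossed psi -> crossed phi) :
  continuous th -> covers k th -> continuous th' ->
  (forall g, val (th' g) = (hinv k (val g).1.1, dcrossed g, hinv k (val g).2)) ->
  degree_preserving_iso.
Proof.
move=> cth thE cth' th'E.
have K1 : cancel th th'.
  move=> g; apply: val_inj; rewrite th'E /dcrossed thE /= !hfunK.
  by rewrite -!surjective_pairing.
have K2 : cancel th' th.
  move=> g; apply: val_inj; rewrite thE /dcrossed th'E /= !hinvK.
  by rewrite -!surjective_pairing.
exists (Homeo K1 K2 cth cth' : homeo (crossed_groupoid phi) (crossed_groupoid psi)).
  move=> a b; rewrite /=; split.
    have abE : (val (th a)).2 = (val (th b)).1.1 <-> (val a).2 = (val b).1.1.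
      by rewrite !thE /=; split=> [/(can_inj (hfunK k))|->].
    by split=> /crossed_composable/abE/crossed_composable.
  move=> /crossed_composable ab; apply: val_inj => /=.
  rewrite thE /dcrossed val_crossed_mul// val_crossed_mul/= ?thE//=.
  by rewrite ab.
by move=> g; rewrite /dcrossed /= thE.
Qed.

Lemma iso_covers (h : homeo (crossed_groupoid phi) (crossed_groupoid psi)) :
  groupoid_iso h ->
  (forall g : crossed_groupoid phi, dcrossed (h g) = dcrossed g) ->
  covers (fun x => (val (h (orbit_arrow phi 0 x) : crossed psi)).1.1) h.
Proof.
move=> hh hd g.
have H1 : h (orbit_arrow phi 0 (val g).1.1) = crossed_rng (h g).
  by rewrite -crossed_rngE; exact: (iso_rng hh g).
have H2 : h (orbit_arrow phi 0 (val g).2) = crossed_src (h g).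
  by rewrite -crossed_srcE; exact: (iso_src hh g).
rewrite H1 H2 -(hd g) /dcrossed /=.
by rewrite -!surjective_pairing.
Qed.

End ConjugacyIso.

Section ConjugacyTheorem.
Context (R : realType).

Lemma iso_base_continuous (X Y : metricType R) (phi : smale X) (psi : smale Y)
    (h : homeo (crossed_groupoid phi) (crossed_groupoid psi)) :
  continuous (fun x => (val (h (orbit_arrow phi 0 x) : crossed psi)).1.1).
Proof.
move=> x.
have H : (fun x => h (orbit_arrow phi 0 x)) @ x --> h (orbit_arrow phi 0 x).
  exact: (cvg_comp _ _ (@orbit_arrow_continuous _ _ phi 0 x) (@hfun_cont _ _ h _)).
exact: (cvg_comp _ _ H (@coord1_continuous _ _ psi _)).
Qed.

(** The required pairs are read off from the images under [th] of the arrows [(x, n, phi^n x)] and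
    of the arrows of degree 0. *)
Lemma covers_into_asym (X Y : metricType R) (phi : smale X) (psi : smale Y)
    (k : X -> Y) (th : crossed phi -> crossed psi) :
  continuous th -> covers k th ->
  (forall n, continuous_into_asym psi (fun x => (iterz psi n (k x), k (iterz phi n x)))) /\
  continuous_into_asym psi (fun p : asym phi => (k (val p).1, k (val p).2)).
Proof.
move=> cth thE; split=> [n|].
- have := @twist_into_asym _ _ psi _ (fun x => th (orbit_arrow phi n x)) n.
  have -> : (fun x => (iterz psi n (val (th (orbit_arrow phi n x))).1.1,
      (val (th (orbit_arrow phi n x))).2)) =
      (fun x => (iterz psi n (k x), k (iterz phi n x))).
    by apply/funext => x; rewrite thE.
  apply; last by move=> x; rewrite /dcrossed thE.
  move=> x; apply: (cvg_comp _ _ (@orbit_arrow_continuous _ _ phi n x)).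
  exact: cth.
- have := @twist_into_asym _ _ psi _ (fun p => th (asym_arrow p)) 0.
  have -> : (fun p => (iterz psi 0 (val (th (asym_arrow p))).1.1,
      (val (th (asym_arrow p))).2)) =
      (fun p : asym phi => (k (val p).1, k (val p).2)).
    by apply/funext => x; rewrite thE.
  apply; last by move=> x; rewrite /dcrossed thE.
  move=> p; apply: (cvg_comp _ _ (@asym_arrow_continuous _ _ phi p)).
  exact: cth.
Qed.

Theorem conjugate_iff_iso (X Y : metricType R) (phi : smale X) (psi : smale Y) :
  asymptotically_conjugate phi psi <-> degree_preserving_iso phi psi.
Proof.
split=> [[k [k1 k2 k3 k4]]|[h hh hd]].
  have [th cth thE] := covers_exists k1 k3 (@hfun_cont _ _ k).
  have [th' cth' th'E] := covers_exists k2 k4 (@hinv_cont _ _ k).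
  exact: (covers_iso cth thE cth' th'E).
pose h' := homeo_sym h; have hh' := groupoid_iso_sym hh.
have hd' (g : crossed_groupoid psi) : dcrossed (h' g) = dcrossed g.
  by rewrite -[g in RHS](hinvK h) hd.
pose k x := (val (h (orbit_arrow phi 0 x) : crossed psi)).1.1.
pose k' y := (val (h' (orbit_arrow psi 0 y) : crossed phi)).1.1.
have kh : covers k h := iso_covers hh hd.
have kh' : covers k' h' := iso_covers hh' hd'.
have kK : cancel k k'.
  move=> x; have := kh' (h (orbit_arrow phi 0 x)); rewrite /= hfunK /=.
  by move=> [] <-.
have k'K : cancel k' k.
  move=> y; have := kh (h' (orbit_arrow psi 0 y)); rewrite /= hinvK /=.
  by move=> [] <-.
exists (Homeo kK k'K (@iso_base_continuous _ _ _ _ h) (@iso_base_continuous _ _ _ _ h')).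
have [H1 H2] := covers_into_asym (@hfun_cont _ _ h) kh.
have [H3 H4] := covers_into_asym (@hfun_cont _ _ h') kh'.
by split.
Qed.

End ConjugacyTheorem.

(** * Convolution on an etale groupoid *)

Section ComplexTopology.
Context (R : realType).

Lemma normc_real (x : R) : `|x%:C| = `|x|%:C.
Proof. by rewrite normc_def /= expr0n addr0 sqrtr_sqr. Qed.

Lemma real_complex_continuous : continuous (fun x : R^o => x%:C : R[i]^o).
Proof.
move=> x; apply/cvgrPdist_lt => e e0.
have [er ee] : 0 < complex.Re e /\ e = (complex.Re e)%:C.
  by move: e0; rewrite ltcE /= => /andP[/eqP i0 r0]; split => //; case: e i0 r0 => a b /= ->.
have N : \forall y \near x, `|x - y| < complex.Re e.
  by have /cvgrPdist_lt := @cvg_id _ (nbhs (x : R^o)); apply.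
near=> y; rewrite -rmorphB normc_real ee ltcR.
by near: y.
Unshelve. all: by end_near. Qed.

Lemma conjc_continuous : continuous (fun z : R[i]^o => Num.conj z : R[i]^o).
Proof.
move=> z; have cz : id @ nbhs (z : R[i]^o) --> (z : R[i]^o) by exact: cvg_id.
have N := (cvgrPdist_lt (FF := nbhs_filter (z : R[i]^o)) _ _).1 cz.
apply: (cvgrPdist_lt (FF := nbhs_filter (z : R[i]^o)) _ _).2 => e e0.
by apply: filterS (N e e0) => w; rewrite -rmorphB /= norm_conjC.
Qed.

End ComplexTopology.

Lemma compact_finite_cover (T : topologicalType) (A : set T) (V : T -> set T) :
  compact A -> (forall x, A x -> nbhs x (V x)) ->
  exists l : seq T, forall x, A x -> exists2 a, a \in l & V a x.
Proof.
move=> /compact_near_coveringP cA VA.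
(* Finite lists directed by inclusion serve as the index filter of near-covering compactness. *)
pose F := filter_from [set: seq T] (fun l => [set l' : seq T | {subset l <= l'}]).
have FF : Filter F.
  apply: filter_from_filter; first by exists [::].
  move=> l l' _ _; exists (l ++ l') => // m ml.
  by split=> x xl; apply: ml; rewrite mem_cat xl ?orbT.
have [|l _ lA] := cA _ F (fun l x => exists2 a, a \in l & V a x) FF.
  move=> x Ax; exists (V x, [set l : seq T | x \in l]).
    split; first exact: VA.
    by exists [:: x] => // l; apply; rewrite mem_head.
  by move=> [y l] [/= xy xl]; exists x.
by exists l; exact: lA.
Qed.

(** * Bisections and partitions of unity *)

Section Bisections.
Context (R : realType) (G : groupoid) (EG : etale R G).
Implicit Types (a b g : G) (U : set G) (f xi : G -> R[i]^o).

Definition bisection U := forall a b, U a -> U b ->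
  (rng a = rng b -> a = b) /\ (src a = src b -> a = b).

Definition supp f := closure [set g | f g != 0].

Lemma supp0 f g : ~ supp f g -> f g = 0.
Proof. by apply: contra_notP => /eqP fg; exact: subset_closure. Qed.

Lemma src_continuous : continuous (@src G).
Proof.
have -> : @src G = @rng G \o @ginv G by apply/funext => a /=; rewrite rng_ginv.
move=> a; apply: (@continuous_comp _ _ _ (@ginv G)); first exact: (et_ginv EG).
exact: (et_rng EG).
Qed.

(** For [b] and [c] near [a] with equal ranges, [b^-1 c] is near the unit [src a]; units being open,
    it is a unit and [b = c]. Equal sources are treated with [b c^-1]. *)
Lemma bisection_nbhs a : exists U, [/\ open U, U a & bisection U].
Proof.
have ua : nbhs (src a) (@units G).
  apply: open_nbhs_nbhs; split; first exact: (et_units EG).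
  by exists (ginv a) => //; rewrite rng_ginv.
have ua' : nbhs (rng a) (@units G).
  by apply: open_nbhs_nbhs; split; [exact: (et_units EG)|exists a].
have f1 : fst @ nbhs (a, a) --> a by exact: cvg_fst.
have f2 : snd @ nbhs (a, a) --> a by exact: cvg_snd.
have i1 : (fun p : G * G => ginv p.1) @ nbhs (a, a) --> ginv a.
  exact: (cvg_comp _ _ f1 (et_ginv EG (x := a))).
have i2 : (fun p : G * G => ginv p.2) @ nbhs (a, a) --> ginv a.
  exact: (cvg_comp _ _ f2 (et_ginv EG (x := a))).
pose P1 := [set p : G * G | rng p.1 = rng p.2].
pose P2 := [set p : G * G | src p.1 = src p.2].
have N1 : \forall p \near (a, a), P1 p -> units (gmul (ginv p.1) p.2).
  have c : (fun p : G * G => gmul (ginv p.1) p.2) @ within P1 (nbhs (a, a)) -->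
      gmul (ginv a) a.
    apply: (et_gmul EG (F := within P1 (nbhs (a, a)))).
    - by apply: cvg_trans i1; apply: cvg_app; exact: cvg_within.
    - by apply: cvg_trans f2; apply: cvg_app; exact: cvg_within.
    - by rewrite src_ginv.
    - have : within P1 (nbhs (a, a)) P1 by exact: withinT.
      by apply: filterS => p; rewrite src_ginv.
  by rewrite gmulVr in c; exact: (c _ ua).
have N2 : \forall p \near (a, a), P2 p -> units (gmul p.1 (ginv p.2)).
  have c : (fun p : G * G => gmul p.1 (ginv p.2)) @ within P2 (nbhs (a, a)) -->
      gmul a (ginv a).
    apply: (et_gmul EG (F := within P2 (nbhs (a, a)))).
    - by apply: cvg_trans f1; apply: cvg_app; exact: cvg_within.
    - by apply: cvg_trans i2; apply: cvg_app; exact: cvg_within.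
    - by rewrite rng_ginv.
    - have : within P2 (nbhs (a, a)) P2 by exact: withinT.
      by apply: filterS => p; rewrite rng_ginv.
  by rewrite gmulV in c; exact: (c _ ua').
have [[V W] /= [aV aW] VW] := filterI N1 N2.
exists (interior (V `&` W)); split.
- exact: open_interior.
- exact: filterI.
move=> b c /interior_subset[bV bW] /interior_subset[cV cW].
have [/= H1 H2] : _ /\ _ := VW (b, c) (conj bV cW).
split=> [bc|bc].
  have /unitsE := H1 bc; rewrite rng_gmulV// => e.
  by rewrite -{1}(gmul_src b) e gmulKl.
have := H2 bc; move=> /[dup] /units_src e /unitsE e'.
have e2 : gmul b (ginv c) = rng c by rewrite -e src_gmul ?src_ginv ?rng_ginv.
by rewrite -(gmul_rng c) -e2 -gmulA ?rng_ginv ?src_ginv// gmulVr -bc gmul_src.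
Qed.

(** A partition of unity made of bumps inside bisections. It reduces claims on convolution to the
    case where each sum has at most one nonzero term. *)
Lemma Cc_ind (P : (G -> R[i]^o) -> Prop) :
  (forall f h, Cc f -> Cc h -> P f -> P h -> P (f + h)) ->
  (forall f U, Cc f -> open U -> bisection U -> supp f `<=` U -> P f) ->
  forall f, Cc f -> P f.
Proof.
move=> PD PU f Cf.
have P0 : P 0.
  apply: (PU 0 set0 (Cc0 _ _) open0); first by move=> a b [].
  rewrite /supp (_ : [set g | _] = set0) ?closure0//.
  by rewrite -subset0 => g /=; rewrite eqxx.
have cover a : exists Up : set G * (G -> R^o), [/\ open Up.1 /\ bisection Up.1,
    continuous Up.2, Up.2 a = 1, forall g, 0 <= Up.2 g &
    closure [set g | Up.2 g != 0] `<=` Up.1].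
  have [U [oU Ua bU]] := bisection_nbhs a.
  have [p [cp pa p0 _ pU]] := et_bump EG (open_nbhs_nbhs (conj oU Ua)).
  by exists (U, p).
have [Up UpP] := choice cover.
pose p a := (Up a).2.
have [cf Kf] := Cf.
have [|D KD] := compact_finite_cover (V := fun a => [set g | p a g != 0]) Kf.
  move=> a _; have [_ cp pa _ _] := UpP a.
  have -> : [set g | p a g != 0] = p a @^-1` [set~ 0].
    by apply/seteqP; split=> g /= /eqP.
  apply: open_nbhs_nbhs; split; last by rewrite /p /= pa; exact/eqP/oner_neq0.
  apply: open_comp; first by move=> g _; exact: cp.
  exact/closed_openC/accessible_closed_set1/hausdorff_accessible/Rhausdorff.
pose s g : R^o := \sum_(a <- D) p a g.
have cs : continuous s.
  move=> g; rewrite /s; apply: cvg_big => [|a _]; first exact: add_continuous.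
  by have [_ cp _ _ _] := UpP a; exact: cp.
have sK g : supp f g -> s g != 0.
  move=> /KD[a aD pag]; rewrite /s (big_rem a)//= lt0r_neq0// ltr_pwDl//.
    by have [_ _ _ p0 _] := UpP a; rewrite lt0r pag p0.
  by apply: sumr_ge0 => b _; have [_ _ _ p0 _] := UpP b; exact: p0.
(* The denominator may vanish only off [supp f], where the factor [f g] is 0. *)
pose fp a g : R[i]^o := (p a g / s g)%:C * f g.
have fE : f = \sum_(a <- D) fp a.
  apply/funext => g; rewrite fct_sumE /fp -mulr_suml -rmorph_sum/= -mulr_suml.
  have [/sK s0|/supp0 ->] := pselect (supp f g); last by rewrite mulr0.
  by rewrite -/(s g) divff// mul1r.
have fp0 a g : f g = 0 -> fp a g = 0 by rewrite /fp => ->; rewrite mulr0.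
have Cfp a : Cc (fp a).
  split.
    move=> g; have [/sK s0|gK] := pselect (supp f g).
      apply: cvgM; last exact: cf.
      apply: (@continuous_cvg _ _ _ _ _ _ (fun x : R^o => x%:C : R[i]^o)).
        exact: real_complex_continuous.
      have [_ cp _ _ _] := UpP a.
      by apply: cvgM; [exact: cp|apply: cvgV => //; exact: cs].
    have gK' : nbhs g (~` supp f).
      by apply: open_nbhs_nbhs; split => //; apply: closed_openC; exact: closed_closure.
    have N : \forall g' \near nbhs g, fp a g' = 0.
      by apply: filterS gK' => g' /supp0 /fp0.
    by rewrite /continuous_at (fp0 _ _ (supp0 gK)); exact: cvg_near_cst N.
  apply: (subclosed_compact _ Kf); first exact: closed_closure.
  by apply: closureS => g /=; apply: contra_neq => /fp0.
have Pfp a : P (fp a).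
  have [[oU bU] _ _ _ pU] := UpP a.
  apply: (PU _ (Up a).1 (Cfp a) oU bU); apply: subset_trans pU.
  apply: closureS => g /=; apply: contra_neq => pag.
  by rewrite /fp /p pag mul0r mul0r.
have sumP (l : seq G) : Cc (\sum_(a <- l) fp a) /\ P (\sum_(a <- l) fp a).
  elim: l => [|a l [CS PS]]; first by rewrite big_nil; split; [exact: Cc0|exact: P0].
  rewrite big_cons; have Ca := Cfp a; have Pa := Pfp a.
  by split; [exact: CcD|exact: PD].
by rewrite fE; have [] := sumP D.
Qed.

End Bisections.

Lemma subset_esum (R : realType) (T : choiceType) (A B : set T) (a : T -> \bar R) :
  A `<=` B -> (\esum_(i in A) a i <= \esum_(i in B) a i)%E.
Proof.
move=> AB; apply: ge_ereal_sup => _ [C [Cfin CA] <-]; apply: ereal_sup_ubound.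
by exists C => //; split => //; exact: subset_trans AB.
Qed.

Lemma normc_sqmod (R : realType) (z : R[i]) : `|z| = (Num.sqrt (sqmod z))%:C.
Proof. by rewrite normc_def; case: z. Qed.

Section Convolution.
Context (R : realType) (G : groupoid) (EG : etale R G).
Implicit Types (a b g : G) (U : set G) (f h xi eta : G -> R[i]^o).

Lemma ginv_gmul a b : src a = rng b -> ginv (gmul a b) = gmul (ginv b) (ginv a).
Proof.
move=> ab; have ba : src (ginv b) = rng (ginv a) by rewrite src_ginv rng_ginv.
apply/esym/gmul_rng_ginv; first by rewrite src_gmul// rng_gmul// rng_ginv.
have e1 : gmul (gmul a b) (ginv b) = a.
  by rewrite -gmulA ?rng_ginv// gmulV -ab gmul_src.
have e2 : src (gmul a b) = rng (ginv b) by rewrite src_gmul// rng_ginv.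
by rewrite gmulA// e1 gmulV rng_gmul.
Qed.

Lemma bisection_convol U f xi a g : bisection U -> supp f `<=` U -> U a ->
  rng a = rng g -> convol f xi g = f a * xi (gmul (ginv a) g).
Proof.
move=> bU fU Ua ag; rewrite /convol -(fsbig_widen [set a])/= ?fsbig_set1//.
  by move=> _ ->.
move=> b [/= bg ba]; have [/fU Ub|/supp0 ->] := pselect (supp f b).
  by exfalso; apply: ba; apply: (bU _ _ Ub Ua).1; rewrite bg.
by rewrite mul0r.
Qed.

Lemma bisection_convol0 U f xi g : supp f `<=` U ->
  (forall a, U a -> rng a <> rng g) -> convol f xi g = 0.
Proof.
move=> fU Ug; apply: fsbig1 => a /= ag.
have [/fU Ua|/supp0 ->] := pselect (supp f a); last by rewrite mul0r.
by exfalso; exact: Ug ag.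
Qed.

(** A bisection contributes at most one arrow. A sum with infinitely many nonzero terms is 0 by
    convention, so the additivity of [convol] rests on this. *)
Lemma finite_fiber f u : Cc f -> finite_set [set a | rng a = u /\ f a != 0].
Proof.
move: f; apply: (Cc_ind EG) => [f h _ _ Ff Fh|f U _ _ bU fU].
  have FU := conj Ff Fh; rewrite -finite_setU in FU.
  apply: sub_finite_set FU => a /= [au fh].
  have [fa|] := eqVneq (f a) 0; last by left.
  by right; split => //; apply: contra_neq fh; rewrite /= fctE fa add0r.
have [[a [au fa]]|nex] := pselect (exists a, rng a = u /\ f a != 0); last first.
  by apply: sub_finite_set (finite_set0 _) => a /= ?; apply: nex; exists a.
apply: sub_finite_set (finite_set1 a) => b /= [bu fb].
by apply: (bU _ _ _ _).1; [apply: fU; exact: subset_closure|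
  apply: fU; exact: subset_closure|rewrite bu].
Qed.

Lemma convol_restrict f xi g (D : set G) :
  [set a | rng a = rng g /\ f a != 0] `<=` D -> D `<=` [set a | rng a = rng g] ->
  convol f xi g = \sum_(a \in D) f a * xi (gmul (ginv a) g).
Proof.
move=> fD Dg; rewrite /convol; apply/esym/fsbig_widen => // a [/= ag aD].
have [->|fa] := eqVneq (f a) 0; first by rewrite mul0r.
by exfalso; apply: aD; apply: fD.
Qed.

Lemma convolDl f h xi : Cc f -> Cc h -> convol (f + h) xi = convol f xi + convol h xi.
Proof.
move=> Cf Ch; apply/funext => g.
pose D := [set a | rng a = rng g /\ f a != 0] `|` [set a | rng a = rng g /\ h a != 0].
have Dfin : finite_set D by rewrite finite_setU; split; exact: finite_fiber.
have Dg : D `<=` [set a | rng a = rng g] by move=> a [] [].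
have fD : [set a | rng a = rng g /\ f a != 0] `<=` D by left.
have hD : [set a | rng a = rng g /\ h a != 0] `<=` D by right.
have fhD : [set a | rng a = rng g /\ (f + h) a != 0] `<=` D.
  move=> a /= [ag fh]; have [fa|] := eqVneq (f a) 0; last by left.
  by right; split => //; apply: contra_neq fh; rewrite /= fctE fa add0r.
rewrite -[RHS]/(convol f xi g + convol h xi g).
rewrite (convol_restrict xi fD Dg) (convol_restrict xi hD Dg).
rewrite (convol_restrict xi fhD Dg) -fsbig_split//; apply: eq_fsbigr => a _.
by rewrite fctE mulrDl.
Qed.

Lemma convolDr f xi eta : Cc f -> convol f (xi + eta) = convol f xi + convol f eta.
Proof.
move=> Cf; apply/funext => g; have Dfin := finite_fiber (rng g) Cf.
have Dg : [set a | rng a = rng g /\ f a != 0] `<=` [set a | rng a = rng g].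
  by move=> a [].
rewrite -[RHS]/(convol f xi g + convol f eta g) !(convol_restrict _ (@subset_refl _ _) Dg).
rewrite -fsbig_split//; apply: eq_fsbigr => a _.
by rewrite fctE mulrDr.
Qed.

Lemma convolZr (c : R[i]) f xi : convol f (fun g => c * xi g) = (fun g => c * convol f xi g).
Proof.
apply/funext => g; rewrite /convol mulr_fsumr; apply: eq_fsbigr => a _.
by rewrite mulrCA.
Qed.

Lemma convolZl (c : R[i]) f xi : convol (fun g => c * f g) xi = (fun g => c * convol f xi g).
Proof.
apply/funext => g; rewrite /convol mulr_fsumr; apply: eq_fsbigr => a _.
by rewrite mulrA.
Qed.

Lemma Cc_sqmod_bounded f : Cc f -> exists2 M : R, 0 <= M & forall g, sqmod (f g) <= M.
Proof.
(* Near [a] the modulus of [f] is at most that of [f a] plus 1; the final bound is the sum of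
   finitely many [N a]. *)
move=> [cf Kf]; pose N a := (Num.sqrt (sqmod (f a)) + 1) ^+ 2.
have N0 a : 0 <= N a by rewrite sqr_ge0.
have [|l lP] := compact_finite_cover (V := fun a => [set g | sqmod (f g) <= N a]) Kf.
  move=> a _; have := cf a; move/cvgrPdist_lt => /(_ 1 ltr01).
  apply: filterS => g /= fag; rewrite -[leLHS]sqr_sqrtr ?sqmod_ge0//.
  rewrite ler_sqr ?nnegrE ?addr_ge0 ?sqrtr_ge0// -lecR rmorphD/= rmorph1.
  rewrite -!normc_sqmod.
  rewrite -lerBlDl (le_trans (lerB_dist _ _))// distrC ltW//.
exists (\sum_(a <- l) N a); first by apply: sumr_ge0 => a _.
move=> g; have [/lP[a al /= ga]|/supp0 ->] := pselect (supp f g); last first.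
  by rewrite /sqmod/= expr0n addr0; apply: sumr_ge0 => a _.
apply: (le_trans ga); rewrite (big_rem a)//= lerDl.
by apply: sumr_ge0 => b _.
Qed.

Definition l2_bounded (T : (G -> R[i]^o) -> (G -> R[i]^o)) := exists2 M : R, 0 <= M &
  forall xi (c : R), (sqnorm xi <= c%:E)%E -> (sqnorm (T xi) <= (M * c)%:E)%E.

(** On a bisection, convolution by [f] is the translation [tau] followed by multiplication by values
    of [f]. Arrows of [U] are determined by their source, so [tau] is injective, and a bound on
    [sqmod (f g)] bounds the operator. *)
Lemma convol_bounded f : Cc f -> l2_bounded (convol f).
Proof.
move: f; apply: (Cc_ind EG) => [f h Cf Ch [M M0 Mf] [N N0 Nh]|f U Cf oU bU fU].
  exists (2 * M + 2 * N); first by rewrite addr_ge0 ?mulr_ge0.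
  move=> xi c xc; rewrite convolDl//.
  by rewrite mulrDl -2!mulrA; apply: sqnormD; [exact: Mf|exact: Nh].
have [M M0 fM] := Cc_sqmod_bounded Cf; exists M => // xi c xc.
have section_ex g : exists b, (exists a, U a /\ rng a = rng g) -> U b /\ rng b = rng g.
  by have [[a aP]|na] := pselect (exists a, U a /\ rng a = rng g); [exists a|exists g].
have [al alP] := choice section_ex.
pose D g := exists a, U a /\ rng a = rng g.
pose tau g := gmul (ginv (al g)) g.
pose eta g : R[i]^o := if pselect (D g) then xi (tau g) else 0.
have -> : convol f xi = fun g => f (al g) * eta g.
  apply/funext => g; rewrite /eta; case: pselect => [/[dup] Dg /alP[Ug rg]|nD] /=.
    exact: bisection_convol Ug rg.
  rewrite mulr0; apply: (bisection_convol0 _ fU) => a Ua ag.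
  by apply: nD; exists a.
apply: sqnormZ => //; apply/sqnorm_leP => x.
have -> : (\esum_(g in [set g | src g = src x]) (sqmod (eta g))%:E =
    \esum_(g in [set g | src g = src x] `&` D) (sqmod (xi (tau g)))%:E)%E.
  rewrite esum_mkcondr; apply: eq_esum => g _; rewrite /eta.
  case: pselect => [Dg|nD] /=; first by rewrite mem_set.
  by rewrite memNset// /sqmod/= expr0n addr0.
rewrite -(@esum_image R G G ([set g | src g = src x] `&` D) tau
  (fun g => (sqmod (xi g))%:E)).
  apply: le_trans ((sqnorm_leP _ _ xc) x); apply: subset_esum.
  by move=> _ [g [/= gx /alP[_ rg]] <-]; rewrite src_gmulV.
move=> g g' /set_mem[_ /alP[Ug rg]] /set_mem[_ /alP[Ug' rg']] /= tt.
have e : al g = al g'.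
  by apply: (bU _ _ Ug Ug').2; rewrite -(rng_gmulV rg) -(rng_gmulV rg') -/(tau g) tt.
by rewrite -(gmulKl rg) -(gmulKl rg') -/(tau g) -/(tau g') tt e.
Qed.

Lemma sqnorm_Cc_fin f : Cc f -> exists2 M : R, 0 <= M & (sqnorm f <= M%:E)%E.
Proof.
move: f; apply: (Cc_ind EG) => [f h Cf Ch [M M0 Mf] [N N0 Nh]|f U Cf oU bU fU].
  by exists (2 * M + 2 * N); [rewrite addr_ge0 ?mulr_ge0|exact: sqnormD].
have [M M0 fM] := Cc_sqmod_bounded Cf; exists M => //; apply/sqnorm_leP => x.
have [[a [ax fa]]|nex] := pselect (exists a, src a = src x /\ f a != 0); last first.
  rewrite esum1 ?lee_fin// => g /= gx; have [->|fg] := eqVneq (f g) 0.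
    by rewrite /sqmod /= expr0n addr0.
  by exfalso; apply: nex; exists g.
apply: (@le_trans _ _ (\esum_(g in [set a]) (sqmod (f g))%:E)%E).
  rewrite [leLHS]esum_mkcond [leRHS]esum_mkcond; apply: le_esum => g _.
  case: ifPn => [/set_mem /= gx|_]; last by case: ifP; rewrite ?lee_fin ?sqmod_ge0.
  have [->|fg] := eqVneq (f g) 0.
    by rewrite /sqmod /= expr0n addr0; case: ifP.
  rewrite mem_set//=; apply: (bU _ _ _ _).2; rewrite ?gx//;
    by apply: fU; exact: subset_closure.
by rewrite esum_set1 ?lee_fin ?sqmod_ge0.
Qed.

End Convolution.

Lemma closed_eq_set (T T' : topologicalType) (f g : T -> T') :
  hausdorff_space T' -> continuous f -> continuous g ->
  closed [set x | f x = g x].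
Proof.
move=> hT cf cg x clx; apply: hT => A B /cf fA /cg gB.
have fgAB : nbhs x (f @^-1` A `&` g @^-1` B) by exact: filterI.
have [y [/= fg [yA yB]]] := clx _ fgAB.
by exists (f y); split => //; rewrite fg.
Qed.

(** * The convolution algebra of compactly supported functions *)

Section ConvolutionAlgebra.
Context (R : realType) (G : groupoid) (EG : etale R G).
Implicit Types (a b g : G) (U : set G) (f h xi eta : G -> R[i]^o).

(** Where [U] has an arrow [a] over [rng g], the local section at [a] follows it and the single term
    of the sum varies continuously. Elsewhere [rng g] avoids the image of [supp f] under [rng],
    which is closed because compact, so the convolution vanishes near [g]. *)
Lemma bisection_convol_continuous U f xi : open U -> bisection U -> Cc f ->
  supp f `<=` U -> continuous xi -> continuous (convol f xi).
Proof.
move=> oU bU [cf Kf] fU cxi g.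
have [[a [Ua ag]]|nex] := pselect (exists a, U a /\ rng a = rng g).
  have [sg sga sgr] := et_section EG a; rewrite ag in sga sgr.
  have rg : @rng G @ g --> rng g by exact: (et_rng EG).
  have ca : (fun g' => sg (rng g')) @ g --> a by exact: (cvg_comp _ _ rg sga).
  have ra : \forall g' \near g, rng (sg (rng g')) = rng g' := rg _ sgr.
  have Ua' : \forall g' \near g, U (sg (rng g')).
    by apply: ca; exact: open_nbhs_nbhs.
  have N : \forall g' \near nbhs g, f (sg (rng g')) *
      xi (gmul (ginv (sg (rng g'))) g') = convol f xi g'.
    near=> g'; apply/esym/bisection_convol; [exact: bU|exact: fU| |]; by near: g'.
  rewrite /continuous_at (bisection_convol xi bU fU Ua ag).
  apply: cvg_trans (near_eq_cvg N) _; apply: cvgM.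
    exact: (cvg_comp _ _ ca (cf a)).
  have cm : (fun g' => gmul (ginv (sg (rng g'))) g') @ g --> gmul (ginv a) g.
    apply: (et_gmul EG (F := nbhs g)) => //.
    - exact: (cvg_comp _ _ ca (et_ginv EG (x := a))).
    - by rewrite src_ginv.
    - by apply: filterS ra => g'; rewrite src_ginv.
  exact: (cvg_comp _ _ cm (cxi _)).
have K : closed (@rng G @` supp f).
  apply: compact_closed; first exact: (et_hausdorff EG).
  apply: continuous_compact => //; apply: continuous_subspaceT.
  exact: (et_rng EG).
have gK : nbhs g (~` (@rng G @^-1` (@rng G @` supp f))).
  apply: open_nbhs_nbhs; split.
    apply: closed_openC; apply: closed_comp K => ? _; exact: (et_rng EG).
  by move=> [a /fU Ua ag]; apply: nex; exists a.
have z g' : (~` (@rng G @^-1` (@rng G @` supp f))) g' -> convol f xi g' = 0.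
  move=> ng; apply: (@bisection_convol0 _ _ (supp f)) => // a fa ag.
  by apply: ng; exists a.
have N : \forall g' \near nbhs g, convol f xi g' = 0 by apply: filterS gK => g' /z.
by rewrite /continuous_at (z _ (nbhs_singleton gK)); exact: cvg_near_cst N.
Unshelve. all: by end_near. Qed.

Lemma supp_convol f h g : convol f h g != 0 ->
  exists a b, [/\ supp f a, supp h b, src a = rng b & g = gmul a b].
Proof.
move=> fhg; apply: contrapT => nex; move/eqP: fhg; apply.
apply: fsbig1 => a /= ag; have [->|fa] := eqVneq (f a) 0; first by rewrite mul0r.
have [->|ha] := eqVneq (h (gmul (ginv a) g)) 0; first by rewrite mulr0.
exfalso; apply: nex; exists a, (gmul (ginv a) g).
split; [exact: subset_closure|exact: subset_closure| |].
- by rewrite rng_gmulV.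
- by rewrite gmulKl.
Qed.

Lemma convol_Cc f h : Cc f -> Cc h -> Cc (convol f h).
Proof.
move=> Cf Ch; move: f Cf; apply: (Cc_ind EG) => [f k Cf Ck Cfh Ckh|f U Cf oU bU fU].
  by rewrite (convolDl EG)//; exact: CcD.
split; first by apply: bisection_convol_continuous fU _ => //; case: Ch.
pose C := [set p : G * G | [/\ supp f p.1, supp h p.2 & src p.1 = rng p.2]].
have CC : compact C.
  have -> : C = (supp f `*` supp h) `&` [set p : G * G | src p.1 = rng p.2].
    by apply/seteqP; split=> p [] => [? ? ?|[? ?] ?]; split.
  apply: compact_closedI; first by apply: compact_setX; [case: Cf|case: Ch].
  apply: closed_eq_set; first exact: (et_hausdorff EG).
    by move=> [p q]; apply: (cvg_comp _ _ cvg_fst); exact: (src_continuous EG).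
  by move=> [p q]; apply: (cvg_comp _ _ cvg_snd); exact: (et_rng EG).
have CK : compact ((fun p : G * G => gmul p.1 p.2) @` C).
  apply: continuous_compact => //; apply/subspace_continuousP => p Cp.
  have c1 : fst @ nbhs p --> p.1 by case: (p) => u v; exact: cvg_fst.
  have c2 : snd @ nbhs p --> p.2 by case: (p) => u v; exact: cvg_snd.
  apply: (et_gmul EG (F := within C (nbhs p))).
  - by apply: cvg_trans c1; apply: cvg_app; exact: cvg_within.
  - by apply: cvg_trans c2; apply: cvg_app; exact: cvg_within.
  - by case: Cp.
  - have : within C (nbhs p) C by exact: withinT.
    by apply: filterS => q [].
have clK := compact_closed (et_hausdorff EG) CK.
apply: subclosed_compact CK _; first exact: closed_closure.
rewrite [X in _ `<=` X]((closure_id _).1 clK); apply: closureS => g /= fhg.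
have [a [b [fa hb ab ->]]] := supp_convol fhg.
by exists (a, b).
Qed.

Lemma convolA f h xi : Cc f -> Cc h ->
  convol f (convol h xi) = convol (convol f h) xi.
Proof.
move=> Cf Ch; move: f Cf; apply: (Cc_ind EG) => [f k Cf Ck Cfh Ckh|f U Cf oU bU fU].
  by rewrite !(convolDl EG)// ?Cfh ?Ckh ?(convolDl EG)//; exact: convol_Cc.
apply/funext => g.
have [[a [Ua ag]]|nex] := pselect (exists a, U a /\ rng a = rng g); last first.
  rewrite (bisection_convol0 _ fU); last by move=> a Ua ag; apply: nex; exists a.
  apply/esym/fsbig1 => c /= cg; rewrite (bisection_convol0 _ fU) ?mul0r//.
  by move=> a Ua ac; apply: nex; exists a; rewrite ac.
rewrite (bisection_convol _ bU fU Ua ag) [in LHS]/convol mulr_fsumr.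
rewrite [RHS]/convol.
(* Left multiplication by [a] matches the terms of the inner sum on the left with those of the sum
   on the right. *)
rewrite [RHS](reindex_fsbig (gmul a) [set b | rng b = rng (gmul (ginv a) g)]).
  apply: eq_fsbigr => b /set_mem /=; rewrite rng_gmulV// => ba.
  rewrite (bisection_convol _ bU fU Ua) ?rng_gmul// gmulVKl// mulrA.
  by rewrite ginv_gmul// -gmulA ?rng_ginv ?src_ginv.
split=> [b /=|b c /set_mem /= + /set_mem /=|c /= cg]; rewrite ?rng_gmulV//.
- by move=> ba; rewrite rng_gmul.
- by move=> ba ca e; rewrite -(gmulVKl (esym ba)) e gmulVKl.
- by exists (gmul (ginv a) c); rewrite ?rng_gmulV ?ag ?cg// gmulKl// ag.
Qed.

Lemma convolBr f xi eta : Cc f -> convol f (xi - eta) = convol f xi - convol f eta.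
Proof.
move=> Cf; have N (k : G -> R[i]^o) : - k = (fun g => -1 * k g).
  by apply/funext => g; rewrite mulN1r.
by rewrite (convolDr EG)// N convolZr -N.
Qed.

Lemma convol_l2 f (xi : l2 R G) : Cc f -> convol f xi \in l2_pred (R := R) (G := G).
Proof.
move=> Cf; apply/mem_set => e e0.
have [M M0 fM] := convol_bounded EG Cf.
have M1 : 0 < M + 1 by rewrite ltr_wpDl.
have [|k Ck xk] := set_mem (l2funP xi) (e / (M + 1)); first by rewrite divr_gt0.
exists (convol f k); first exact: convol_Cc.
have -> : convol f xi - convol f k = convol f (l2fun xi - k).
  by rewrite convolBr.
apply: le_trans (fM _ _ xk) _; rewrite lee_fin mulrCA ler_piMr ?(ltW e0)//.
by rewrite ler_pdivrMr// mul1r lerDl.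
Qed.

End ConvolutionAlgebra.

(** * The operator algebra *)

Section Operators.
Context (R : realType) (G : groupoid) (EG : etale R G).
Implicit Types (a b g : G) (f h : G -> R[i]^o) (xi eta : l2 R G).
Implicit Types T : l2 R G -> l2 R G.

Definition cop f (Cf : Cc f) : l2 R G -> l2 R G :=
  fun xi => L2 (convol_l2 EG xi Cf).

Lemma l2_ext xi eta : (forall g, xi g = eta g) -> xi = eta.
Proof. by move=> e; apply: val_inj; apply/funext. Qed.

Lemma l2_fin xi : exists2 N : R, 0 <= N & (sqnorm xi <= N%:E)%E.
Proof.
have [f Cf xf] := set_mem (l2funP xi) 1 ltr01.
have [M M0 fM] := sqnorm_Cc_fin EG Cf.
exists (2 * 1 + 2 * M); first by rewrite addr_ge0 ?mulr_ge0.
by rewrite -[l2fun xi](subrK f); exact: sqnormD.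
Qed.

Lemma esum_ge0_sqmod (k : G -> R[i]^o) (x : G) :
  (0 <= \esum_(g in [set g | src g = src x]) (sqmod (k g))%:E)%E.
Proof. by apply: esum_ge0 => g _; rewrite lee_fin sqmod_ge0. Qed.

Lemma cstar_approx T (e : R) : cstar R G T -> 0 < e -> exists2 f, Cc f &
  forall xi (N : R), (sqnorm xi <= N%:E)%E ->
    (sqnorm (l2fun (T xi) - convol f xi)%R <= (e * N)%:E)%E.
Proof.
move=> cT e0; have [|f Cf fT] := cT (Num.sqrt e); first by rewrite sqrtr_gt0.
exists f => // xi N xiN; apply: le_trans (fT xi) _.
rewrite (sqr_sqrtr (ltW e0)) EFinM.
by apply: lee_wpmul2l; rewrite // lee_fin ltW.
Qed.

(** [cstar] compares with an extended real, which is finite by [l2_fin], so a bound for each real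
    [N] is enough. *)
Lemma cstarI T : (forall e : R, 0 < e -> exists2 f, Cc f &
  forall xi (N : R), 0 <= N -> (sqnorm xi <= N%:E)%E ->
    (sqnorm (l2fun (T xi) - convol f xi)%R <= (e * N)%:E)%E) -> cstar R G T.
Proof.
move=> H e e0; have [|f Cf fT] := H (e ^+ 2); first by rewrite exprn_gt0.
(* The arrow [x] makes the supremum one over a nonempty set, hence nonnegative; on an empty groupoid
   it would be minus infinity. *)
exists f => // xi; apply/sqnorm_leP => x.
have [N _ xiN] := l2_fin xi.
have x0 : (0 <= sqnorm xi)%E.
  by apply: le_trans (esum_ge0_sqmod xi x) _; apply: ereal_sup_ubound; exists x.
have [n n0 xn] : exists2 n : R, 0 <= n & sqnorm xi = n%:E.
  exists (fine (sqnorm xi)); first exact: fine_ge0.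
  by rewrite fineK// ge0_fin_numE// (le_lt_trans xiN)// ltry.
have := fT xi n n0; rewrite xn => /(_ (lexx _)) /sqnorm_leP /(_ x).
by rewrite EFinM.
Qed.

Lemma cop_cstar f (Cf : Cc f) : cstar R G (cop Cf).
Proof.
apply: cstarI => e e0; exists f => // xi N N0 _ /=.
rewrite subrr; apply/sqnorm_leP => x; rewrite esum1 ?lee_fin ?mulr_ge0 ?(ltW e0)// => g _.
by rewrite /sqmod/= expr0n/= addr0.
Qed.

Lemma cstar_bounded T : cstar R G T -> exists2 M : R, 0 <= M &
  forall xi (N : R), (sqnorm xi <= N%:E)%E -> (sqnorm (T xi) <= (M * N)%:E)%E.
Proof.
move=> cT; have [f Cf fT] := cstar_approx cT ltr01.
have [M M0 fM] := convol_bounded EG Cf.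
exists (2 * 1 + 2 * M); first by rewrite addr_ge0 ?mulr_ge0.
move=> xi N xN; rewrite -[l2fun (T xi)](subrK (convol f xi)).
by rewrite mulrDl -2!mulrA; apply: sqnormD; [exact: fT|exact: fM].
Qed.

Lemma cstar_lin (c : R[i]) T T' : cstar R G T -> cstar R G T' ->
  cstar R G (c *: T + T').
Proof.
move=> cT cT'; apply: cstarI => e e0.
pose k := sqmod c; have k0 : 0 <= k := sqmod_ge0 c.
(* [sqnormD] doubles both errors, hence a quarter of [e] for each; [k + 1] avoids a division by
   0. *)
have [|f Cf fT] := cstar_approx cT (e := e / 4 / (k + 1)).
  by rewrite !divr_gt0// ltr_wpDl.
have [|h Ch hT] := cstar_approx cT' (e := e / 4); first by rewrite divr_gt0.
have Ccf : Cc (fun g => c * f g) by apply: (@CcM _ _ (cst c)) => // z; exact: cvg_cst.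
exists ((fun g => c * f g) + h); first exact: CcD.
move=> xi N N0 xN.
have -> : l2fun ((c *: T + T') xi) - convol ((fun g => c * f g) + h) xi =
    (fun g => c * (l2fun (T xi) - convol f xi) g) + (l2fun (T' xi) - convol h xi).
  rewrite (convolDl EG)// convolZl; apply/funext => g.
  by rewrite !fctE /= mulrBr opprD addrACA.
have H1 := sqnormZ k0 (fun=> lexx _) (fT xi N xN).
apply: le_trans (sqnormD H1 (hT xi N xN)) _; rewrite lee_fin.
have : k * (e / 4 / (k + 1)) <= e / 4.
  by rewrite mulrA ler_pdivrMr ?ltr_wpDl// mulrC ler_wpM2l ?divr_ge0 ?ltW// ltrDl.
move=> ke; have : k * (e / 4 / (k + 1)) * N <= e / 4 * N by exact: ler_wpM2r.
rewrite !mulrA; lra.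
Qed.

(** The error splits as [(T - f) T' + f (T' - h)]. The accuracy asked of [h] depends on the norm of
    convolution by [f], so [f] is chosen first. *)
Lemma cstar_comp T T' : cstar R G T -> cstar R G T' -> cstar R G (T \o T').
Proof.
move=> cT cT'; apply: cstarI => e e0.
have [C C0 TC] := cstar_bounded cT'.
have [|f Cf fT] := cstar_approx cT (e := e / 4 / (C + 1)).
  by rewrite !divr_gt0// ltr_wpDl.
have [M M0 fM] := convol_bounded EG Cf.
have [|h Ch hT] := cstar_approx cT' (e := e / 4 / (M + 1)).
  by rewrite !divr_gt0// ltr_wpDl.
exists (convol f h); first exact: convol_Cc.
move=> xi N N0 xN.
have -> : l2fun ((T \o T') xi) - convol (convol f h) xi =
    (l2fun (T (T' xi)) - convol f (T' xi)) + convol f (l2fun (T' xi) - convol h xi).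
  by rewrite (convolBr EG)// (convolA EG)// addrA subrK.
apply: le_trans (sqnormD (fT _ _ (TC _ _ xN)) (fM _ _ (hT _ _ xN))) _.
rewrite lee_fin.
have bd (D : R) : 0 <= D -> e / 4 / (D + 1) * (D * N) <= e / 4 * N.
  move=> D0; rewrite mulrA ler_wpM2r// -mulrA ler_piMr ?divr_ge0 ?ltW//.
  by rewrite mulrC ltr_pdivrMr ?ltr_wpDl// mul1r ltrDl.
have := bd C C0; have := bd M M0.
rewrite [e / 4 / (M + 1) * (M * N)]mulrCA.
by move: (e / 4 / (C + 1) * _) (M * _) => u v; lra.
Qed.

End Operators.

(** * The diagonal *)

Lemma Cc_l2 (R : realType) (G : groupoid) (f : G -> R[i]^o) :
  Cc f -> f \in l2_pred (R := R) (G := G).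
Proof.
move=> Cf; apply/mem_set => e e0; exists f => //; rewrite subrr.
apply/sqnorm_leP => x; rewrite esum1 ?lee_fin ?(ltW e0)// => g _.
by rewrite /sqmod/= expr0n/= addr0.
Qed.

Lemma convol_diag (R : realType) (G : groupoid) (f xi : G -> R[i]^o) :
  (forall g, ~ units g -> f g = 0) -> convol f xi = fun g => f (rng g) * xi g.
Proof.
move=> f0; apply/funext => g; rewrite /convol -(fsbig_widen [set rng g])/=.
- by rewrite fsbig_set1 ginv_rng gmul_rng.
- by move=> _ -> /=; rewrite rng_rng.
move=> a [/= ag ang]; have [/unitsE ua|/f0 ->] := pselect (units a).
  by exfalso; apply: ang; rewrite -ag ua.
by rewrite mul0r.
Qed.

Section DiagonalOperators.
Context (R : realType) (X : metricType R) (S : smale X).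
Let G := crossed_groupoid S.
Let EG : etale R G := crossed_etale S.
Implicit Types (a b : X -> R[i]^o) (xi : l2 R G).

Definition unit_at (x : X) : G := orbit_arrow S 0 x.

Lemma point_continuous : continuous unit_at.
Proof. exact: orbit_arrow_continuous. Qed.

Definition base (g : G) : X := (val (g : crossed S)).1.1.
Definition tip (g : G) : X := (val (g : crossed S)).2.

Lemma base_continuous : continuous base.
Proof. exact: coord1_continuous. Qed.

Lemma rng_point g : rng g = unit_at (base g).
Proof. exact: crossed_rngE. Qed.

Lemma src_point g : src g = unit_at (tip g).
Proof. exact: crossed_srcE. Qed.

Lemma basepoint x : base (unit_at x) = x. Proof. by []. Qed.

Lemma unit_point g : units g -> g = unit_at (base g).
Proof. by move=> /unitsE <-; rewrite -rng_point. Qed.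

Definition diagf a : G -> R[i]^o :=
  fun g => if pselect (units g) then a (base g) else 0.

Lemma diagf_off a g : ~ units g -> diagf a g = 0.
Proof. by rewrite /diagf; case: pselect. Qed.

Lemma diagf_on a g : units g -> diagf a g = a (base g).
Proof. by rewrite /diagf; case: pselect. Qed.

(** The units are open, closed, and compact as an image of [X]. *)
Lemma diagf_Cc a : continuous a -> Cc (diagf a).
Proof.
move=> ca.
have cab : continuous (a \o base).
  by move=> g; apply: (cvg_comp _ _ (@base_continuous g)); exact: ca.
have uclosed : closed (@units G).
  have -> : @units G = [set g | rng g = g] by apply/seteqP; split=> g /unitsE.
  apply: closed_eq_set; [exact: (et_hausdorff EG)|exact: (et_rng EG)|].
  by move=> g; exact: cvg_id.
split.
  move=> g; have [ug|nug] := pselect (units g).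
    have N : \forall g' \near nbhs g, a (base g') = diagf a g'.
      have : nbhs g (@units G) by apply: open_nbhs_nbhs; split => //; exact: (et_units EG).
      by apply: filterS => g' ug'; rewrite diagf_on.
    by rewrite /continuous_at diagf_on//; exact: cvg_trans (near_eq_cvg N) (cab g).
  have N : \forall g' \near nbhs g, diagf a g' = 0.
    have : nbhs g (~` @units G).
      by apply: open_nbhs_nbhs; split => //; exact: closed_openC.
    by apply: filterS => g'; exact: diagf_off.
  by rewrite /continuous_at diagf_off//; exact: cvg_near_cst N.
have uK : compact (@units G).
  have -> : @units G = unit_at @` setT.
    by apply/seteqP; split=> g; [move=> /unit_point ->; exists (base g)|
      move=> [x _ <-]; exists (unit_at x) => //; rewrite rng_point].
  apply: continuous_compact; last exact: (smale_compact S).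
  by apply: continuous_subspaceT; exact: point_continuous.
apply: subclosed_compact uK _; first exact: closed_closure.
move: (closure_id (@units G)).1 => /(_ uclosed) ->.
by apply: closureS => g /=; apply: contraNP => nug; rewrite diagf_off.
Qed.

(* [mulop a] is junk when [a] is not continuous. *)
Definition mulop a : l2 R G -> l2 R G :=
  match pselect (continuous a) with
  | left ca => cop EG (diagf_Cc ca) | right _ => idfun end.

Lemma mulopE a xi g : continuous a -> mulop a xi g = a (base g) * xi g.
Proof.
move=> ca; rewrite /mulop; case: pselect => // ca' /=.
rewrite convol_diag; last exact: diagf_off.
by rewrite diagf_on ?rng_point//; exists g => //; rewrite rng_point.
Qed.

Lemma eq_mulop a (T : l2 R G -> l2 R G) : continuous a ->
  (forall xi g, T xi g = a (base g) * xi g) -> T = mulop a.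
Proof.
move=> ca TE; apply/funext => xi; apply: l2_ext => g.
by rewrite TE mulopE.
Qed.

Lemma mulop_cstar a : continuous a -> cstar R G (mulop a).
Proof.
by move=> ca; rewrite /mulop; case: pselect => // ca'; exact: cop_cstar.
Qed.

Lemma cstar_diagP (T : l2 R G -> l2 R G) :
  cstar_diag R G T <-> exists2 a, continuous a & T = mulop a.
Proof.
split=> [[f [[cf Kf] f0 Tf]]|[a ca ->]].
  exists (f \o unit_at).
    by move=> x; apply: (cvg_comp _ _ (@point_continuous x)); exact: cf.
  apply: eq_mulop.
    by move=> x; apply: (cvg_comp _ _ (@point_continuous x)); exact: cf.
  by move=> xi g; rewrite Tf convol_diag// rng_point.
exists (diagf a); split; [exact: diagf_Cc|exact: diagf_off|move=> xi].
apply/funext => g; rewrite mulopE// convol_diag; last exact: diagf_off.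
by rewrite diagf_on ?rng_point//; exists g => //; rewrite rng_point.
Qed.

Lemma mulop_cstar_diag a : continuous a -> cstar_diag R G (mulop a).
Proof. by move=> ca; apply/cstar_diagP; exists a. Qed.

Definition unit_vector : l2 R G :=
  L2 (Cc_l2 (diagf_Cc (fun x => cvg_cst (1 : R[i]^o)))).

(** For [T] in the algebra, [T unit_vector] is the function on [G] that represents [T], and its
    restriction to the units is the conditional expectation of [T] on C(X). *)
Definition symb (T : l2 R G -> l2 R G) (x : X) : R[i]^o := T unit_vector (unit_at x).

Lemma units_point x : units (unit_at x).
Proof. by exists (unit_at x) => //; rewrite rng_point. Qed.

Lemma unit_vector_point x : unit_vector (unit_at x) = 1.
Proof. by rewrite /= diagf_on//; exact: units_point. Qed.

Lemma symb_mulop a : continuous a -> symb (mulop a) = a.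
Proof.
move=> ca; apply/funext => x.
by rewrite /symb mulopE// unit_vector_point mulr1.
Qed.

Lemma mulop1 : mulop (cst 1) = idfun.
Proof.
apply/esym/eq_mulop => [x|xi g]; first exact: cvg_cst.
by rewrite mul1r.
Qed.

Lemma mulop_lin (c : R[i]) a b : continuous a -> continuous b ->
  mulop (fun x => c * a x + b x) = c *: mulop a + mulop b.
Proof.
move=> ca cb; apply/esym/eq_mulop => [x|xi g].
  by apply: cvgD; [apply: cvgM; [exact: cvg_cst|exact: ca]|exact: cb].
by rewrite mulrDl -mulrA -(mulopE xi g ca) -(mulopE xi g cb).
Qed.

Lemma mulop_comp a b : continuous a -> continuous b ->
  mulop (fun x => a x * b x) = mulop a \o mulop b.
Proof.
move=> ca cb; apply/esym/eq_mulop => [x|xi g].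
  by apply: cvgM; [exact: ca|exact: cb].
by rewrite /= !mulopE// mulrA.
Qed.

Lemma symb_diag (T : l2 R G -> l2 R G) : cstar_diag R G T ->
  continuous (symb T) /\ T = mulop (symb T).
Proof. by move=> /cstar_diagP[a ca ->]; rewrite symb_mulop. Qed.

Lemma symb_comp (T T' : l2 R G -> l2 R G) x : cstar_diag R G T ->
  cstar_diag R G T' -> symb (T \o T') x = symb T x * symb T' x.
Proof.
move=> /cstar_diagP[a ca ->] /cstar_diagP[b cb ->].
have E : mulop a (unit_vector) (unit_at x) = a x.
  by rewrite mulopE// unit_vector_point mulr1.
etransitivity; first exact: (mulopE _ _ ca).
exact: (congr2 (fun u v : R[i] => u * v) (esym E) erefl).
Qed.

End DiagonalOperators.

(** * Homogeneous operators and Gelfand duality *)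

Section Expi.
Context (R : realType).
Implicit Types x y : R.

Lemma expiD x y : expi (x + y) = expi x * expi y.
Proof.
rewrite /expi cosD sinD; apply/eqP; rewrite eq_complex /=.
by apply/andP; split; apply/eqP; ring.
Qed.

Lemma expi0 : expi 0 = 1 :> R[i].
Proof. by rewrite /expi cos0 sin0. Qed.

Lemma expi_neq0 x : expi x != 0.
Proof.
apply/eqP => e; have := expiD x (- x); rewrite subrr expi0 e mul0r.
by move/eqP; rewrite oner_eq0.
Qed.

Lemma expi_pi : expi (pi : R) = -1.
Proof. by rewrite /expi cospi sinpi; apply/eqP; rewrite eq_complex /= oppr0 !eqxx. Qed.

Lemma sqmod_expi x : sqmod (expi x) = 1.
Proof. by rewrite /sqmod /= cos2Dsin2. Qed.

Lemma expi_int_inj (m n : int) :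
  (forall t : R, expi (2 * pi * m%:~R * t) = expi (2 * pi * n%:~R * t)) -> m = n.
Proof.
move=> H; apply/eqP; apply/negP => /negP mn.
have [d [d0 mE]] : exists d : R, d != 0 /\ m%:~R = n%:~R + d.
  exists (m - n)%:~R; rewrite intr_eq0 subr_eq0; split => //.
  by rewrite -rmorphD /= addrC subrK.
(* At this [t] the two phases differ by the factor [expi pi], which is -1. *)
pose t : R := (2 * d)^-1; have := H t.
have -> : 2 * pi * m%:~R * t = 2 * pi * n%:~R * t + pi :> R.
  by rewrite mE /t; field.
rewrite expiD expi_pi mulrN1 => /eqP; rewrite eq_sym -subr_eq0 opprK -mulr2n.
by rewrite mulrn_eq0 /= (negPf (expi_neq0 _)).
Qed.

End Expi.

Section DualActionDegree.
Context (R : realType) (X : metricType R) (S : smale X).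
Let G := crossed_groupoid S.
Let EG : etale R G := crossed_etale S.
Implicit Types (f : G -> R[i]^o) (xi : l2 R G) (T : l2 R G -> l2 R G).

Lemma dcrossed_mul (g h : G) : src g = rng h ->
  dcrossed (gmul g h : crossed S) = dcrossed g + dcrossed h.
Proof. by move=> /crossed_composable gh; rewrite /dcrossed val_crossed_mul. Qed.

Lemma phase_mul (t : R) (g h : G) : src g = rng h ->
  phase t (gmul g h) = phase t g * phase t h.
Proof. by move=> gh; rewrite /phase dcrossed_mul// rmorphD/= mulrDr mulrDl expiD. Qed.

Lemma phaseN (t : R) (g : G) : phase t g * phase (- t) g = 1.
Proof. by rewrite /phase -expiD mulrN subrr expi0. Qed.

Lemma phase_unit (t : R) (g : G) : units g -> phase t g = 1.
Proof. by move=> /crossed_unitE[d0 _]; rewrite /phase d0 mulr0 mul0r expi0. Qed.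

Lemma phase_convol (t : R) f (xi : G -> R[i]^o) :
  (fun g => phase t g * convol f (fun g => phase (- t) g * xi g) g) =
  convol (fun g => phase t g * f g) xi.
Proof.
apply/funext => g; rewrite /convol mulr_fsumr; apply: eq_fsbigr => a aS.
have ag : rng a = rng g := set_mem aS.
rewrite -{1}(gmulKl ag) phase_mul ?rng_gmulV//.
set b := gmul (ginv a) g; rewrite -[RHS]mulr1 -(phaseN t b); ring.
Qed.

Lemma dual_actionE (t : R) T xi g :
  dual_action t T xi g = phase t g * T (dual_unitary (- t) xi) g.
Proof. by []. Qed.

Lemma sqnorm_phase (t : R) (xi : G -> R[i]^o) (N : R) :
  (sqnorm xi <= N%:E)%E -> (sqnorm (fun g => phase t g * xi g)%R <= N%:E)%E.
Proof.
rewrite -[X in (_ <= X%:E)%E -> _]mul1r => xN; rewrite -(mul1r N).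
by apply: sqnormZ; [|move=> g; rewrite /phase sqmod_expi|rewrite mul1r in xN].
Qed.

Lemma cstar_dual (t : R) T : cstar R G T -> cstar R G (dual_action t T).
Proof.
move=> cT; apply: (cstarI EG) => e e0; have [f Cf fT] := cstar_approx cT e0.
exists (fun g => phase t g * f g); first by apply: CcM => //; exact: phase_cont.
move=> xi N N0 xN; rewrite -phase_convol.
have -> : l2fun (dual_action t T xi) -
    (fun g => phase t g * convol f (fun g => phase (- t) g * xi g) g) =
    (fun g => phase t g * (l2fun (T (dual_unitary (- t) xi)) -
      convol f (dual_unitary (- t) xi)) g).
  by apply/funext => g; rewrite !fctE dual_actionE mulrBr.
by apply: sqnorm_phase; apply: fT; exact: sqnorm_phase.
Qed.

Definition homogeneous (k : int) T :=
  forall t : R, dual_action t T = expi (2 * pi * k%:~R * t) *: T.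

Lemma cop_homogeneous k f (Cf : Cc f) :
  (forall g, f g != 0 -> dcrossed (g : crossed S) = k) ->
  homogeneous k (cop EG Cf).
Proof.
move=> fk t; apply/funext => xi; apply: val_inj.
rewrite [LHS]phase_convol.
have -> : (fun g => phase t g * f g) =
    (fun g => expi (2 * pi * k%:~R * t) * f g).
  apply/funext => g; have [->|/fk dg] := eqVneq (f g) 0; first by rewrite !mulr0.
  by rewrite /phase dg.
by rewrite convolZl.
Qed.

(** The phase is 1 on units, so the dual unitaries fix [unit_vector] and multiply [T unit_vector] by
    a scalar. Where the latter is nonzero this scalar is [phase t g] for all [t], which determines
    the degree. *)
Lemma homogeneous_degree k T g : homogeneous k T -> T (unit_vector S) g != 0 ->
  dcrossed (g : crossed S) = k.
Proof.
move=> Tk Tg; apply: (@expi_int_inj R) => t.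
have u1 : dual_unitary (- t) (unit_vector S) = unit_vector S.
  apply: l2_ext => h /=; have [uh|nuh] := pselect (units h).
    by rewrite phase_unit// mul1r.
  by rewrite diagf_off// mulr0.
have := dual_actionE t T (unit_vector S) g.
rewrite Tk u1 => /(mulIf Tg) /esym; exact.
Qed.

End DualActionDegree.

(** * Gelfand duality on the diagonal *)

Section GradedHom.
Context (R : realType) (X Y : metricType R) (phi : smale X) (psi : smale Y).
Let G := crossed_groupoid phi.
Let H := crossed_groupoid psi.
Variable Phi : (l2 R G -> l2 R G) -> (l2 R H -> l2 R H).

(** Stated without bijectivity, so that it can be applied to an isomorphism and to its inverse
    chosen on the algebra alone. *)
Record graded_hom : Prop := GradedHom {
  gh_cstar : forall T, cstar R G T -> cstar R H (Phi T);
  gh_lin : forall (a : R[i]) T T', cstar R G T -> cstar R G T' ->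
    Phi (a *: T + T') = a *: Phi T + Phi T';
  gh_comp : forall T T', cstar R G T -> cstar R G T' ->
    Phi (T \o T') = Phi T \o Phi T';
  gh_diag : forall T, cstar_diag R G T -> cstar_diag R H (Phi T);
  gh_id : Phi idfun = idfun;
  gh_dual : forall (t : R) T, cstar R G T ->
    Phi (dual_action t T) = dual_action t (Phi T) }.

Hypothesis gPhi : graded_hom.

Lemma gh_homogeneous k T : cstar R G T -> homogeneous k T -> homogeneous k (Phi T).
Proof.
move=> cT Tk t; rewrite -gh_dual// Tk.
have cst0 : cstar R G 0.
  have -> : (0 : l2 R G -> l2 R G) = -1 *: T + T by rewrite scaleN1r addNr.
  exact: (cstar_lin (crossed_etale phi)).
(* Linearity with the scalar -1 gives [Phi 0 = - Phi 0 + Phi 0]. *)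
have Phi0 : Phi 0 = 0.
  have := gh_lin gPhi (-1) cst0 cst0; rewrite scaler0 addr0 => ->.
  by rewrite scaleN1r addNr.
have := gh_lin gPhi (expi (2 * pi * k%:~R * t)) cT cst0.
by rewrite Phi0 !addr0.
Qed.

Section Gelfand.
Variable y : Y.

Let chi (a : X -> R[i]^o) : R[i] := symb (Phi (mulop a)) y.

Let Phi_mulop (a : X -> R[i]^o) : continuous a -> cstar_diag R H (Phi (mulop a)).
Proof. by move=> ca; apply: gh_diag gPhi _ _; exact: mulop_cstar_diag. Qed.

Let chi_lin (c : R[i]) (a b : X -> R[i]^o) : continuous a -> continuous b ->
  chi (fun x => c * a x + b x) = c * chi a + chi b.
Proof.
move=> ca cb; rewrite /chi mulop_lin// gh_lin//; exact: mulop_cstar.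
Qed.

Let chi_mul (a b : X -> R[i]^o) : continuous a -> continuous b ->
  chi (fun x => a x * b x) = chi a * chi b.
Proof.
move=> ca cb; rewrite /chi mulop_comp// gh_comp//; [|exact: mulop_cstar|exact: mulop_cstar].
exact: symb_comp (Phi_mulop ca) (Phi_mulop cb).
Qed.

Let chi1 : chi (cst 1) = 1.
Proof.
rewrite /chi mulop1 (gh_id gPhi) -mulop1 symb_mulop//.
by move=> x; exact: cvg_cst.
Qed.

(** The zero sets of the functions in the kernel of [chi] generate a proper filter: a function
    without zeros is invertible, and its being in the kernel would give [chi (cst 1) = 0]. A cluster
    point exists by compactness and lies in the closed zero set of each [a - chi a]. *)
Lemma character_point : exists x, forall a : X -> R[i]^o, continuous a -> chi a = a x.
Proof.
pose N := [set a : X -> R[i]^o | continuous a /\ chi a = 0].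
pose Z (a : X -> R[i]^o) := [set x | a x = 0].
have N0 (a : X -> R[i]^o) : continuous a -> N (fun x => a x - chi a).
  move=> ca; split.
    by move=> x; apply: cvgB; [exact: ca|exact: cvg_cst].
  have c1 : continuous (cst 1 : X -> R[i]^o) by move=> x; exact: cvg_cst.
  have := chi_lin (- chi a) c1 ca; rewrite chi1 mulr1 addNr => <-.
  by congr chi; apply/funext => x; rewrite addrC.
have F : ProperFilter (filter_from N Z).
  apply: filter_from_proper; last first.
    move=> a [ca a0]; apply: contrapT => Za.
    have az x : a x != 0 by apply/eqP => ax; apply: Za; exists x.
    have cva : continuous (fun x => (a x)^-1).
      by move=> x; apply: cvgV => //; exact: ca.
    have := chi_mul cva ca; rewrite a0 mulr0.
    have -> : (fun x => (a x)^-1 * a x) = cst 1 by apply/funext => x; rewrite mulVf.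
    by rewrite chi1 => /eqP; rewrite oner_eq0.
  apply: filter_from_filter.
    by exists (fun x => cst 1 x - chi (cst 1)); apply: N0 => x; exact: cvg_cst.
  move=> a b [ca a0] [cb b0].
  have cca : continuous (fun x => Num.conj (a x) : R[i]^o).
    by move=> x; apply: (cvg_comp _ _ (ca x)); exact: conjc_continuous.
  have ccb : continuous (fun x => Num.conj (b x) : R[i]^o).
    by move=> x; apply: (cvg_comp _ _ (cb x)); exact: conjc_continuous.
  have cab : continuous (fun x => a x * Num.conj (a x) : R[i]^o).
    by move=> x; apply: cvgM; [exact: ca|exact: cca].
  have cbb : continuous (fun x => b x * Num.conj (b x) : R[i]^o).
    by move=> x; apply: cvgM; [exact: cb|exact: ccb].
  (* Its zeros are the common zeros of [a] and [b], and it stays in the kernel because the kernel is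
     an ideal. *)
  exists (fun x => 1 * (a x * Num.conj (a x)) + b x * Num.conj (b x)).
    split; first by move=> x; apply: cvgD; [apply: cvgM; [exact: cvg_cst|exact: cab]|exact: cbb].
    have Ea := etrans (chi_mul ca cca) (etrans (congr1 ( *%R^~ _) a0) (mul0r _)).
    have Eb := etrans (chi_mul cb ccb) (etrans (congr1 ( *%R^~ _) b0) (mul0r _)).
    apply: (etrans (chi_lin 1 cab cbb)).
    by apply: (etrans (congr2 (fun u v : R[i] => 1 * u + v) Ea Eb)); rewrite mulr0 addr0.
  move=> x /eqP; rewrite mul1r -!normCK paddr_eq0 ?exprn_ge0//.
  by rewrite !expf_eq0 /= !normr_eq0 => /andP[/eqP ? /eqP ?].
have [x [_ clx]] := smale_compact phi F filterT.
exists x => a ca; have [cN _] := N0 a ca.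
have : closure (Z (fun x => a x - chi a)) x.
  move=> A xA; apply: (clx _ A _ xA); exists (fun x => a x - chi a) => //; exact: N0.
have cZ : closed (Z (fun x => a x - chi a)).
  exact: (@closed_eq_set _ _ (fun x => a x - chi a) (cst 0)
    (@norm_hausdorff _ R[i]^o) cN (fun z => cvg_cst _)).
by rewrite -((closure_id _).1 cZ) /Z /= => /subr0_eq.
Qed.

End Gelfand.

Lemma gelfand_dual : exists2 k : Y -> X, continuous k &
  forall a : X -> R[i]^o, continuous a -> Phi (mulop a) = mulop (a \o k).
Proof.
have [k kP] := choice character_point.
have kE (a : X -> R[i]^o) : continuous a -> continuous (a \o k) /\ Phi (mulop a) = mulop (a \o k).
  move=> ca; have -> : a \o k = symb (Phi (mulop a)).
    by apply/funext => y /=; rewrite -kP.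
  by apply/symb_diag/(gh_diag gPhi)/mulop_cstar_diag.
exists k; last by move=> a /kE[].
move=> y; apply/metricType_numDomainType.cvgrPdist_lt => e e0.
(* For this [a], continuity of [a \o k] at [y] is continuity of [k]; and [a \o k] is continuous as
   the symbol of a diagonal operator. *)
pose a (x : X) : R[i]^o := (mdist (k y) x)%:C.
have ca : continuous a.
  move=> x; apply: (@continuous_cvg _ _ _ _ _ _ (fun x : R^o => x%:C : R[i]^o)).
    exact: real_complex_continuous.
  exact: (cvg_mdist (cvg_cst _) cvg_id).
have [cak _] := kE a ca.
have e0' : 0 < e%:C by rewrite ltcR.
have := cak y; move/cvgrPdist_lt => /(_ _ e0'); apply: filterS => z.
rewrite /a /= mdistxx sub0r normrN normc_real ltcR ger0_norm ?mdist_ge0//.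
Qed.

End GradedHom.

(** * Reconstruction of the groupoid *)

Lemma sqmod_le_sqnorm (R : realType) (G : groupoid) (xi : G -> R[i]^o) (N : R) (g : G) :
  (sqnorm xi <= N%:E)%E -> sqmod (xi g) <= N.
Proof.
move=> /sqnorm_leP/(_ g); rewrite -lee_fin; apply: le_trans.
rewrite -(@esum_set1 R G g (fun g => (sqmod (xi g))%:E)) ?lee_fin ?sqmod_ge0//.
by apply: subset_esum => _ ->.
Qed.

Lemma peak_function (R : realType) (X : metricType R) (D : set X) (x : X) :
  finite_set D -> ~ D x -> exists a : X -> R[i]^o,
    [/\ continuous a, a x = 1, forall z, sqmod (a z) <= 1 & forall z, D z -> a z = 0].
Proof.
move=> Dfin Dx.
have : nbhs x (~` D).
  apply: open_nbhs_nbhs; split => //; apply: closed_openC.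
  apply: (accessible_finite_set_closed.1 _ _ Dfin).
  exact/hausdorff_accessible/metric_hausdorff.
move=> /metricType_numDomainType.nbhs_mdistP[r /= r0 rD].
pose p z : R^o := Num.max 0 (1 - mdist x z / r).
have cp : continuous p.
  move=> z; apply: (@continuous_max _ _ (cst 0) (fun z => 1 - mdist x z / r)).
    exact: cvg_cst.
  apply: cvgB; first exact: cvg_cst.
  by apply: cvgM; [exact: (cvg_mdist (cvg_cst x) cvg_id)|exact: cvg_cst].
exists (fun z => (p z)%:C); split.
- move=> z; apply: (@continuous_cvg _ _ _ _ _ _ (fun x : R^o => x%:C : R[i]^o)).
    exact: real_complex_continuous.
  exact: cp.
- by rewrite /p mdistxx mul0r subr0 max_r.
- move=> z; rewrite /sqmod /= expr0n addr0 expr_le1// /p ?le_max ?lexx//.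
  rewrite ge_max ler01 /= gerBl divr_ge0 ?mdist_ge0//; exact: ltW.
- move=> z Dz; rewrite /p max_l// subr_le0 ler_pdivlMr// mul1r leNgt.
  by apply/negP => /rD.
Qed.

Section KeyLemma.
Context (R : realType) (X Y : metricType R) (phi : smale X) (psi : smale Y).
Let G := crossed_groupoid phi.
Let H := crossed_groupoid psi.
Let EG : etale R G := crossed_etale phi.
Let EH : etale R H := crossed_etale psi.

(* With [fv g = f (g^-1)] and [U] a bisection, [fv * (a f)] is supported on the units. *)
Section BisectionSquare.
Variables (U : set G) (f : G -> R[i]^o).
Hypotheses (bU : bisection U) (Cf : Cc f) (fU : supp f `<=` U).

Definition inversion : homeo G G :=
  Homeo (@ginvK G) (@ginvK G) (et_ginv EG) (et_ginv EG).

Let fv : G -> R[i]^o := f \o inversion.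

Lemma inversion_Cc : Cc fv.
Proof. exact: (Cc_homeo inversion Cf). Qed.

Let Uv : set G := [set g | U (ginv g)].

Let bUv : bisection Uv.
Proof.
move=> a b Ua Ub; have [H1 H2] := bU Ua Ub; split=> ab.
  by rewrite -(ginvK a) H2 ?ginvK// !src_ginv.
by rewrite -(ginvK a) H1 ?ginvK// !rng_ginv.
Qed.

Let fvU : supp fv `<=` Uv.
Proof.
move=> g fg; apply: fU => B Bg.
have [z [/= fz Bz]] := fg _ (et_ginv EG Bg).
by exists (ginv z).
Qed.

Variables (a : X -> R[i]^o) (ca : continuous a).

Let af : G -> R[i]^o := fun g => a (base g) * f g.

Let Caf : Cc af.
Proof.
apply: (CcM (u := a \o (@base _ _ phi))) => // g.
by apply: (cvg_comp _ _ (@base_continuous _ _ phi g)); exact: ca.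
Qed.

Let square0 g : ~ units g -> convol fv af g = 0.
Proof.
move=> nug; have [[b [Ub bg]]|nex] := pselect (exists b, Uv b /\ rng b = rng g).
  rewrite (bisection_convol _ bUv fvU Ub bg) /af.
  have [/fU Ubg|/supp0 ->] := pselect (supp f (gmul (ginv b) g)); last by rewrite !mulr0.
  exfalso; apply: nug; have e : ginv b = gmul (ginv b) g.
    by apply: (bU Ub Ubg).1; rewrite rng_gmulV// rng_ginv.
  by exists b => //; rewrite -gmulV e gmulKl.
by apply: (bisection_convol0 _ fvU) => b Ub bg; apply: nex; exists b.
Qed.

Let T := cop EG inversion_Cc \o (mulop (S := phi) a \o cop EG Cf).

Let TE xi : T xi = convol (convol fv af) xi :> (G -> R[i]^o).
Proof.
rewrite -(convolA EG _ inversion_Cc Caf).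
rewrite [LHS]/=; congr convol; apply/funext => g; rewrite mulopE//= /convol mulr_fsumr.
apply: eq_fsbigr => b bS; have bg : rng b = rng g := set_mem bS.
by rewrite mulrA /af; congr (a _ * _ * _); have /(congr1 (@base _ _ phi)) := bg.
Qed.

Lemma bisection_square : cstar_diag R G T /\
  forall g, U g -> symb T (tip g) = f g * (a (base g) * f g).
Proof.
split.
  exists (convol fv af); split; [exact: (convol_Cc EG inversion_Cc Caf)|exact: square0|].
  exact: TE.
move=> g Ug; rewrite /symb TE convol_diag; last exact: square0.
rewrite unit_vector_point mulr1 -src_point rng_src.
have Ug' : Uv (ginv g) by rewrite /Uv /mkset ginvK.
rewrite (bisection_convol _ bUv fvU Ug') ?rng_ginv ?rng_src//.
by rewrite ginvK gmul_src -[fv _]/(f (ginv (ginv g))) ginvK.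
Qed.

End BisectionSquare.

(** The degree is constant on [U], which makes convolution by [f] homogeneous; [f] comes from a real
    [p], so that its square stays bounded below near [g0]. *)
Lemma bump_arrow (g0 : G) : exists (U : set G) (f : G -> R[i]^o) (p : G -> R^o),
  [/\ bisection U, Cc f, supp f `<=` U, forall g, f g = (p g)%:C &
      [/\ continuous p, p g0 = 1, U g0, open U &
          forall g, U g -> dcrossed (g : crossed phi) = dcrossed (g0 : crossed phi)]].
Proof.
have [U [oU Ug0 bU]] := bisection_nbhs EG g0.
have [_ _ dg0 _] := cvg_id_crossed g0.
pose V := interior (U `&` [set g : G | dcrossed (g : crossed phi) = dcrossed (g0 : crossed phi)]).
have g0V : nbhs g0 V.
  apply: open_nbhs_nbhs; split; first exact: open_interior.
  by apply: filterI => //; exact: open_nbhs_nbhs.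
have [p [cp p1 p0 Kp pV]] := et_bump EG g0V.
exists V, (fun g => (p g)%:C), p.
have s_eq : supp (fun g => (p g)%:C : R[i]^o) `<=` closure [set g | p g != 0].
  by apply: closureS => g /=; apply: contra_neq => ->.
split => //.
- by move=> a b /interior_subset[Ua _] /interior_subset[Ub _]; exact: bU.
- split.
    by move=> g; exact: (cvg_comp _ _ (cp g) (@real_complex_continuous R (p g))).
  by apply: (subclosed_compact _ Kp s_eq); exact: closed_closure.
- exact: subset_trans pV.
split => //; first exact: nbhs_singleton g0V.
  exact: open_interior.
by move=> g /interior_subset[].
Qed.

Variables (Phi : (l2 R G -> l2 R G) -> (l2 R H -> l2 R H)) (k : Y -> X) (h : X -> Y).
Hypotheses (gPhi : graded_hom Phi) (kK : cancel k h) (hK : cancel h k).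
Hypothesis ck : continuous k.
Hypothesis Phik : forall a : X -> R[i]^o, continuous a -> Phi (mulop a) = mulop (a \o k).

Lemma Phi_symb T y : cstar_diag R G T -> symb (Phi T) y = symb T (k y).
Proof.
move=> /symb_diag[cT TE].
have E : Phi T = mulop (symb T \o k) := etrans (congr1 Phi TE) (Phik cT).
have cTk : continuous (symb T \o k).
  by move=> z; exact: (cvg_comp _ _ (@ck z) (@cT (k z))).
have E1 : symb (Phi T) y = symb (mulop (S := psi) (symb T \o k)) y.
  exact: (congr1 (fun T' : l2 R H -> l2 R H => symb T' y) E).
have E2 := symb_mulop psi cTk.
by rewrite E1 E2.
Qed.

(* If [f] is a bump on a bisection through [g0], [S = Phi (cop f)] and [q] in [Cc]
   approximates [Phi (cop fv)], then the value of [q * (a \o k) S 1] at the unit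
   [h (tip g)] is nearly [f g ^+ 2 * a (base g)]. Letting [a] peak at [base g], only the
   arrow over [(h (tip g), h (base g))] of the opposite degree can contribute. *)
Lemma arrow_lift (g0 : G) : exists2 K : set H, compact K &
  \forall g \near g0, exists b : H, [/\ K b, base b = h (tip g), tip b = h (base g) &
    dcrossed (b : crossed psi) = - dcrossed (g : crossed phi)].
Proof.
have [U [f [p [bU Cf fU fE [cp p1 Ug0 oU Ud]]]]] := bump_arrow g0.
pose n := dcrossed (g0 : crossed phi).
pose Cfv := inversion_Cc Cf.
pose S := Phi (cop EG Cf); pose P := Phi (cop EG Cfv).
pose s := S (unit_vector psi).
have Sn : homogeneous n S.
  apply: (gh_homogeneous gPhi); first exact: cop_cstar.
  apply: cop_homogeneous => g fg; apply: Ud; apply: fU; exact: subset_closure.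
have [N N0 sN] := l2_fin EH s.
have cP : cstar R H P by apply: (gh_cstar gPhi); exact: cop_cstar.
(* Near [g0] one has [p g > 1/2], so the exact value [p g * p g] exceeds [1/4] and its [sqmod]
   exceeds [1/16]; this [e] keeps the error [e * N] at most [1/16]. *)
pose e := (16 * (N + 1))^-1 : R.
have N1 : 0 < N + 1 by rewrite ltr_wpDl.
have e0 : 0 < e by rewrite invr_gt0 mulr_gt0.
have eN : e * N <= 16^-1.
  by rewrite /e invfM -mulrA ler_piMr ?invr_ge0// ler_pdivrMl// mulr1 lerDl.
have [q Cq qP] := cstar_approx cP e0.
(* [q] is chosen before [g], so one compact set serves all arrows near [g0]. *)
exists (supp q); first by case: Cq.
have pU : \forall g \near g0, U g /\ 2^-1 < p g.
  apply: filterI; first exact: open_nbhs_nbhs.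
  have := cp g0; rewrite /continuous_at p1 => /cvgrPdist_lt /(_ 2^-1).
  rewrite invr_gt0 => /(_ (ltr0n _ _)).
  by apply: filterS => g; rewrite ltr_norml => /andP[_] /=; lra.
apply: filterS pU => g [Ug pg].
apply: contrapT => nb.
pose y := h (tip g); pose x := base g.
(* The points other than [x] that are seen by the finitely many nonzero values of [q] over the unit
   at [y]; [a] is made to vanish on them. *)
pose D := (k \o (@tip _ _ psi)) @` [set b | rng b = unit_at psi y /\ q b != 0] `\ x.
have Dfin : finite_set D.
  by apply: finite_setD; apply: finite_image; exact: (finite_fiber EH).
have [a [ca ax a1 aD]] : exists a : X -> R[i]^o, [/\ continuous a, a x = 1,
    forall z, sqmod (a z) <= 1 & forall z, D z -> a z = 0].
  by apply: (peak_function Dfin) => -[_]; apply.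
have cak : continuous (a \o k).
  by move=> z; exact: (cvg_comp _ _ (@ck z) (@ca (k z))).
pose xi := mulop (a \o k) s.
have xiN : (sqnorm xi <= N%:E)%E.
  have -> : l2fun xi = (fun b => (a \o k) (base b) * s b).
    by apply/funext => b; exact: mulopE.
  rewrite -(mul1r N); apply: sqnormZ => // b; exact: a1.
have Pxi : P xi (unit_at psi y) = f g * f g.
  have c1 : cstar R G (cop EG Cf) := cop_cstar EG Cf.
  have c2 : cstar R G (cop EG Cfv) := cop_cstar EG Cfv.
  have c3 : cstar R G (mulop (S := phi) a) := mulop_cstar phi ca.
  have E1 := gh_comp gPhi c2 (cstar_comp EG c3 c1).
  have E2 := gh_comp gPhi c3 c1.
  have E := etrans E1 (congr1 (fun T => P \o T)
    (etrans E2 (congr1 (fun T => T \o S) (Phik ca)))).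
  have [dT TE] := bisection_square bU Cf fU ca.
  have ky : k y = tip g by exact: hK.
  have := Phi_symb y dT; rewrite ky (TE g Ug) -/x ax mul1r => <-.
  exact: (esym (congr1 (fun T : l2 R H -> l2 R H => symb T y) E)).
(* In the term of [b], the factor [a] forces [k (tip b) = x] and the homogeneity of [S] forces the
   degree of [b^-1], so a nonzero term would provide the arrow that [nb] excludes. *)
have qxi : convol q xi (unit_at psi y) = 0.
  apply: fsbig1 => b bS; have : rng b = rng (unit_at psi y) := bS.
  rewrite (rng_point (unit_at psi y)) basepoint => bu.
  have [->|qb] := eqVneq (q b) 0; first by rewrite mul0r.
  have -> : gmul (ginv b) (unit_at psi y) = ginv b.
    by rewrite -bu -src_ginv gmul_src.
  have -> : xi (ginv b) = a (k (tip b)) * s (ginv b) by exact: mulopE.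
  have [/aD ->|nD] := pselect (D (k (tip b))); first by rewrite mul0r mulr0.
  have [->|sb] := eqVneq (s (ginv b)) 0; first by rewrite !mulr0.
  exfalso; apply: nb; exists b; split.
  - exact: subset_closure.
  - by have := congr1 (@base _ _ psi) bu.
  - rewrite -[tip b]kK; congr h; apply: contrapT => ne; apply: nD.
    by split => //; exists b.
  - rewrite (Ud g Ug) -/n -(homogeneous_degree Sn sb).
    by rewrite /dcrossed /= opprK.
have := sqmod_le_sqnorm (unit_at psi y) (qP xi N xiN).
have -> : (l2fun (P xi) - convol q xi) (unit_at psi y) = (p g * p g)%:C.
  apply: (etrans (congr2 (fun u v : R[i] => u - v) Pxi qxi)).
  by rewrite subr0 fE -rmorphM.
rewrite /sqmod /= expr0n addr0 leNgt => /negP; apply.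
apply: le_lt_trans eN _.
have p4 : 4^-1 < p g * p g.
  have -> : 4^-1 = 2^-1 * 2^-1 :> R by field.
  by rewrite ltr_pM ?invr_ge0.
have -> : 16^-1 = 4^-1 * 4^-1 :> R by field.
by rewrite expr2 ltr_pM ?invr_ge0.
Qed.

End KeyLemma.

(** Each arrow has a neighbourhood of bounded level, and levels increase, so finitely many of these
    neighbourhoods share a level. *)
Lemma compact_level (R : realType) (Y : metricType R) (psi : smale Y)
    (K : set (crossed psi)) : compact K -> exists m, forall b, K b ->
  Ga psi m (iterz psi (dcrossed b) (val b).1.1, (val b).2).
Proof.
move=> /compact_near_coveringP cK.
have [|m _ mK] := cK nat \oo (fun m b =>
    Ga psi m (iterz psi (dcrossed b) (val b).1.1, (val b).2)) _.
  move=> b Kb; have [_ _ db [m0 mb]] := cvg_id_crossed b.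
  have N : \forall b' \near b, dcrossed b' = dcrossed b /\
      Ga psi m0 (iterz psi (dcrossed b) (val b').1.1, (val b').2) by exact: filterI.
  exists ([set b' : crossed psi | dcrossed b' = dcrossed b /\
      Ga psi m0 (iterz psi (dcrossed b) (val b').1.1, (val b').2)],
    [set m | (m0 <= m)%N]) => /=.
    by split; [exact: N|exists m0].
  by move=> [b' m] /= [[-> H] mm]; exact: Ga_mono mm H.
by exists m => b; exact: (mK m (leqnn m)).
Qed.

Section GradedCover.
Context (R : realType) (X Y : metricType R) (phi : smale X) (psi : smale Y).
Let G := crossed_groupoid phi.
Let H := crossed_groupoid psi.
Variables (Phi : (l2 R G -> l2 R G) -> (l2 R H -> l2 R H)) (k : Y -> X) (h : X -> Y).
Hypotheses (gPhi : graded_hom Phi) (kK : cancel k h) (hK : cancel h k).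
Hypotheses (ck : continuous k) (ch : continuous h).
Hypothesis Phik : forall a : X -> R[i]^o, continuous a -> Phi (mulop a) = mulop (a \o k).

Lemma graded_cover : exists2 th : crossed phi -> crossed psi,
  continuous th & covers h th.
Proof.
have lift := arrow_lift gPhi kK hK ck Phik.
pose over (g : G) (b : H) := [/\ base b = h (tip g), tip b = h (base g) &
  dcrossed (b : crossed psi) = - dcrossed (g : crossed phi)].
have over_ex g : exists b, over g b.
  have [K _ /nbhs_singleton[b [_ ? ? ?]]] := lift g; by exists b.
have [be beP] := choice over_ex.
have over_uniq g b b' : over g b -> over g b' -> b = b'.
  by move=> [H1 H2 H3] [H4 H5 H6]; apply: crossed_inj;
    [exact: etrans H1 (esym H4)|exact: etrans H2 (esym H5)|exact: etrans H3 (esym H6)].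
have cbe : continuous be.
  (* By uniqueness the arrows found in [K] are the chosen [be g], and [K] bounds their level, which
     convergence of the endpoints and of the degree does not control. *)
  move=> g0; have [K cK gK] := lift g0.
  have [H1 H2 H3 _] := cvg_id_crossed g0.
  have [b01 b02 b03] := beP g0.
  have Kbe : \forall g \near g0, K (be g).
    apply: filterS gK => g [b [Kb H4 H5 H6]].
    by rewrite (over_uniq g (be g) b (beP g)).
  have [m mK] := compact_level cK.
  apply/(cvg_crossedP (FF := nbhs_filter g0)); split.
  - rewrite -/(base (be g0)) b01.
    have := cvg_comp _ _ H2 (@ch (tip g0)); apply: cvg_trans.
    by apply: near_eq_cvg; apply: nearW => g; have [H4 _ _] := beP g; exact: esym H4.
  - rewrite -/(tip (be g0)) b02.
    have := cvg_comp _ _ H1 (@ch (base g0)); apply: cvg_trans.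
    by apply: near_eq_cvg; apply: nearW => g; have [_ H5 _] := beP g; exact: esym H5.
  - by apply: filterS H3 => g dg; have [_ _ ->] := beP g; rewrite b03 dg.
  - exists m; near=> g.
    have -> : dcrossed (be g0) = dcrossed (be g).
      have [_ _ ->] := beP g; rewrite b03; congr (- _); apply/esym; near: g.
      exact: H3.
    by apply: mK; near: g.
(* [arrow_lift] produces the reversed arrow. *)
exists (fun g => ginv (be g) : H).
  by move=> g; exact: (cvg_comp _ _ (@cbe g) (@crossed_ginv_continuous _ _ psi (be g))).
move=> g; have [H1 H2 H3] := beP g.
rewrite /= -[(val (be g)).2]/(tip (be g)) -[(val (be g)).1.1]/(base (be g)) H1 H2.
by rewrite -[(val (be g)).1.2]/(dcrossed (be g)) H3 opprK.
Unshelve. all: by end_near. Qed.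

End GradedCover.

(** * The inverse isomorphism and the two base maps *)

Section Inverse.
Context (R : realType) (X Y : metricType R) (phi : smale X) (psi : smale Y).
Let G := crossed_groupoid phi.
Let H := crossed_groupoid psi.
Let EG : etale R G := crossed_etale phi.
Variable Phi : (l2 R G -> l2 R G) -> (l2 R H -> l2 R H).
Hypothesis Phi_iso : cstar_iso Phi.
Hypothesis Phi_diag : Phi @` cstar_diag R G = cstar_diag R H.
Hypothesis Phi_dual : forall (t : R) T, cstar R G T ->
  Phi (dual_action t T) = dual_action t (Phi T).

Lemma idfun_diag (X' : metricType R) (S : smale X') :
  cstar_diag R (crossed_groupoid S) idfun.
Proof.
rewrite -(mulop1 S); apply: mulop_cstar_diag => x; exact: cvg_cst.
Qed.

Lemma diag_cstar (X' : metricType R) (S : smale X') T :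
  cstar_diag R (crossed_groupoid S) T -> cstar R (crossed_groupoid S) T.
Proof. by move=> /cstar_diagP[a ca ->]; exact: mulop_cstar. Qed.

Lemma graded_hom_iso : graded_hom Phi.
Proof.
have [[PhiC _ _] lin comp _] := Phi_iso.
have dg T : cstar_diag R G T -> cstar_diag R H (Phi T).
  by move=> dT; rewrite -Phi_diag; exists T.
split => //.
(* The identity is [Phi T] for some diagonal [T], so [Phi idfun] equals [Phi idfun \o Phi T], which
   is [Phi T] by multiplicativity. *)
have : (Phi @` cstar_diag R G) idfun by rewrite Phi_diag; exact: idfun_diag.
move=> [T dT PT].
have E := comp idfun T (diag_cstar (idfun_diag phi)) (diag_cstar dT).
have -> : Phi idfun = Phi idfun \o Phi T by rewrite PT.
by rewrite -E.
Qed.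

(** [Psi] is specified on the algebra only and arbitrary outside. Its properties are checked after
    applying [Phi], which is injective on the algebra; hence the membership conditions
    throughout. *)
Lemma graded_hom_inverse : exists2 Psi : (l2 R H -> l2 R H) -> (l2 R G -> l2 R G),
  graded_hom Psi & (forall T, cstar R G T -> Psi (Phi T) = T) /\
    (forall T, cstar R H T -> Phi (Psi T) = T).
Proof.
have gPhi := graded_hom_iso.
have [[PhiC PhiI PhiS] _ _ _] := Phi_iso.
have ex T : exists T0, cstar R H T -> cstar R G T0 /\ Phi T0 = T.
  have [cT|nT] := pselect (cstar R H T); last by exists idfun.
  by have [T0 cT0 <-] := PhiS T cT; exists T0.
have [Psi PsiP] := choice ex.
have inj T T' : cstar R G T -> cstar R G T' -> Phi T = Phi T' -> T = T'.
  by move=> cT cT'; apply: PhiI; exact: mem_set.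
have PsiC T : cstar R H T -> cstar R G (Psi T) by move=> /PsiP[].
have PsiK T : cstar R H T -> Phi (Psi T) = T by move=> /PsiP[].
have PhiK T : cstar R G T -> Psi (Phi T) = T.
  by move=> cT; apply: inj; [apply: PsiC; exact: PhiC| |apply: PsiK; exact: PhiC].
have EH : etale R H := crossed_etale psi.
exists Psi => //; split => //.
- move=> a T T' cT cT'; apply: inj; [apply: PsiC; exact: (cstar_lin EH)|
    by apply: (cstar_lin EG); exact: PsiC|].
  rewrite PsiK; last exact: (cstar_lin EH).
  by rewrite (gh_lin gPhi) ?PsiK//; exact: PsiC.
- move=> T T' cT cT'; apply: inj; [apply: PsiC; exact: (cstar_comp EH)|
    by apply: (cstar_comp EG); exact: PsiC|].
  rewrite PsiK; last exact: (cstar_comp EH).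
  by rewrite (gh_comp gPhi) ?PsiK//; exact: PsiC.
- move=> T; rewrite -Phi_diag => -[T0 dT0 <-].
  by rewrite PhiK//; exact: diag_cstar.
- by rewrite -(gh_id gPhi) PhiK//; exact: diag_cstar (idfun_diag phi).
- move=> t T cT; apply: inj; [apply: PsiC; exact: cstar_dual|
    by apply: cstar_dual; exact: PsiC|].
  rewrite PsiK; last exact: cstar_dual.
  by rewrite (gh_dual gPhi) ?PsiK//; exact: PsiC.
Qed.

Lemma iso_of_graded_cstar_iso : degree_preserving_iso phi psi.
Proof.
have gPhi := graded_hom_iso; have [Psi gPsi [PhiK PsiK]] := graded_hom_inverse.
have [k ck Phik] := gelfand_dual gPhi; have [h ch Psih] := gelfand_dual gPsi.
(* The distance to [z] separates [z] from all other points. *)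
have sep (Z : metricType R) (z z' : Z) :
    (forall a : Z -> R[i]^o, continuous a -> a z = a z') -> z = z'.
  move=> zz; pose a w : R[i]^o := (mdist z w)%:C.
  have ca : continuous a.
    move=> w; apply: (@continuous_cvg _ _ _ _ _ _ (fun x : R^o => x%:C : R[i]^o)).
      exact: real_complex_continuous.
    exact: (cvg_mdist (cvg_cst z) cvg_id).
  have := zz a ca; rewrite /a mdistxx => /complexI /esym; exact: mdist_positivity.
have hK : cancel h k.
  move=> x; apply: sep => a ca.
  have cak : continuous (a \o k).
    by move=> z; exact: (cvg_comp _ _ (@ck z) (@ca (k z))).
  have E : mulop (S := phi) a = mulop ((a \o k) \o h).
    rewrite -Psih// -Phik// PhiK//; exact: mulop_cstar.
  have cakh : continuous ((a \o k) \o h).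
    by move=> z; exact: (cvg_comp _ _ (@ch z) (@cak (h z))).
  have E1 := congr1 (fun u : X -> R[i]^o => u x) (symb_mulop phi ca).
  have E2 := congr1 (fun u : X -> R[i]^o => u x) (symb_mulop phi cakh).
  exact: (esym (etrans (esym E1)
    (etrans (congr1 (fun T : l2 R G -> l2 R G => symb T x) E) E2))).
have kK : cancel k h.
  move=> y; apply: sep => b cb.
  have cbh : continuous (b \o h).
    by move=> z; exact: (cvg_comp _ _ (@ch z) (@cb (h z))).
  have E : mulop (S := psi) b = mulop ((b \o h) \o k).
    rewrite -Phik// -Psih// PsiK//; exact: mulop_cstar.
  have cbhk : continuous ((b \o h) \o k).
    by move=> z; exact: (cvg_comp _ _ (@ck z) (@cbh (k z))).
  have E1 := congr1 (fun u : Y -> R[i]^o => u y) (symb_mulop psi cb).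
  have E2 := congr1 (fun u : Y -> R[i]^o => u y) (symb_mulop psi cbhk).
  exact: (esym (etrans (esym E1)
    (etrans (congr1 (fun T : l2 R H -> l2 R H => symb T y) E) E2))).
have [th cth thE] := graded_cover gPhi kK hK ck ch Phik.
have [th' cth' th'E] := graded_cover gPsi hK kK ch ck Psih.
exact: (@covers_iso _ _ _ phi psi (Homeo hK kK ch ck) th th').
Qed.

End Inverse.

Theorem theorem1p2 (R : realType) (X Y : metricType R)
    (phi : smale X) (psi : smale Y)
    (phi_irr : irreducible phi) (psi_irr : irreducible psi)
    (X_infinite : infinite_set [set: X]) (Y_infinite : infinite_set [set: Y]) :
  (asymptotically_conjugate phi psi <->
   exists2 h : homeo (crossed_groupoid phi) (crossed_groupoid psi),
     groupoid_iso h &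
     forall g : crossed_groupoid phi, dcrossed (h g) = dcrossed g) /\
  ((exists2 h : homeo (crossed_groupoid phi) (crossed_groupoid psi),
      groupoid_iso h &
      forall g : crossed_groupoid phi, dcrossed (h g) = dcrossed g) <->
   exists Phi :
       (l2 R (crossed_groupoid phi) -> l2 R (crossed_groupoid phi)) ->
       (l2 R (crossed_groupoid psi) -> l2 R (crossed_groupoid psi)),
     [/\ cstar_iso Phi,
         Phi @` cstar_diag R (crossed_groupoid phi) =
           cstar_diag R (crossed_groupoid psi) &
         forall (t : R) T, cstar R (crossed_groupoid phi) T ->
           Phi (dual_action t T) = dual_action t (Phi T)]).
Proof.
split; first exact: conjugate_iff_iso.
split=> [[h hh hd]|[Phi [Phi_iso Phi_diag Phi_dual]]].
  exists (conj_map hh); split.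
  - exact: cstar_iso_conj.
  - exact: cstar_diag_conj_eq.
  - by move=> t T _; exact: conj_map_dual.
exact: iso_of_graded_cstar_iso Phi_iso Phi_diag Phi_dual.
Qed.
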